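(* Let $\mathfrak s$ be a (fundamental transitive) semisimple graded $CR$ algebra of the complex type and $\mathfrak l$ a complex irreducible graded representation of $\mathfrak s$ such that $\mathfrak l_{-1}\ne0$ and $\mathfrak l_{-2}\neq0$. Then the following conditions are equivalent: (i) $\mathfrak s\oplus\mathfrak l$ is a partial Levi--Tanaka extension of $\mathfrak s$; (ii) $\mathrm{ad}(J_{\mathfrak s})$ acts as a scalar multiple of the identity on $\mathfrak l_0\oplus\mathfrak l_{-2}$; (iii) if $\lambda\in\mathscr P_{-2}$, $\alpha,\alpha'\in\mathscr R^{1,0}$, $\beta,\beta'\in\mathscr R^{0,1}$, then none of the weights $\lambda-\alpha-\alpha'$, $\lambda-\alpha+\beta$, $\lambda-\beta-\beta'$, $\lambda+\alpha-\beta$ belongs to $\mathscr P$; (iv) there exists a partition (into two disjoint, possibly empty, subsets) $\mathscr P_{-1}=\mathscr P^{1,0}\cup\mathscr P^{0,1}$ such that (a) $(\mathscr P^{1,0}\pm\mathscr B_0)\cap\mathscr P\subset\mathscr P^{1,0}$ and $(\mathscr P^{0,1}\pm\mathscr B_0)\cap\mathscr P\subset\mathscr P^{0,1}$, (b) $(\mathscr P^{1,0}+\mathscr B^{1,0})\cap\mathscr P=\emptyset$, $(\mathscr P^{1,0}-\mathscr B^{0,1})\cap\mathscr P=\emptyset$, $(\mathscr P^{0,1}+\mathscr B^{0,1})\cap\mathscr P=\emptyset$, $(\mathscr P^{0,1}-\mathscr B^{1,0})\cap\mathscr P=\emptyset$.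
   Context: Lie algebras and modules are finite dimensional. A gradation of a module $\mathfrak l$ over a $\mathbb Z$-graded Lie algebra $\mathfrak s=\bigoplus_p\mathfrak s_p$ is a decomposition $\mathfrak l=\bigoplus_{p\in\mathbb Z}\mathfrak l_p$ with $[\mathfrak s_p,\mathfrak l_q]\subset\mathfrak l_{p+q}$, where $[X,Y]=X\cdot Y$. The Abelian extension $\mathfrak s\oplus\mathfrak l$ has the bracket of $\mathfrak s$, $[X,Y]=X\cdot Y$ for $X\in\mathfrak s,Y\in\mathfrak l$, and $[\mathfrak l,\mathfrak l]=0$. For graded $\mathfrak a$: $\mathfrak a_+=\bigoplus_{p\ge0}\mathfrak a_p$. A graded module $\mathfrak l$ is transitive if $[\mathfrak s_{-1},Y]\ne\{0\}$ for all $Y\in\mathfrak l_p\setminus\{0\}$, $p\ge0$; nondegenerate if $[\mathfrak s_{-1},Y]\neq\{0\}$ for all $Y\in\mathfrak l_{-1}\setminus\{0\}$; fundamental if $\mathfrak l_{p-1}=[\mathfrak s_{-1},\mathfrak l_p]$ for all $p<0$. A graded Lie algebra has one of these properties if its adjoint module does. A graded $CR$ algebra is a graded real Lie algebra $\mathfrak s$ with a linear $J:\mathfrak s_{-1}\to\mathfrak s_{-1}$ such that $J^2=-\mathrm{Id}$, $[JX,JY]=[X,Y]$ for $X,Y\in\mathfrak s_{-1}$, and $[A,JX]=J[A,X]$ for $A\in\mathfrak s_0,X\in\mathfrak s_{-1}$. A graded $\mathfrak s$-module is $CR$ if it admits a complex structure $J$ on $\mathfrak l_{-1}$ making $\mathfrak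 s\oplus\mathfrak l$ a graded $CR$ algebra. $\mathfrak s\oplus\mathfrak l$ is a partial Levi--Tanaka extension of $\mathfrak s$ if $\mathfrak l$ is graded, transitive and $CR$, and $\mathfrak s\oplus\mathfrak l$ is fundamental and nondegenerate. ''Of the complex type''/''complex'': $\mathfrak s$ and $\mathfrak l$ are obtained from a graded complex Lie algebra and a graded complex representation of it by restriction of the base field to $\mathbb R$. $J_{\mathfrak s}\in\mathfrak s_0$ is the element with $[J_{\mathfrak s},X]=JX$ for all $X\in\mathfrak s_{-1}$ (it exists). $E_{\mathfrak s}\in\mathfrak s$ is the unique element with $[E_{\mathfrak s},X]=pX$ for $X\in\mathfrak s_p$. Fix a Cartan subalgebra $\mathfrak h$ of $\mathfrak s$ containing $E_{\mathfrak s}$, so $\mathfrak h\subset\mathfrak s_0$ and $J_{\mathfrak s}\in\mathfrak h$. $\mathscr R$ is the root system of $\mathfrak s$ and $\mathscr P$ the set of weights of $\mathfrak l$ with respect to $\mathfrak h$; $\mathscr R_p$ (resp. $\mathscr P_p$) is the set of roots (resp. weights) whose eigenspaces lie in $\mathfrak s_p$ (resp. $\mathfrak l_p$). $\mathscr R^{1,0}=\{\alpha\in\mathscr R_{-1}\mid\alpha(J_{\mathfrak s})=i\}$ and $\mathscr R^{0,1}=\{\alpha\in\mathscr R_{-1}\mid\alpha(J_{\mathfrak s})=-i\}$, so $\mathscr R_{-1}=\mathscr R^{1,0}\cup\mathscr R^{0,1}$. $\mathscr B$ is a system of simple roots of $\mathscr R$ such that the eigenspaces of the negative roots are contained in $\mathfrak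 s_+$ and $\mathscr B=\mathscr B_0\cup\mathscr B^{1,0}\cup\mathscr B^{0,1}$, where $\mathscr B_0=\mathscr B\cap\mathscr R_0$, $\mathscr B^{1,0}=\mathscr B\cap\mathscr R^{1,0}$, $\mathscr B^{0,1}=\mathscr B\cap\mathscr R^{0,1}$. For sets of weights, $A\pm B=\{a\pm b\mid a\in A,b\in B\}$.
   Formalization: (ii)⇒(i) is proved assuming no nonzero X in s_{-1} has [X,s_{-1}]=0 and X·l=0; this follows from (i), and without it the claim fails (s=sl_2⊕sl_2, l=C^2 of one factor). In (iii) each exclusion is quantified only over the roots occurring in it. *)

(* Defs.v *)
From HB Require Import structures.
From mathcomp Require Import all_boot all_order all_algebra.
From mathcomp Require Import boolp classical_sets reals.
From mathcomp.real_closed Require Import complex.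

Set Implicit Arguments.
Unset Strict Implicit.
Unset Printing Implicit Defensive.

Import Order.TTheory GRing.Theory Num.Theory.
Local Open Scope classical_set_scope.
Local Open Scope ring_scope.

(* A property of graded modules is applied to a graded Lie algebra by taking its
   bracket as the action. Finite dimension is not part of these definitions:
   they are applied to spaces that are finite dimensional over the complex
   numbers, and to the real spaces underlying them. *)

Section LieOverField.
Variable F : fieldType.

Definition subspace (V : lmodType F) (U : set V) : Prop :=
  U 0 /\ forall (a : F) x y, U x -> U y -> U (a *: x + y).

(* V is the direct sum of the V_p: existence of the decomposition, then
   uniqueness. *)
Definition gradation (V : lmodType F) (gr : int -> set V) : Prop :=
  [/\ forall p, subspace (gr p),
      forall x, exists (r : seq int) (y : int -> V),
        (forall p, gr p (y p)) /\ x = \sum_(p <- r) y p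
    & forall (r : seq int) (y : int -> V), uniq r ->
        (forall p, gr p (y p)) -> \sum_(p <- r) y p = 0 ->
        forall p, p \in r -> y p = 0].

Definition plus_part (V : lmodType F) (gr : int -> set V) : set V :=
  [set x | exists (r : seq int) (y : int -> V),
    [/\ forall p, p \in r -> 0 <= p, forall p, gr p (y p)
      & x = \sum_(p <- r) y p]].

Definition lie_algebra (g : lmodType F) (br : g -> g -> g) : Prop :=
  [/\ forall x, linear (br x), forall y, linear (br^~ y),
      forall x, br x x = 0
    & forall x y z, br x (br y z) + br y (br z x) + br z (br x y) = 0].

Definition lie_module (g M : lmodType F) (br : g -> g -> g)
    (act : g -> M -> M) : Prop :=
  [/\ forall X, linear (act X), forall Y, linear (act^~ Y)
    & forall X X' Y, act (br X X') Y = act X (act X' Y) - act X' (act X Y)].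

(* [A, U]: the linear span of the elements X . Y, for X in A and Y in U. *)
Definition bracket_span (g M : lmodType F) (act : g -> M -> M)
    (A : set g) (U : set M) : set M :=
  [set Z | exists (n : nat) (c : 'I_n -> F) (X : 'I_n -> g) (Y : 'I_n -> M),
    [/\ forall i, A (X i), forall i, U (Y i)
      & Z = \sum_(i < n) c i *: act (X i) (Y i)]].

Definition graded_module (g M : lmodType F) (br : g -> g -> g)
    (gs : int -> set g) (act : g -> M -> M) (gl : int -> set M) : Prop :=
  [/\ lie_module br act, gradation gl
    & forall p q X Y, gs p X -> gl q Y -> gl (p + q) (act X Y)].

Definition graded_lie_algebra (g : lmodType F) (br : g -> g -> g)
    (gs : int -> set g) : Prop :=
  [/\ lie_algebra br, gradation gs
    & forall p q X Y, gs p X -> gs q Y -> gs (p + q) (br X Y)].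

Definition transitive_gr (g M : lmodType F) (gs : int -> set g)
    (act : g -> M -> M) (gl : int -> set M) : Prop :=
  forall p Y, 0 <= p -> gl p Y -> Y <> 0 ->
    exists2 X, gs (-1) X & act X Y <> 0.

Definition nondegenerate_gr (g M : lmodType F) (gs : int -> set g)
    (act : g -> M -> M) (gl : int -> set M) : Prop :=
  forall Y, gl (-1) Y -> Y <> 0 -> exists2 X, gs (-1) X & act X Y <> 0.

Definition fundamental_gr (g M : lmodType F) (gs : int -> set g)
    (act : g -> M -> M) (gl : int -> set M) : Prop :=
  forall p, p < 0 -> gl (p - 1) = bracket_span act (gs (-1)) (gl p).

Definition lie_ideal (g : lmodType F) (br : g -> g -> g) (I : set g) : Prop :=
  subspace I /\ forall X Y, I Y -> I (br X Y).

Fixpoint derived_series (g : lmodType F) (br : g -> g -> g) (I : set g)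
    (n : nat) : set g :=
  if n is m.+1
  then bracket_span br (derived_series br I m) (derived_series br I m)
  else I.

Definition lie_solvable (g : lmodType F) (br : g -> g -> g) (I : set g) :
    Prop := exists n, derived_series br I n `<=` [set 0].

Definition lie_semisimple (g : lmodType F) (br : g -> g -> g) : Prop :=
  forall I, lie_ideal br I -> lie_solvable br I -> I `<=` [set 0].

Fixpoint lower_central_series (g : lmodType F) (br : g -> g -> g)
    (h : set g) (n : nat) : set g :=
  if n is m.+1 then bracket_span br h (lower_central_series br h m) else h.

Definition lie_nilpotent (g : lmodType F) (br : g -> g -> g) (h : set g) :
    Prop := exists n, lower_central_series br h n `<=` [set 0].

Definition cartan_subalgebra (g : lmodType F) (br : g -> g -> g)
    (h : set g) : Prop :=
  [/\ subspace h, forall X Y, h X -> h Y -> h (br X Y), lie_nilpotent br h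
    & forall X, (forall Y, h Y -> h (br X Y)) -> h X].

Definition lie_irreducible (g M : lmodType F) (act : g -> M -> M) : Prop :=
  [set: M] <> [set 0] /\
  forall U : set M, subspace U -> (forall X Y, U Y -> U (act X Y)) ->
    U = [set 0] \/ U = [set: M].

Definition ext_bracket (g M : lmodType F) (br : g -> g -> g)
    (act : g -> M -> M) (u v : g * M) : g * M :=
  (br u.1 v.1, act u.1 v.2 - act v.1 u.2).

Definition ext_grading (g M : lmodType F) (gs : int -> set g)
    (gl : int -> set M) (p : int) : set (g * M) := gs p `*` gl p.

End LieOverField.

Section CR.
Variable R : realType.

(* J is a map on the whole of g, but only its restriction to the component of
   degree -1 matters. *)
Definition graded_CR_algebra (g : lmodType R) (br : g -> g -> g)
    (gs : int -> set g) (J : g -> g) : Prop :=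
  graded_lie_algebra br gs /\
  [/\ forall X, gs (-1) X -> gs (-1) (J X),
      forall (a : R) X Y, gs (-1) X -> gs (-1) Y ->
        J (a *: X + Y) = a *: J X + J Y,
      forall X, gs (-1) X -> J (J X) = - X,
      forall X Y, gs (-1) X -> gs (-1) Y -> br (J X) (J Y) = br X Y
    & forall A X, gs 0 A -> gs (-1) X -> br A (J X) = J (br A X)].

Definition CR_module (g M : lmodType R) (br : g -> g -> g)
    (gs : int -> set g) (J : g -> g) (act : g -> M -> M)
    (gl : int -> set M) : Prop :=
  exists J' : M -> M,
    graded_CR_algebra (ext_bracket br act) (ext_grading gs gl)
      (fun u => (J u.1, J' u.2)).

(* No nonzero element of s_{-1} acts trivially both on s_{-1} and on l. This is
   necessary for the nondegeneracy of the Abelian extension and can fail for a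
   semisimple s: let s be the sum of two copies of sl_2, each graded in degrees
   -1, 0, 1, and l the standard module of the first copy, in degrees -1, -2. *)
Definition trivial_common_kernel (g M : lmodType R) (br : g -> g -> g)
    (gs : int -> set g) (act : g -> M -> M) : Prop :=
  forall X, gs (-1) X -> (forall X', gs (-1) X' -> br X X' = 0) ->
    (forall Y, act X Y = 0) -> X = 0.

Definition partial_Levi_Tanaka (g M : lmodType R) (br : g -> g -> g)
    (gs : int -> set g) (J : g -> g) (act : g -> M -> M)
    (gl : int -> set M) : Prop :=
  [/\ graded_module br gs act gl, transitive_gr gs act gl,
      CR_module br gs J act gl,
      fundamental_gr (ext_grading gs gl) (ext_bracket br act)
        (ext_grading gs gl)
    & nondegenerate_gr (ext_grading gs gl) (ext_bracket br act)
        (ext_grading gs gl)].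

End CR.

Definition realified (R : realType) (V : lmodType R[i]) : Type := V.

Section Realified.
Variables (R : realType) (V : lmodType R[i]).

HB.instance Definition _ := GRing.Zmodule.on (realified V).

Let rscale (a : R) (x : realified V) : realified V := a%:C%C *: (x : V).

Let rscaleA a b x : rscale a (rscale b x) = rscale (a * b) x.
Proof. by rewrite /rscale scalerA rmorphM. Qed.
Let rscale1 : left_id 1 rscale.
Proof. by move=> x; rewrite /rscale rmorph1 scale1r. Qed.
Let rscaleDr : right_distributive rscale +%R.
Proof. by move=> a x y; rewrite /rscale scalerDr. Qed.
Let rscaleDl x : {morph rscale^~ x : a b / a + b}.
Proof. by move=> a b; rewrite /rscale rmorphD scalerDl. Qed.

HB.instance Definition _ := GRing.Zmodule_isLmodule.Build R (realified V)
  rscaleA rscale1 rscaleDr rscaleDl.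

End Realified.

Section Weights.
Variables (C : fieldType) (s : vectType C) (br : s -> s -> s).
Variables (gs : int -> set s) (h : {vspace s}).

Local Notation dual := 'Hom(subvs_of h, C^o).

Definition weight_space (l : vectType C) (act : s -> l -> l) (lambda : dual) :
    set l :=
  [set Y | forall H : subvs_of h, act (vsval H) Y = lambda H *: Y].

Definition weights (l : vectType C) (act : s -> l -> l) : set dual :=
  [set lambda | weight_space act lambda <> [set 0]].

Definition weights_in (l : vectType C) (act : s -> l -> l)
    (gl : int -> set l) (p : int) : set dual :=
  [set lambda | weights act lambda /\ weight_space act lambda `<=` gl p].

(* The zero functional is a weight of the adjoint module, but not a root. *)
Definition roots : set dual := weights br `\ 0.

Definition roots_in (p : int) : set dual := weights_in br gs p `\ 0.

(* The roots in R_{-1} taking the value c at H, which is to be in h: vsproj h H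
   is then H as an element of h. *)
Definition roots_at (H : s) (c : C) : set dual :=
  [set alpha | roots_in (-1) alpha /\ alpha (vsproj h H) = c].

Definition simple_roots (B : seq dual) : Prop :=
  [/\ free B, forall alpha, alpha \in B -> roots alpha
    & forall alpha, roots alpha -> exists k : dual -> nat,
        alpha = \sum_(b <- B) b *+ k b \/ alpha = - \sum_(b <- B) b *+ k b].

Definition negative_root (B : seq dual) : set dual :=
  [set alpha | roots alpha /\
     exists k : dual -> nat, alpha = - \sum_(b <- B) b *+ k b].

End Weights.

Definition sum_set (V : zmodType) (A B : set V) : set V :=
  [set a + b | a in A & b in B].

Definition diff_set (V : zmodType) (A B : set V) : set V :=
  [set a - b | a in A & b in B].

(* P and Pm2 are to be the sets of all weights and of the weights in degree -2,
   R10 and R01 sets of roots. Each excluded weight is quantified over the roots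
   occurring in it only, so that the condition is not void if R10 or R01 is
   empty. *)
Definition no_forbidden_weight (V : zmodType) (P Pm2 R10 R01 : set V) : Prop :=
  forall lambda, Pm2 lambda ->
    [/\ forall alpha alpha', R10 alpha -> R10 alpha' ->
          ~ P (lambda - alpha - alpha'),
        forall alpha beta, R10 alpha -> R01 beta -> ~ P (lambda - alpha + beta),
        forall beta beta', R01 beta -> R01 beta' -> ~ P (lambda - beta - beta')
      & forall alpha beta, R10 alpha -> R01 beta -> ~ P (lambda + alpha - beta)].

(* P and Pm1 are to be the sets of all weights and of the weights in degree -1,
   and B0, B10, B01 the parts of a set of simple roots. *)
Definition CR_partition (V : zmodType) (P Pm1 B0 B10 B01 : set V) : Prop :=
  exists P10 P01 : set V,
    [/\ Pm1 = P10 `|` P01, P10 `&` P01 = set0,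
        [/\ sum_set P10 B0 `&` P `<=` P10, diff_set P10 B0 `&` P `<=` P10,
            sum_set P01 B0 `&` P `<=` P01 & diff_set P01 B0 `&` P `<=` P01]
      & [/\ sum_set P10 B10 `&` P = set0, diff_set P10 B01 `&` P = set0,
            sum_set P01 B01 `&` P = set0 & diff_set P01 B10 `&` P = set0]].

(* Main.v *)
(* Condition (ii) is the pivot: it says that [J_s - c] is a candidate for the complex
   structure of [l_{-1}]. If (ii) holds, [(J_s - c)^2 = -1] on [l_{-1}], as this becomes
   true after applying any element of [s_{-1}] and [s_{-1}] annihilates no nonzero
   vector of [l_{-1}]; all the requirements of (i), and the partition of (iv) according to
   the values of the weights at [J_s], follow.

   Conversely, suppose that [l_{-1}] is the sum of [s_0]-submodules [L^e], [e = i, -i], such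
   that the [e]-eigenspaces of [ad J_s] in [s_{-1}] and in [s_1] annihilate [L^e]. Starting
   from an eigenvector of [J_s] in some [L^e], the irreducibility of [l] gives (ii).
   Under (iv) the [L^e] are sums of weight spaces, and the annihilation is proved by
   induction on the height of the roots. Under (i) they are the eigenspaces of the complex
   structure, which nondegeneracy makes complex linear; [s_{-1}] then behaves well by
   definition, and [s_1] by a trace computation on root strings. Under (iii), the
   vectors of [l_{-2}] in an eigenspace of [J_s] generate [l], and no path along weights
   leads from them to another eigenvalue in degrees -2 and 0.

   The structure theory of [s] rests on the Killing form, whose nondegeneracy is derived
   from the absence of abelian ideals through traces of semisimple parts. *)

Require Import Defs.
From HB Require Import structures.
From mathcomp Require Import all_boot all_order all_algebra.
From mathcomp Require Import boolp classical_sets reals.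
From mathcomp.real_closed Require Import complex.
From mathcomp Require Import zify ring.

Set Implicit Arguments.
Unset Strict Implicit.
Unset Printing Implicit Defensive.

Import Order.TTheory GRing.Theory Num.Theory.
Local Open Scope classical_set_scope.
Local Open Scope ring_scope.

(** * Linear algebra *)

(** Irreducibility enters the passages to (ii) through one device, [ladder_full]: a nonzero subspace
    of a single component that is preserved by [s_0], by [s_1 s_{-1}] and by [s_{-1} s_1] is the
    whole component, and the other components arise from it by repeated steps up or down. Statements
    on [l] are thus reduced to products of one element of degree 1 and one of degree -1, which is
    why a splitting of [l_{-1}] alone is enough.

    The obstacle in starting from (i) is that the axioms of a CR module do not mention [s_1]. A
    vector of [L^e] that the [e] part of [s_1] does not annihilate is shown, by means of a root
    string, to be an image of [l_0], hence to lie in [L^{-e}] as well.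

    Modules over [sl_2] and complete reducibility are not invoked. Their place is taken by one
    remark: an element of [[A, B]] is traceless on every subspace stable under [A] and [B]. It is
    played against the signs of the eigenvalues of a degree operator. *)

Section Subspaces.
Variables (F : fieldType) (V : lmodType F).
Implicit Types (A : set V).

Lemma subspace_sum A (I : Type) (r : seq I) (P : pred I) (x : I -> V) :
  subspace A -> (forall i, P i -> A (x i)) -> A (\sum_(i <- r | P i) x i).
Proof.
move=> [A0 AD] Ax; apply: (big_ind A) => // u v Au Av.
by rewrite -[u]scale1r; apply: AD.
Qed.

Lemma subspaceZ A a x : subspace A -> A x -> A (a *: x).
Proof. by move=> [A0 AD] Ax; rewrite -[_ *: _]addr0; apply: AD. Qed.

Lemma subspaceD A x y : subspace A -> A x -> A y -> A (x + y).
Proof. by move=> [A0 AD] Ax Ay; rewrite -[x]scale1r; apply: AD. Qed.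

End Subspaces.

Section Span.
Variables (F : fieldType) (V : vectType F).
Implicit Types (A : set V) (U W : {vspace V}).

Lemma spanning_seq_exists A : exists X : seq V,
  (forall x, x \in X -> A x) /\ forall v, A v -> v \in <<X>>%VS.
Proof.
suff main k X : (forall x, x \in X -> A x) -> (\dim {:V} - \dim <<X>> <= k)%N ->
    exists X : seq V, (forall x, x \in X -> A x)
    /\ forall v, A v -> v \in <<X>>%VS.
  by apply: (main _ [::]) (leqnn _).
elim: k X => [|k IHk] X XA.
  rewrite leqn0 subn_eq0 => dX; exists X; split=> // v _.
  suff /eqP-> : <<X>>%VS == fullv by rewrite memvf.
  by rewrite eqEdim subvf.
move=> dX; have [AX|/existsNP[v /not_implyP[Av /negP vX]]] :=
  pselect (forall v, A v -> v \in <<X>>%VS); first by exists X.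
apply: (IHk (v :: X)) => [x|].
  by rewrite inE => /predU1P[->|/XA].
have ltX : (\dim <<X>> < \dim <<v :: X>>)%N.
  rewrite ltnNge; apply: contra vX => dvX.
  have /eqP-> : <<X>>%VS == <<v :: X>>%VS.
    by rewrite eqEdim dvX andbT; apply: sub_span => x Xx; rewrite inE Xx orbT.
  by apply: memv_span; rewrite mem_head.
by move: dX ltX; lia.
Qed.

(** The span of an arbitrary set, as a [{vspace V}]. Subspaces given by a predicate thus acquire a
    dimension and lattice operations, and [vsp_ind] reduces a linear property to generators. *)
Definition vsp A : {vspace V} := <<sval (cid (spanning_seq_exists A))>>%VS.

Lemma mem_vsp A v : A v -> v \in vsp A.
Proof. by rewrite /vsp; case: cid => X /= [_]; apply. Qed.

Lemma vsp_sub A U : (forall v, A v -> v \in U) -> (vsp A <= U)%VS.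
Proof.
rewrite /vsp; case: cid => X /= [XA _] AU.
by apply/span_subvP => x /XA; apply: AU.
Qed.

Lemma vspP A v : subspace A -> v \in vsp A <-> A v.
Proof.
move=> sA; split=> [|/mem_vsp//]; rewrite /vsp; case: cid => X /= [XA _].
move=> /(coord_span (X := in_tuple X))->; apply: subspace_sum => // i _.
by apply: subspaceZ => //; apply: XA; apply: mem_nth.
Qed.

Lemma vsp_ind A (Q : set V) v :
  subspace Q -> (forall x, A x -> Q x) -> v \in vsp A -> Q v.
Proof.
move=> sQ AQ vA; rewrite -(vspP _ sQ); move: v vA; apply/subvP.
by apply: vsp_sub => x /AQ Qx; rewrite (vspP _ sQ).
Qed.

Lemma subspace_vspace U : subspace [set` U].
Proof. by split=> [|a x y] /=; [exact: mem0v | move=> ? ?; rewrite memvD ?memvZ]. Qed.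

Lemma vspace0P U : U = 0%VS <-> (forall v, v \in U -> v = 0).
Proof.
split=> [-> v|U0]; first by rewrite memv0 => /eqP.
by apply/eqP; rewrite -subv0; apply/subvP => v /U0->; rewrite mem0v.
Qed.

Lemma vspaceN0P U : U <> 0%VS -> exists2 v, v \in U & v != 0.
Proof. by move/eqP; rewrite -vpick0 => ?; exists (vpick U) => //; apply: memv_pick. Qed.

End Span.

Section Linfun.
Variables (F : fieldType) (U V : vectType F).

Lemma linfunE (f : U -> V) : linear f -> linfun f =1 f.
Proof.
by move=> lf; pose f' : {linear U -> V} := HB.pack f (GRing.isLinear.Build F U V _ f lf);
  exact: (lfunE f').
Qed.

Lemma subspace_ker (f : 'Hom(U, V)) (A : set V) :
  subspace A -> subspace [set x | A (f x)].
Proof. by case=> A0 AD; split=> [|a x y] /=; rewrite ?linear0 // linearP; apply: AD. Qed.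

End Linfun.

(** * Traces of endomorphisms *)

Section Trace.
Import passmx.
Variable C : numClosedFieldType.

Definition ltr (V : vectType C) (f : 'End(V)) : C :=
  \tr (mxof (vbasis fullv) (vbasis fullv) f).

Lemma ltr_linear (V : vectType C) : linear_for *%R (@ltr V).
Proof. by move=> a f g; rewrite /ltr !linearP. Qed.

HB.instance Definition _ (V : vectType C) :=
  GRing.isLinear.Build C 'End(V) C _ (@ltr V) (@ltr_linear V).

Lemma ltrC (U V : vectType C) (f : 'Hom(U, V)) (g : 'Hom(V, U)) :
  ltr (f \o g)%VF = ltr (g \o f)%VF.
Proof.
by rewrite /ltr !(mxof_comp _ _ (vbasisP _)) mxtrace_mulC.
Qed.

Lemma ltr1 (V : vectType C) : ltr (\1 : 'End(V))%VF = (dim V)%:R.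
Proof. by rewrite /ltr mxof1 ?(basis_free (vbasisP _)) // mxtrace1 dimvf. Qed.

Variable V : vectType C.
Implicit Types (f g p : 'End(V)) (U W : {vspace V}).

(** [p] factors through its image as an inclusion after a projection; composed in the other order
    they give the identity of the image, with the same trace. *)
Lemma ltr_idem p : (p \o p)%VF = p -> ltr p = (\dim (limg p))%:R.
Proof.
move=> pp; set W := limg p; pose i := linfun (vsval : subvs_of W -> V).
pose q := (linfun (vsproj W) \o p)%VF.
have pW v : v \in W -> p v = v.
  by move=> /memv_imgP[u _ ->]; rewrite -comp_lfunE pp.
have -> : p = (i \o q)%VF.
  apply/lfunP => v; rewrite !comp_lfunE !lfunE /= vsprojK //.
  by apply: memv_img; rewrite memvf.
rewrite ltrC; suff -> : (q \o i)%VF = \1%VF by rewrite ltr1 -dimvf dimvf.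
apply/lfunP => w; rewrite !comp_lfunE !lfunE /= pW ?vsvalK //.
exact: subvsP.
Qed.

(** [f] maps [U k] into [U k.+1], so by cyclicity its trace may be computed on [U k.+1] instead of
    [U k]; iterating, it is computed on the zero space. *)
Lemma ltr_nilp f N : (forall v, iter N f v = 0) -> ltr f = 0.
Proof.
move=> fN; pose U k := iter k (lfun_img f) fullv.
have stepU k : (U k.+1 <= U k)%VS.
  by elim: k => [|k IHk]; [exact: subvf | exact: limgS].
have step k : ltr (f \o projv (U k))%VF = ltr (f \o projv (U k.+1))%VF.
  have -> : (f \o projv (U k))%VF = (projv (U k.+1) \o (f \o projv (U k)))%VF.
    apply/lfunP => v; rewrite !comp_lfunE [RHS]projv_id //.
    by apply: memv_img; apply: memv_proj.
  rewrite ltrC -comp_lfunA; congr (ltr (f \o _)%VF).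
  apply/lfunP => v; rewrite comp_lfunE [LHS]projv_id //.
  by apply: (subvP (stepU k)); apply: memv_proj.
have UN k v : v \in U k -> exists w, v = iter k f w.
  elim: k v => [|k IHk] v; first by exists v.
  by move=> /memv_imgP[w /IHk[u ->] ->]; exists u.
have -> : ltr f = ltr (f \o projv (U N))%VF.
  elim: (N) => [|k IHk]; last by rewrite -step.
  by congr ltr; apply/lfunP => v; rewrite comp_lfunE projv_id ?memvf.
suff -> : (f \o projv (U N))%VF = 0 by rewrite linear0.
apply/lfunP => v; rewrite comp_lfunE zero_lfunE.
by have [w ->] := UN N _ (memv_proj (U N) v); rewrite fN linear0.
Qed.

Definition lstable f U := forall v, v \in U -> f v \in U.

(** For a stable [U], [f \o projv U] has the trace of the restriction of [f] to [U]; this form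
    avoids endomorphisms of subspaces. *)
Lemma ltr_comm_stable f g U : lstable f U -> lstable g U ->
  ltr (((f \o g) - (g \o f)) \o projv U)%VF = 0.
Proof.
move=> fU gU; rewrite comp_lfunDl comp_lfunNl raddfB /=.
have stab k : lstable k U -> (projv U \o (k \o projv U))%VF = (k \o projv U)%VF.
  by move=> kU; apply/lfunP => v; rewrite !comp_lfunE [LHS]projv_id ?kU ?memv_proj.
rewrite -!comp_lfunA -(stab g gU) -[in X in _ - X](stab f fU).
by rewrite (comp_lfunA f) (comp_lfunA g) ltrC subrr.
Qed.

End Trace.

(** * Generalized eigenspaces and their projectors *)

Section GeneralizedEigenspaces.
Import passmx.
Variable C : numClosedFieldType.

(** Powers of distinct linear factors are coprime. Evaluated at a matrix, the terms of the sum
    become its spectral projectors. *)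
Lemma bezout_powers (r : seq C) N : uniq r -> r != [::] ->
  exists u : C -> {poly C},
    \sum_(a <- r) u a * \prod_(b <- r | b != a) ('X - b%:P) ^+ N = 1.
Proof.
elim: r => [//|x r IHr] /= /andP[xr ur] _.
have [->|r0] := eqVneq r [::].
  by exists (fun=> 1); rewrite big_seq1 mul1r big_cons big_nil eqxx.
have [u Du] := IHr ur r0.
have /Bezout_eq1_coprimepP[[s t] /= Dst] :
    coprimep (('X - x%:P) ^+ N) (\prod_(b <- r) ('X - b%:P) ^+ N).
  elim: (r) xr => [|y r' IH]; first by rewrite big_nil coprimep1.
  rewrite inE negb_or => /andP[xy xr']; rewrite big_cons coprimepMr IH // andbT.
  by rewrite coprimep_expl // coprimep_expr // coprimep_XsubC2 // subr_eq0 eq_sym.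
exists (fun a => if a == x then t else s * u a).
rewrite -[RHS]Dst -[s in RHS]mulr1 -[X in _ = s * X * _ + _]Du.
rewrite big_cons eqxx big_cons eqxx /= addrC; congr (_ + _).
  rewrite -mulrA mulr_suml mulr_sumr.
  rewrite big_seq [RHS]big_seq; apply: eq_bigr => a ra.
  have ax : a != x by apply: contraNneq xr => <-.
  by rewrite (negPf ax) big_cons (eq_sym x) ax /=; ring.
congr (_ * _); rewrite big_seq_cond [RHS]big_seq; apply: eq_bigl => b.
by rewrite andb_idr // => br; apply: contraNneq xr => <-.
Qed.

(** The projectors are polynomials in [A]. The last clause is the induction along Horner's scheme:
    it gives them every property that [B *m A + c%:M] inherits from [B], such as commutation and
    stability. *)
Lemma mx_generalized_projectors n (A : 'M[C]_n) :
  exists (r : seq C) (p : C -> 'M[C]_n) (N : nat),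
  [/\ uniq r, \sum_(a <- r) p a = 1%:M,
      forall a b, a \in r -> b \in r -> a != b -> p a *m p b = 0,
      forall a, a \in r -> iter N (mulmx^~ (A - a%:M)) (p a) = 0
    & forall (Q : set 'M[C]_n) a, Q 0 ->
        (forall B c, Q B -> Q (B *m A + c%:M)) -> Q (p a)].
Proof.
case: n A => [|n] A.
  by exists [::], (fun=> 0), 0%N; split=> //; rewrite big_nil [RHS]flatmx0.
have [rs Drs] := closed_field_poly_normal (char_poly A).
rewrite (monicP (char_poly_monic A)) scale1r in Drs.
(* [N] bounds all multiplicities, so that the characteristic polynomial divides [P]. *)
pose r := undup rs; pose N := size rs.
pose P := \prod_(a <- r) ('X - a%:P) ^+ N.
have PA q : P %| q -> horner_mx A q = 0.
  move=> Pq; suff /dvdpP[q' ->] : char_poly A %| q.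
    by rewrite rmorphM /= (Cayley_Hamilton A) mulr0.
  apply: dvdp_trans Pq; rewrite Drs /P /r /N.
  have : {subset rs <= undup rs} by move=> z; rewrite mem_undup.
  elim: (rs) (undup rs) => [|z rs' IH] r' sub; first by rewrite big_nil dvd1p.
  under [X in _ %| X]eq_bigr do rewrite exprS.
  rewrite big_cons big_split /= dvdp_mul ?IH //.
    have zr' : z \in r' by apply: sub; rewrite mem_head.
    by rewrite (perm_big _ (perm_to_rem zr')) big_cons dvdp_mulr.
  by move=> y ry; apply: sub; rewrite inE ry orbT.
have r0 : r != [::].
  have := size_char_poly A; rewrite Drs size_prod_XsubC => -[sz].
  by apply: contra_eqN sz => /eqP /undup_nil ->.
have [u Du] := bezout_powers N (undup_uniq rs) r0.
pose e a := u a * \prod_(b <- r | b != a) ('X - b%:P) ^+ N.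
have PE a : a \in r -> P = ('X - a%:P) ^+ N * \prod_(b <- r | b != a) ('X - b%:P) ^+ N.
  by move=> ar; rewrite /P (bigD1_seq a) ?undup_uniq.
exists r, (fun a => horner_mx A (e a)), N; split=> [|||a ar|Q a Q0 QA].
- exact: undup_uniq.
- by rewrite -rmorph_sum /= Du rmorph1.
- move=> a b ar br ab; rewrite [_ *m _](esym (rmorphM _ _ _)) /= PA // (PE a ar).
  rewrite /e mulrACA dvdp_mull // [X in _ %| X]mulrC dvdp_mul //.
  by rewrite (perm_big _ (perm_to_rem ar)) big_cons ab dvdp_mulr.
- have iterE k B : iter k (mulmx^~ (A - a%:M)) B = B * (A - a%:M) ^+ k.
    by elim: k => [|k IHk]; rewrite /= ?expr0 ?mulr1 // IHk exprSr mulrA.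
  have DA : A - a%:M = horner_mx A ('X - a%:P).
    by rewrite rmorphB /= horner_mx_X horner_mx_C.
  by rewrite iterE DA -rmorphXn -rmorphM /= PA // (PE a ar) /e -mulrA [X in _ %| _ * X]mulrC dvdp_mull.
- elim/poly_ind: (e a) => [|q c IHq]; first by rewrite rmorph0.
  by rewrite rmorphD rmorphM /= horner_mx_X horner_mx_C; apply: QA.
Qed.

Variable V : vectType C.
Implicit Types (f g : 'End(V)) (U : {vspace V}) (v : V).

Definition shift f a : 'End(V) := f - a *: \1%VF.

Lemma shiftE f a v : shift f a v = f v - a *: v.
Proof. by rewrite /shift add_lfunE opp_lfunE scale_lfunE id_lfunE. Qed.

Lemma lfun_generalized_projectors f :
  exists (r : seq C) (p : C -> 'End(V)) (N : nat),
  [/\ uniq r, forall v, v = \sum_(a <- r) p a v,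
      forall a b v, a \in r -> b \in r -> a != b -> p a (p b v) = 0,
      forall a v, a \in r -> iter N (shift f a) (p a v) = 0
    & forall (Q : set 'End(V)) a, Q 0 ->
        (forall g c, Q g -> Q (f \o g + c *: \1)%VF) -> Q (p a)].
Proof.
set e := vbasis (fullv : {vspace V}).
have be : basis_of fullv e := vbasisP _.
have [r [p [N [ur sp pp Np Qp]]]] := mx_generalized_projectors (mxof e e f).
have hM A B : (hommx e e (A *m B) = hommx e e B \o hommx e e A)%VF.
  exact: hommx_mul.
have hf : hommx e e (mxof e e f) = f by rewrite mxofK.
have h1 c : hommx e e c%:M = c *: \1%VF.
  by rewrite -scalemx1 linearZ /= hommx1.
exists r, (fun a => hommx e e (p a)), N; split=> // [v|a b v ar br ab|a v ar|Q a Q0 QA].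
- rewrite -sum_lfunE -linear_sum sp /=.
  by have /= -> := h1 1; rewrite scale1r id_lfunE.
- by rewrite -comp_lfunE -hM pp // 1?eq_sym // linear0 zero_lfunE.
- have hS : hommx e e (mxof e e f - a%:M) = shift f a.
    by rewrite linearB /= hf h1.
  have iterE k B : hommx e e (iter k (mulmx^~ (mxof e e f - a%:M)) B) v
      = iter k (shift f a) (hommx e e B v).
    by elim: k => [//|k IHk]; rewrite /= hM hS comp_lfunE IHk.
  by rewrite -iterE Np // linear0 zero_lfunE.
- apply: (Qp (fun A => Q (hommx e e A))) => [|B c QB]; first by rewrite linear0.
  by rewrite linearD /= hM hf h1; apply: QA.
Qed.

Definition gen_eigen f a v := exists n, iter n (shift f a) v = 0.

(** Over an algebraically closed field this amounts to being spanned by eigenvectors, see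
    [diagonalizable_spanned]; in this form it applies directly to the images of [genproj]. *)
Definition diagonalizable f := forall a v, gen_eigen f a v -> f v = a *: v.

Lemma iter_commute f g n v : (forall v, g (f v) = f (g v)) ->
  g (iter n f v) = iter n f (g v).
Proof. by move=> fg; elim: n => //= n IHn; rewrite fg IHn. Qed.

Lemma iter_lfun0 f n : iter n f 0 = 0.
Proof. by elim: n => //= n ->; rewrite linear0. Qed.

Lemma iter_lfunP f n a u v : iter n f (a *: u + v) = a *: iter n f u + iter n f v.
Proof. by elim: n => //= n ->; rewrite linearP. Qed.

Lemma iter_lfun_eq0 f n m v : (n <= m)%N -> iter n f v = 0 -> iter m f v = 0.
Proof. by move=> /subnK<-; rewrite iterD => ->; rewrite iter_lfun0. Qed.

Lemma shift_commute f g a v : (forall v, g (f v) = f (g v)) ->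
  g (shift f a v) = shift f a (g v).
Proof. by move=> fg; rewrite !shiftE linearB linearZ /= fg. Qed.

Lemma gen_eigen_commute f g a v : (forall v, g (f v) = f (g v)) ->
  gen_eigen f a v -> gen_eigen f a (g v).
Proof.
move=> fg [n fn]; exists n; rewrite -iter_commute ?fn ?linear0 // => u.
exact: shift_commute.
Qed.

Lemma gen_eigen_subspace f a : subspace (gen_eigen f a).
Proof.
split=> [|c u v [n fu] [m fv]]; first by exists 0%N.
exists (n + m)%N; rewrite iter_lfunP.
by rewrite (iter_lfun_eq0 _ fu) ?leq_addr // (iter_lfun_eq0 _ fv) ?leq_addl //
  scaler0 addr0.
Qed.

Lemma eigen_gen_eigen f a v : f v = a *: v -> gen_eigen f a v.
Proof. by move=> fv; exists 1%N; rewrite /= shiftE fv subrr. Qed.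

(** By induction on the order, [shift f a v] vanishes; then [f] acts on [v] by [a], and the powers
    of [shift f b] act by those of [a - b]. *)
Lemma gen_eigen_disjoint f a b v :
  gen_eigen f a v -> gen_eigen f b v -> a != b -> v = 0.
Proof.
move=> [n]; elim: n v => [//|n IHn] v fn fb ab.
have /eqP : shift f a v = 0.
  apply: IHn => //; first by rewrite -iterSr.
  by apply: gen_eigen_commute fb => u; rewrite !shiftE [RHS]linearB [in RHS]linearZ.
rewrite shiftE subr_eq0 => /eqP fv; case: fb => m.
have -> : iter m (shift f b) v = (a - b) ^+ m *: v.
  elim: m => [|m IHm]; first by rewrite scale1r.
  by rewrite /= IHm linearZ /= shiftE fv -scalerBl scalerA exprSr.
move=> /eqP; rewrite scaler_eq0 expf_eq0 subr_eq0 (negPf ab) andbF /=.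
by move=> /eqP.
Qed.

Lemma genproj_exists f : exists p : C -> 'End(V),
  [/\ exists N, forall a v, iter N (shift f a) (p a v) = 0,
      forall a v, gen_eigen f a v -> p a v = v,
      exists2 r, uniq r & forall v, v = \sum_(a <- r) p a v
    & forall (Q : set 'End(V)) a, Q 0 ->
        (forall g c, Q g -> Q (f \o g + c *: \1)%VF) -> Q (p a)].
Proof.
have [r [p [N [ur sp pp Np Qp]]]] := lfun_generalized_projectors f.
(* Outside the list [r] the projector is set to 0, which makes it total in [a]. *)
exists (fun a => if a \in r then p a else 0); split.
- exists N => a v; case: ifP => ar; first exact: Np.
  by rewrite zero_lfunE iter_lfun0.
- have pE a b v : b \in r -> a != b -> gen_eigen f a v -> p b v = 0.
    move=> br ab fv; apply: (gen_eigen_disjoint (b := b) _ _ ab); last first.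
      by exists N; apply: Np.
    apply: gen_eigen_commute fv => u.
    apply: (Qp (fun g => g (f u) = f (g u))) => [|g c /= IHg].
      by rewrite !zero_lfunE linear0.
    by rewrite !add_lfunE !comp_lfunE !scale_lfunE !id_lfunE linearD linearZ /= IHg.
  move=> a v fv; rewrite [RHS]sp; case: ifP => ar; last first.
    rewrite zero_lfunE big_seq big1 // => b br; apply: pE fv => //.
    by apply: contraFneq ar => ->.
  rewrite (bigD1_seq a) //= big_seq_cond big1 ?addr0 // => b /andP[br ba].
  by apply: pE fv => //; rewrite eq_sym.
- by exists r => // v; rewrite [LHS]sp big_seq [RHS]big_seq; apply: eq_bigr => a ->.
- by move=> Q a Q0 Qf; case: ifP => // ar; apply: Qp.
Qed.

Definition genproj f : C -> 'End(V) := sval (cid (genproj_exists f)).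

Lemma genproj_nilp f : exists N, forall a v, iter N (shift f a) (genproj f a v) = 0.
Proof. by rewrite /genproj; case: cid => p []. Qed.

Lemma genproj_id f a v : gen_eigen f a v -> genproj f a v = v.
Proof. by rewrite /genproj; case: cid => p /= [_ pid _ _]; apply: pid. Qed.

Lemma genproj_sum f :
  exists2 r, uniq r & forall v, v = \sum_(a <- r) genproj f a v.
Proof. by rewrite /genproj; case: cid => p []. Qed.

Lemma genproj_ind f (Q : set 'End(V)) a : Q 0 ->
  (forall g c, Q g -> Q (f \o g + c *: \1)%VF) -> Q (genproj f a).
Proof. by rewrite /genproj; case: cid => p /= [_ _ _ pind]; apply: pind. Qed.

Lemma gen_eigen_genproj f a v : gen_eigen f a (genproj f a v).
Proof. by have [N fN] := genproj_nilp f; exists N. Qed.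

Lemma genproj_commute f g a v : (forall v, g (f v) = f (g v)) ->
  g (genproj f a v) = genproj f a (g v).
Proof.
move=> fg; apply: (genproj_ind (Q := fun p => g (p v) = p (g v))).
  by rewrite !zero_lfunE linear0.
move=> p c IHp; rewrite !add_lfunE !comp_lfunE !scale_lfunE !id_lfunE.
by rewrite linearD linearZ /= fg IHp.
Qed.

Lemma genproj_stable f U a : lstable f U -> lstable (genproj f a) U.
Proof.
move=> fU v Uv; apply: (genproj_ind (Q := fun p => p v \in U)).
  by rewrite zero_lfunE mem0v.
move=> p c IHp; rewrite !add_lfunE !comp_lfunE !scale_lfunE !id_lfunE.
by rewrite memvD ?memvZ ?fU.
Qed.

Lemma genproj_out f a b v : gen_eigen f b v -> a != b -> genproj f a v = 0.
Proof.
move=> fv ab; apply: (gen_eigen_disjoint _ _ ab).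
  exact: gen_eigen_genproj.
by apply: gen_eigen_commute fv => u; rewrite (genproj_commute (g := f)).
Qed.

Lemma genproj_idem f a : (genproj f a \o genproj f a)%VF = genproj f a.
Proof.
by apply/lfunP => v; rewrite comp_lfunE genproj_id //; apply: gen_eigen_genproj.
Qed.

Lemma genproj_neq0 f U v : lstable f U -> v \in U -> v != 0 ->
  exists2 a, genproj f a v \in U & genproj f a v != 0.
Proof.
move=> fU Uv v0; have [r _ sp] := genproj_sum f.
have [a0|] := pselect (forall a, genproj f a v = 0).
  by move: v0; rewrite [v]sp big1 ?eqxx.
by move=> /existsNP[a /eqP fa]; exists a => //; apply: genproj_stable.
Qed.

Lemma eigenvector_exists f U : lstable f U -> U <> 0%VS ->
  exists a v, [/\ v \in U, v != 0 & f v = a *: v].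
Proof.
move=> fU /vspaceN0P[v0 Uv0 v0N0].
have [a] := genproj_neq0 fU Uv0 v0N0.
move: (genproj f a v0) (gen_eigen_genproj f a v0) => v [n].
elim: n v => [v /= -> _|n IHn v]; first by rewrite eqxx.
rewrite iterSr => fv Uv v0'; have [/eqP|sv0] := eqVneq (shift f a v) 0.
  by rewrite shiftE subr_eq0 => /eqP fa; exists a, v.
by apply: IHn fv _ sv0; rewrite shiftE memvB ?memvZ ?fU.
Qed.

Lemma genproj_eigen f a v : diagonalizable f -> f (genproj f a v) = a *: genproj f a v.
Proof. by apply; apply: gen_eigen_genproj. Qed.

Lemma diagonalizable_spanned f :
  (forall v, v \in vsp [set v | exists a, f v = a *: v]) -> diagonalizable f.
Proof.
move=> fV a v fa; rewrite -[v in RHS](genproj_id fa) -[v in LHS](genproj_id fa).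
apply: (vsp_ind (Q := [set v | f (genproj f a v) = a *: genproj f a v])) (fV v).
  split=> [|c x y /= fx fy]; first by rewrite /= [genproj f a 0]linear0 scaler0 linear0.
  by rewrite [genproj f a (_ + _)]linearP [LHS]linearP /= fx fy scalerDr !scalerA mulrC.
move=> x [b fx] /=; have [ab|ab] := eqVneq a b; last first.
  by rewrite (genproj_out (eigen_gen_eigen fx) ab) scaler0 linear0.
by rewrite genproj_id ab //; apply: eigen_gen_eigen.
Qed.

(** Induction on the dimension: unless all of [T] acts on [U] by scalars, some [f] cuts [U] into
    proper eigenspaces, which the other operators preserve. *)
Lemma joint_eigenvectors (T : set 'End(V)) U :
  (forall f, T f -> diagonalizable f /\ lstable f U) ->
  (forall f g v, T f -> T g -> f (g v) = g (f v)) ->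
  (U <= vsp [set v | v \in U /\ forall f, T f -> exists a, f v = a *: v])%VS.
Proof.
move=> TU Tcomm; have [n] := ubnP (\dim U).
elim: n U TU => // n IHn U TU /ltnSE leUn.
have [Tscal|] := pselect (forall f, T f -> exists a, forall v, v \in U -> f v = a *: v).
  apply/subvP => v Uv; apply: mem_vsp; split=> // f /Tscal[a fa].
  by exists a; apply: fa.
move=> /existsNP[f /not_implyP[Tf /forallNP fscal]].
have [df fU] := TU f Tf.
have [r _ sp] := genproj_sum f.
apply/subvP => v Uv; rewrite [v]sp; apply: memv_suml => a _.
pose Ua := (U :&: lker (shift f a))%VS.
have UaP w : w \in Ua -> w \in U /\ f w = a *: w.
  by rewrite memv_cap memv_ker shiftE subr_eq0 => /andP[? /eqP].
have sUa : (Ua <= vsp [set v | v \in Ua /\ forall f, T f -> exists a, f v = a *: v])%VS.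
  apply: IHn => [g Tg|].
    have [dg gU] := TU g Tg; split=> // w; rewrite !memv_cap !memv_ker !shiftE.
    move=> /andP[Uw]; rewrite !subr_eq0 => /eqP fw; rewrite gU //=.
    by rewrite Tcomm // fw linearZ.
  apply: leq_trans leUn; rewrite ltnNge; apply/negP => dU; apply: (fscal a) => w Uw.
  have /eqP UaU : Ua == U by rewrite eqEdim capvSl.
  by apply: (UaP w _).2; rewrite UaU.
have /(subvP sUa) : genproj f a v \in Ua.
  by rewrite memv_cap genproj_stable // memv_ker shiftE genproj_eigen ?subrr ?eqxx.
by apply/subvP; apply: vsp_sub => w [/UaP[Uw _] Tw]; apply: mem_vsp.
Qed.

(** The same descent without diagonalizability: a single eigenvector of [f] in [U] suffices to pass
    to a proper nonzero eigenspace. *)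
Lemma common_eigenvector (T : set 'End(V)) U :
  (forall f, T f -> lstable f U) ->
  (forall f g v, T f -> T g -> f (g v) = g (f v)) -> U <> 0%VS ->
  exists v, [/\ v \in U, v != 0 & forall f, T f -> exists a, f v = a *: v].
Proof.
move=> TU Tcomm; have [n] := ubnP (\dim U).
elim: n U TU => // n IHn U TU /ltnSE leUn U0.
have [Tscal|] := pselect (forall f, T f -> exists a, forall v, v \in U -> f v = a *: v).
  have [v Uv v0] := vspaceN0P U0; exists v; split=> // f /Tscal[a fa].
  by exists a; apply: fa.
move=> /existsNP[f /not_implyP[Tf /forallNP fscal]].
have [a [v [Uv v0 fv]]] := eigenvector_exists (TU f Tf) U0.
pose Ua := (U :&: lker (shift f a))%VS.
have UaP w : w \in Ua -> w \in U /\ f w = a *: w.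
  by rewrite memv_cap memv_ker shiftE subr_eq0 => /andP[? /eqP].
have [||/vspace0P Ua0|w [/UaP[Uw _] w0 Tw]] := IHn Ua; last by exists w.
- move=> g Tg w; rewrite !memv_cap !memv_ker !shiftE.
  move=> /andP[Uw]; rewrite !subr_eq0 => /eqP fw; rewrite (TU g) //=.
  by rewrite Tcomm // fw linearZ.
- apply: leq_trans leUn; rewrite ltnNge; apply/negP => dU; apply: (fscal a) => w Uw.
  have /eqP UaU : Ua == U by rewrite eqEdim capvSl.
  by apply: (UaP w _).2; rewrite UaU.
- have := Ua0 v; rewrite memv_cap Uv memv_ker shiftE fv subrr eqxx => /(_ isT) /eqP.
  by rewrite (negPf v0).
Qed.

(** The list [r] does not depend on [U], so that the traces on two stable subspaces can be compared
    term by term. *)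
Lemma ltr_stable_diagonalizable f r U : (forall v, v = \sum_(a <- r) genproj f a v) ->
  diagonalizable f -> lstable f U ->
  ltr (f \o projv U)%VF = \sum_(a <- r) a * (\dim (U :&: lker (shift f a)))%:R
  /\ \dim U = (\sum_(a <- r) \dim (U :&: lker (shift f a)))%N.
Proof.
move=> sp df fU.
pose q a := (genproj f a \o projv U)%VF.
have qU a v : q a v \in U.
  by rewrite comp_lfunE; apply: genproj_stable => //; apply: memv_proj.
have qa a v : f (q a v) = a *: q a v by rewrite comp_lfunE genproj_eigen.
have q_id a v : v \in U -> f v = a *: v -> q a v = v.
  move=> Uv fv; rewrite comp_lfunE projv_id // genproj_id //.
  exact: eigen_gen_eigen.
have trq a : ltr (q a) = (\dim (U :&: lker (shift f a)))%:R.
  rewrite ltr_idem; last first.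
    by apply/lfunP => v; rewrite [LHS]comp_lfunE q_id.
  congr (_%:R); apply/eqP; rewrite (_ : limg (q a) = (U :&: lker (shift f a))%VS) //.
  apply/vspaceP => v; apply/memv_imgP/idP => [[u _ ->]|].
    by rewrite memv_cap qU memv_ker shiftE qa subrr eqxx.
  rewrite memv_cap memv_ker shiftE subr_eq0 => /andP[Uv /eqP fv].
  by exists v; rewrite ?memvf ?q_id.
have fq : (f \o projv U)%VF = \sum_(a <- r) a *: q a.
  apply/lfunP => v; rewrite comp_lfunE {1}[projv U v]sp linear_sum sum_lfunE.
  by apply: eq_bigr => a _ /=; rewrite scale_lfunE comp_lfunE genproj_eigen.
have Uq : projv U = \sum_(a <- r) q a.
  apply/lfunP => v; rewrite {1}[projv U v]sp sum_lfunE.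
  by apply: eq_bigr => a _; rewrite comp_lfunE.
split.
  by rewrite fq linear_sum; apply: eq_bigr => a _; rewrite linearZ /= trq.
apply/eqP; rewrite -(eqr_nat C) natr_sum.
have <- : ltr (projv U) = (\dim U)%:R.
  by rewrite ltr_idem ?limg_proj //; apply/lfunP => v; rewrite comp_lfunE projv_proj.
by rewrite Uq linear_sum; apply/eqP; apply: eq_bigr => a _ /=; rewrite trq.
Qed.

End GeneralizedEigenspaces.

(** * Lie modules and the Killing form *)

Section LieModule.
Variables (C : numClosedFieldType) (s l : vectType C).
Variables (br : s -> s -> s) (act : s -> l -> l).
Hypothesis actM : lie_module br act.

Definition op x : 'End(l) := linfun (act x).

Lemma opE x v : op x v = act x v.
Proof. by case: actM => lx _ _; rewrite /op linfunE. Qed.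

Lemma actPr x a u v : act x (a *: u + v) = a *: act x u + act x v.
Proof. by case: actM => lx _ _; apply: lx. Qed.

Lemma actPl v a x y : act (a *: x + y) v = a *: act x v + act y v.
Proof. by case: actM => _ lv _; apply: lv. Qed.

Lemma op_linear : linear op.
Proof. by move=> a x y; apply/lfunP => v; rewrite add_lfunE scale_lfunE !opE actPl. Qed.

Definition actor v : 'Hom(s, l) := linfun (act^~ v).

Lemma actorE v x : actor v x = act x v.
Proof. by case: actM => _ lv _; rewrite /actor linfunE. Qed.

Lemma act0r x : act x 0 = 0. Proof. by rewrite -opE linear0. Qed.
Lemma act0l v : act 0 v = 0. Proof. by rewrite -actorE linear0. Qed.
Lemma actDr x u v : act x (u + v) = act x u + act x v.
Proof. by rewrite -!opE linearD. Qed.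
Lemma actDl x y v : act (x + y) v = act x v + act y v.
Proof. by rewrite -!actorE linearD. Qed.
Lemma actNr x u : act x (- u) = - act x u.
Proof. by rewrite -!opE linearN. Qed.
Lemma actNl x u : act (- x) u = - act x u.
Proof. by rewrite -!actorE linearN. Qed.
Lemma actBr x u v : act x (u - v) = act x u - act x v.
Proof. by rewrite actDr actNr. Qed.
Lemma actBl x y v : act (x - y) v = act x v - act y v.
Proof. by rewrite actDl actNl. Qed.
Lemma actZr x a v : act x (a *: v) = a *: act x v.
Proof. by rewrite -!opE linearZ. Qed.
Lemma actZl x a v : act (a *: x) v = a *: act x v.
Proof. by rewrite -!actorE linearZ. Qed.
Lemma act_suml v (I : Type) (r : seq I) (P : pred I) (f : I -> s) :
  act (\sum_(i <- r | P i) f i) v = \sum_(i <- r | P i) act (f i) v.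
Proof. by rewrite -actorE linear_sum; apply: eq_bigr => i _; rewrite /= actorE. Qed.

Lemma act_br x y v : act (br x y) v = act x (act y v) - act y (act x v).
Proof. by case: actM => _ _ brE; apply: brE. Qed.

Lemma actAC x y v : act x (act y v) = act (br x y) v + act y (act x v).
Proof. by rewrite act_br subrK. Qed.

Lemma op_br x y : op (br x y) = ((op x \o op y) - (op y \o op x))%VF.
Proof.
by apply/lfunP => v; rewrite add_lfunE opp_lfunE !comp_lfunE !opE act_br.
Qed.

Definition bracket_vs (A : {vspace s}) (U : {vspace l}) : {vspace l} :=
  vsp [set act x v | x in [set` A] & v in [set` U]].

Lemma mem_bracket (A : {vspace s}) (U : {vspace l}) x v :
  x \in A -> v \in U -> act x v \in bracket_vs A U.
Proof. by move=> Ax Uv; apply: mem_vsp; exists x => //; exists v. Qed.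

Lemma bracket_sub (A : {vspace s}) (U W : {vspace l}) :
  (forall x v, x \in A -> v \in U -> act x v \in W) -> (bracket_vs A U <= W)%VS.
Proof. by move=> AUW; apply: vsp_sub => _ [x Ax [v Uv <-]]; apply: AUW. Qed.

Lemma subspace_act x (U : {vspace l}) : subspace [set v | act x v \in U].
Proof.
split=> [|a u v /= Uu Uv]; first by rewrite /= act0r mem0v.
by rewrite actPr memvD ?memvZ.
Qed.

End LieModule.

Section LieAlgebra.
Variables (C : numClosedFieldType) (s : vectType C) (br : s -> s -> s).
Hypothesis brL : lie_algebra br.

Lemma br_anti x y : br x y = - br y x.
Proof.
case: brL => lr ll brxx _; have := brxx (x + y).
have DR z u v : br z (u + v) = br z u + br z v.
  by have := lr z 1 u v; rewrite !scale1r.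
have DL z u v : br (u + v) z = br u z + br v z.
  by have := ll z 1 u v; rewrite !scale1r.
by rewrite DL !DR !brxx add0r addr0 => /eqP; rewrite addr_eq0 => /eqP.
Qed.

Lemma adM : lie_module br br.
Proof.
case: (brL) => lr ll brxx jac; split=> // x y z.
rewrite (br_anti (br x y) z); have /eqP := jac x y z.
have br0 u : br u 0 = 0.
  by have := lr u (-1) 0 0; rewrite scaler0 addr0 scaleN1r addNr.
have NR u v : br u (- v) = - br u v.
  by have := lr u (-1) v 0; rewrite addr0 br0 addr0 !scaleN1r.
by rewrite addr_eq0 (br_anti z x) NR => /eqP <-.
Qed.

Local Notation ad := (op br).

Lemma brxx x : br x x = 0. Proof. by case: brL. Qed.

Lemma br_jacobi x y z : br x (br y z) = br (br x y) z + br y (br x z).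
Proof. exact: actAC adM _ _ _. Qed.

Definition subalgebra (K : {vspace s}) :=
  forall x y, x \in K -> y \in K -> br x y \in K.

(** Starting from 0, a proper subalgebra is enlarged by a line of its normalizer in [K]; the last
    one before [K] has codimension one. *)
Lemma max_codim1_subalgebra (K : {vspace s}) : K <> 0%VS -> subalgebra K ->
  (forall L : {vspace s}, (L <= K)%VS -> L <> K -> subalgebra L ->
     exists x, [/\ x \in K, x \notin L & forall y, y \in L -> br y x \in L]) ->
  exists (L : {vspace s}) x, [/\ L <> K, subalgebra L, (L <= K)%VS,
     x \in K /\ (forall y, y \in L -> br y x \in L) & K = (L + <[x]>)%VS].
Proof.
move=> K0 sK ext.
suff main n (L : {vspace s}) : (\dim K - \dim L < n)%N -> (L <= K)%VS -> L <> K ->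
    subalgebra L -> exists (L : {vspace s}) x, [/\ L <> K, subalgebra L, (L <= K)%VS,
     x \in K /\ (forall y, y \in L -> br y x \in L) & K = (L + <[x]>)%VS].
  apply: (main _ 0%VS (ltnSn _)); rewrite ?sub0v //; first by move=> E; apply: K0.
  by move=> x y; rewrite !memv0 => /eqP-> _; rewrite (act0l adM).
elim: n L => // n IHn L; rewrite ltnS => dL LK LnK sL.
have [x [Kx Lx xL]] := ext L LK LnK sL.
have [KE|KnE] := eqVneq K (L + <[x]>)%VS; first by exists L, x; split.
have sL' : (L + <[x]> <= K)%VS by rewrite subv_add LK -memvE.
apply: (IHn (L + <[x]>)%VS) => //; last first.
- move=> _ _ /memv_addP[y Ly [_ /vlineP[a ->] ->]] /memv_addP[z Lz [_ /vlineP[b ->] ->]].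
  rewrite (actDr adM) !(actDl adM) !(actZl adM) !(actZr adM) brxx !scaler0 addr0.
  apply: (subvP (addvSl L <[x]>)).
  have xzL : br x z \in L by rewrite br_anti memvN xL.
  have yzL := sL y z Ly Lz; have yxL := xL y Ly.
  by rewrite !(rpredD, rpredZ).
- by move=> E; rewrite E eqxx in KnE.
have dLx : (\dim L < \dim (L + <[x]>))%N.
  rewrite ltnNge; apply: contra Lx => dLx.
  have /eqP-> : L == (L + <[x]>)%VS by rewrite eqEdim addvSl.
  by rewrite memvE addvSr.
have := dimvS sL'; move: dL dLx; lia.
Qed.

(** Engel's theorem for the action of [K] on [B] modulo [A]; the pair of subspaces replaces a
    quotient. Induction on the dimension of [K]: the theorem for a proper subalgebra acting on [K]
    modulo itself provides the normalizing vectors that [max_codim1_subalgebra] asks for. *)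
Lemma engel (K A B : {vspace s}) : subalgebra K ->
  (forall x v, x \in K -> v \in A -> br x v \in A) ->
  (forall x v, x \in K -> v \in B -> br x v \in B) ->
  (forall x v, x \in K -> v \in K -> exists n, iter n (br x) v = 0) ->
  (forall x v, x \in K -> v \in B -> exists n, iter n (br x) v \in A) ->
  ~~ (B <= A)%VS ->
  exists v, [/\ v \in B, v \notin A & forall x, x \in K -> br x v \in A].
Proof.
have [n] := ubnP (\dim K); elim: n K A B => // n IHn K A B /ltnSE leKn sK KA KB nilK nilB nBA.
have [K0|/eqP K0] := eqVneq K 0%VS.
  have /subvPn[v Bv Av] := nBA; exists v; split=> // x; rewrite K0 memv0 => /eqP->.
  by rewrite (act0l adM) mem0v.
have ltK (L : {vspace s}) : (L <= K)%VS -> L <> K -> (\dim L < n)%N.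
  move=> LK LnK; apply: leq_trans leKn; rewrite ltnNge; apply/negP => dKL; apply: LnK.
  by apply/eqP; rewrite eqEdim LK.
have [|L [x [LnK sL LK [Kx xL] KE]]] := max_codim1_subalgebra K0 sK.
  move=> L LK LnK sL; have LKx y : y \in L -> y \in K by apply/subvP.
  apply: (IHn L L K) => //; first exact: ltK.
  - by move=> y z /LKx Ky; apply: sK.
  - by move=> y z /LKx Ky /LKx; apply: nilK.
  - by move=> y z /LKx Ky /(nilK _ _ Ky)[m E]; exists m; rewrite E mem0v.
  - by apply/negP => KL; apply: LnK; apply/eqP; rewrite eqEsubv LK.
have LKx y : y \in L -> y \in K by apply/subvP.
have [|||||v [Bv Av Lv]] := IHn L A B (ltK _ LK LnK) sL => //.
- by move=> y v /LKx; apply: KA.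
- by move=> y v /LKx; apply: KB.
- by move=> y z /LKx Ky /LKx; apply: nilK.
- by move=> y v /LKx; apply: nilB.
(* [x] normalizes [L], so its iterates on [v] remain annihilated by [L] modulo [A]; the last iterate
   outside [A] is annihilated by [x] as well. *)
have W k : iter k (br x) v \in B /\ forall y, y \in L -> br y (iter k (br x) v) \in A.
  elim: k => [//|k [Bk Lk]] /=; split=> [|y Ly]; first exact: KB.
  by rewrite br_jacobi memvD ?Lk ?xL // KA // Lk.
have [m] := nilB x v Kx Bv; elim: m => [|m IHm] /=; first by rewrite (negPf Av).
have [/IHm//|nAm] := boolP (iter m (br x) v \in A); move=> Am1.
exists (iter m (br x) v); split=> //; first by have [] := W m.
move=> y; rewrite KE => /memv_addP[z Lz [_ /vlineP[a ->] ->]].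
by rewrite (actDl adM) (actZl adM) memvD ?memvZ //; have [_ ->] := W m.
Qed.

End LieAlgebra.

Section EigenMap.
Variables (C : numClosedFieldType) (V : vectType C).
Implicit Types (f g : 'End(V)) (v : V).

Lemma gen_eigen_span f v : v \in vsp [set v | exists a, gen_eigen f a v].
Proof.
have [r _ sp] := genproj_sum f; rewrite [v]sp; apply: memv_suml => a _.
by apply: mem_vsp; exists a; apply: gen_eigen_genproj.
Qed.

Lemma gen_eigen_ind f (Q : set V) v : subspace Q ->
  (forall a v, gen_eigen f a v -> Q v) -> Q v.
Proof.
move=> sQ fQ; apply: (vsp_ind sQ _ (gen_eigen_span f v)) => w [a].
exact: fQ.
Qed.

Lemma shift0 f : shift f 0 = f.
Proof. by rewrite /shift scale0r subr0. Qed.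

Lemma gen_eigen0_nilp f : (forall v, gen_eigen f 0 v) ->
  exists N, forall v, iter N f v = 0.
Proof.
move=> f0; have [N fN] := genproj_nilp f; exists N => v.
by rewrite -[RHS](fN 0 v) genproj_id // shift0.
Qed.

(** For [phi] the identity this is the semisimple part of [f]; for [phi] the complex conjugation,
    its composite with [f] has as trace a sum of squared moduli of eigenvalues. *)
Definition eigmap f (phi : C -> C) : 'End(V) :=
  \sum_(a <- s2val (cid2 (genproj_sum f))) phi a *: genproj f a.

Lemma eigmapE f phi a v : gen_eigen f a v -> eigmap f phi v = phi a *: v.
Proof.
rewrite /eigmap; case: cid2 => r /= ur sp fv; rewrite sum_lfunE.
have fb b : b != a -> genproj f b v = 0 by apply: genproj_out.
have [ar|ar] := boolP (a \in r).
  rewrite (bigD1_seq a) //= big1 ?addr0 ?scale_lfunE ?genproj_id // => b ba.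
  by rewrite scale_lfunE fb ?scaler0.
have -> : v = 0.
  rewrite [v]sp big_seq big1 // => b br; apply: fb.
  by apply: contraNneq ar => <-.
by rewrite scaler0 big1 // => b _; rewrite linear0.
Qed.

Lemma ltr_genproj f a :
  ltr (f \o genproj f a)%VF = a * (\dim (limg (genproj f a)))%:R.
Proof.
have [N fN] := genproj_nilp f.
have -> : (f \o genproj f a)%VF =
    a *: genproj f a + (shift f a \o genproj f a)%VF.
  apply/lfunP => v; rewrite add_lfunE !comp_lfunE scale_lfunE shiftE.
  by rewrite addrC subrK.
rewrite linearD linearZ /= ltr_idem ?genproj_idem // (@ltr_nilp _ _ _ N.+1) ?addr0 //.
have com v : genproj f a (shift f a v) = shift f a (genproj f a v).
  by rewrite !shiftE linearB linearZ /= (genproj_commute (g := f)).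
suff it k v : iter k.+1 (shift f a \o genproj f a)%VF v
    = iter k.+1 (shift f a) (genproj f a v) by move=> v; rewrite it iterS fN linear0.
elim: k => [|k IHk]; first by rewrite /= comp_lfunE.
rewrite iterS IHk comp_lfunE iter_commute // [genproj _ _ (genproj _ _ _)]genproj_id //.
exact: gen_eigen_genproj.
Qed.

(** The trace is the sum of [|a| ^+ 2] times the dimensions of the generalized eigenspaces; when it
    vanishes, no nonzero eigenvalue is left. *)
Lemma ltr_eigmap_conj f : ltr (f \o eigmap f Num.conj)%VF = 0 ->
  exists N, forall v, iter N f v = 0.
Proof.
rewrite /eigmap; case: cid2 => r /= ur sp tr0; apply: gen_eigen0_nilp => v.
have {tr0} : \sum_(a <- r) `|a| ^+ 2 * (\dim (limg (genproj f a)))%:R = 0.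
  rewrite -[RHS]tr0.
  have -> : (f \o \sum_(a <- r) Num.conj a *: genproj f a)%VF
      = \sum_(a <- r) Num.conj a *: (f \o genproj f a)%VF.
    apply/lfunP => u; rewrite comp_lfunE !sum_lfunE linear_sum.
    by apply: eq_bigr => a _; rewrite /= !scale_lfunE comp_lfunE linearZ.
  rewrite linear_sum; apply: eq_bigr => a _ /=.
  by rewrite linearZ /= ltr_genproj mulrA normCK [a * _]mulrC.
move=> /eqP; rewrite psumr_eq0 => [/allP tr0|a _]; last first.
  by rewrite mulr_ge0 ?exprn_ge0.
have p0 a : a \in r -> a != 0 -> genproj f a = 0.
  move=> ar a0; have := tr0 a ar.
  rewrite mulf_eq0 expf_eq0 normr_eq0 (negPf a0) pnatr_eq0 dimv_eq0 /= => /eqP i0.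
  apply/lfunP => u; rewrite zero_lfunE; apply/eqP; rewrite -memv0 -i0.
  by apply: memv_img; rewrite memvf.
rewrite [v]sp big_seq; apply: subspace_sum => [|a ar].
  exact: gen_eigen_subspace.
have [-> |a0] := eqVneq a 0; first exact: gen_eigen_genproj.
by rewrite p0 // zero_lfunE; exists 0%N.
Qed.

(* Commutators of operators commuting with [f] are traceless on the eigenspaces of [f]. *)
Lemma diagonalizable_commutator_eq0 f : diagonalizable f ->
  f \in vsp [set k | exists g h : 'End(V),
    [/\ forall v, g (f v) = f (g v), forall v, h (f v) = f (h v)
      & k = ((g \o h) - (h \o g))%VF]] -> f = 0.
Proof.
move=> df fgh; have p0 a : a != 0 -> genproj f a = 0.
  move=> a0; have : ltr (f \o genproj f a)%VF = 0.
    apply: (vsp_ind (Q := [set k | ltr (k \o genproj f a)%VF = 0])) fgh.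
      split=> [|c k k' /= k0 k0']; first by rewrite /= comp_lfun0l linear0.
      by rewrite comp_lfunDl -comp_lfunZl linearP /= k0 k0' mulr0 addr0.
    move=> _ [g [h [gf hf ->]]] /=; rewrite comp_lfunDl comp_lfunNl linearB /=.
    have hp : (h \o genproj f a)%VF = (genproj f a \o h)%VF.
      by apply/lfunP => v; rewrite !comp_lfunE genproj_commute.
    by rewrite -!comp_lfunA hp comp_lfunA ltrC comp_lfunA subrr.
  rewrite ltr_genproj => /eqP; rewrite mulf_eq0 (negPf a0) pnatr_eq0 dimv_eq0 /= => /eqP i0.
  apply/lfunP => u; rewrite zero_lfunE; apply/eqP; rewrite -memv0 -i0.
  by apply: memv_img; rewrite memvf.
apply/lfunP => v; rewrite zero_lfunE; have [r _ sp] := genproj_sum f.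
rewrite [v]sp linear_sum big1 // => a _ /=; rewrite genproj_eigen //.
have [->|/p0->] := eqVneq a 0; first by rewrite scale0r.
by rewrite zero_lfunE scaler0.
Qed.

End EigenMap.

(** The shift by [a + b] acts on [act u v] by Leibniz' rule, and after [m + n] applications one
    factor of each term has been annihilated. *)
Lemma gen_eigen_act (C : numClosedFieldType) (s l : vectType C)
    (br : s -> s -> s) (act : s -> l -> l) x a b u v :
  lie_module br br -> lie_module br act ->
  gen_eigen (op br x) a u -> gen_eigen (op act x) b v ->
  gen_eigen (op act x) (a + b) (act u v).
Proof.
move=> adM actM [m um] [n vn]; exists (m + n)%N.
suff main k m' n' u' v' : iter m' (shift (op br x) a) u' = 0 ->
    iter n' (shift (op act x) b) v' = 0 -> (m' + n' <= k)%N ->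
    iter k (shift (op act x) (a + b)) (act u' v') = 0 by apply: main um vn _.
elim: k m' n' u' v' => [|k IHk] {um vn}m {}n {}u {}v um vn.
  by rewrite leqn0 addn_eq0 => /andP[/eqP m0 _]; rewrite m0 /= in um; rewrite um (act0l actM).
move=> leS; rewrite iterSr.
have -> : shift (op act x) (a + b) (act u v)
    = act (shift (op br x) a u) v + act u (shift (op act x) b v).
  rewrite !shiftE !(opE actM) !(opE adM) (actAC actM) (actBl actM) (actBr actM) (actZl actM) (actZr actM).
  by rewrite scalerDl opprD addrACA.
rewrite -[X in iter k _ (X + _)]scale1r iter_lfunP scale1r.
case: m um leS => [|m] um leS.
  rewrite /= in um; rewrite um [shift _ _ 0]linear0 !(act0l actM).
  by rewrite iter_lfun0 addr0.
case: n vn leS => [|n] vn leS.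
  rewrite /= in vn; rewrite vn [shift _ _ 0]linear0 !(act0r actM).
  by rewrite iter_lfun0 addr0.
have -> : iter k (shift (op act x) (a + b)) (act (shift (op br x) a u) v) = 0.
  by apply: (IHk m n.+1) => //; rewrite -iterSr.
by rewrite add0r; apply: (IHk m.+1 n) => //; try lia; rewrite -iterSr.
Qed.

(** The starting point of the structure theory. It concerns ideals over the complex base field,
    whereas semisimplicity is assumed of the underlying real algebra; [semisimple_no_abelian_ideal]
    relates the two. *)
Definition without_abelian_ideal (C : fieldType) (s : vectType C) (br : s -> s -> s) : Prop :=
  forall I : {vspace s}, (forall x y, y \in I -> br x y \in I) ->
    (forall x y, x \in I -> y \in I -> br x y = 0) -> I = 0%VS.

(** * The Killing form *)

Section Killing.
Variables (C : numClosedFieldType) (s : vectType C) (br : s -> s -> s).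
Hypothesis brL : lie_algebra br.
Hypothesis no_abelian_ideal : without_abelian_ideal br.

Local Notation ad := (op br).
Let adm : lie_module br br := adM brL.

Definition killing x y : C := ltr (ad x \o ad y)%VF.

Lemma killingC x y : killing x y = killing y x.
Proof. exact: ltrC. Qed.

Lemma killing_linear x : linear_for *%R (killing x).
Proof.
by move=> a y z; rewrite /killing (op_linear adm) comp_lfunDr -comp_lfunZr linearP.
Qed.

Lemma killing_assoc x y z : killing (br x y) z = killing x (br y z).
Proof.
rewrite /killing !(op_br adm) comp_lfunDl comp_lfunNl comp_lfunDr comp_lfunNr.
rewrite !linearB /= -!comp_lfunA; congr (_ - _).
by rewrite ltrC -comp_lfunA.
Qed.

Lemma killing0r x : killing x 0 = 0.
Proof. by have := killing_linear x (-1) 0 0; rewrite scaler0 addr0 mulN1r addNr. Qed.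

Lemma killingZr x a y : killing x (a *: y) = a * killing x y.
Proof. by have := killing_linear x a y 0; rewrite !addr0 killing0r addr0. Qed.

Lemma killing_subspace x : subspace [set y | killing x y = 0].
Proof.
split=> [|a y z /= y0 z0]; first exact: killing0r.
by rewrite killing_linear y0 z0 mulr0 addr0.
Qed.

Lemma ad_eq0_center x : (forall y, br x y = 0) -> x = 0.
Proof.
move=> x0; suff : <[x]>%VS = 0%VS :> {vspace s}.
  by move=> /vspace0P; apply; apply: memv_line.
apply: no_abelian_ideal => [y z|y z] /vlineP[a ->].
  by rewrite (actZr adm) (br_anti brL) x0 oppr0 scaler0 mem0v.
by move=> /vlineP[b ->]; rewrite (actZl adm) x0 scaler0.
Qed.

Definition derivation (D : 'End(s)) := forall u v, D (br u v) = br (D u) v + br u (D v).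

(** The bracket adds generalized eigenvalues, so additivity of [phi] becomes Leibniz' rule. Applied
    to the identity and to complex conjugation. *)
Lemma eigmap_derivation x phi : {morph phi : a b / a + b >-> a + b} ->
  derivation (eigmap (ad x) phi).
Proof.
move=> phiD u v; set D := eigmap _ _.
have sub1 w : subspace [set u | D (br u w) = br (D u) w + br u (D w)].
  split=> [|a y z /= Dy Dz]; first by rewrite /= !(act0l adm, linear0) addr0.
  rewrite !linearP /= !(actPl adm) linearP /= Dy Dz scalerDr addrACA; done.
have sub2 w : subspace [set v | D (br w v) = br (D w) v + br w (D v)].
  split=> [|a y z /= Dy Dz]; first by rewrite /= !(act0r adm, linear0) addr0.
  rewrite !linearP /= !(actPr adm) linearP /= Dy Dz scalerDr addrACA; done.
apply: (gen_eigen_ind (f := ad x) u (sub1 v)) => a {}u fu /=.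
apply: (gen_eigen_ind (f := ad x) v (sub2 u)) => b {}v fv /=.
rewrite (eigmapE phi fu) (eigmapE phi fv) (eigmapE phi (gen_eigen_act adm adm fu fv)).
by rewrite phiD (actZl adm) (actZr adm) scalerDl.
Qed.

Lemma op_derivation D x : derivation D -> op br (D x) = ((D \o ad x) - (ad x \o D))%VF.
Proof.
move=> DD; apply/lfunP => v; rewrite add_lfunE opp_lfunE !comp_lfunE !(opE adm).
by rewrite DD addrK.
Qed.

(** The derived ideal [K] of the radical [I] of the form acts nilpotently; if nonzero, it would by
    Engel's theorem have a nonzero centre, an abelian ideal. Hence [I] is itself abelian, and
    therefore zero. *)
Theorem killing_nondegenerate x : (forall y, killing x y = 0) -> x = 0.
Proof.
pose I := vsp [set x | forall y, killing x y = 0].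
have sI : subspace [set x | forall y, killing x y = 0].
  split=> [y|a u v /= u0 v0 y]; first by rewrite killingC killing0r.
  by rewrite killingC killing_linear killingC u0 killingC v0 mulr0 addr0.
have IE u : u \in I <-> forall y, killing u y = 0 by apply: vspP sI.
have idI u v : v \in I -> br u v \in I.
  move=> /IE v0; apply/IE => y.
  by rewrite (br_anti brL) -scaleN1r killingC killingZr killingC killing_assoc v0 mulr0.
have idI' u v : u \in I -> br u v \in I.
  by move=> Iu; rewrite (br_anti brL) memvN idI.
pose K := bracket_vs br I I.
have KI u : u \in K -> u \in I.
  by apply: subvP; apply: bracket_sub => y z Iy Iz; apply: idI.
have idK u v : v \in K -> br u v \in K.
  move=> Kv; apply: (vsp_ind (Q := [set v | br u v \in K])) Kv.
    split=> [|a y z /= Ky Kz]; first by rewrite /= (act0r adm) mem0v.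
    by rewrite (actPr adm) memvD ?memvZ.
  move=> _ [y Iy [z Iz <-]] /=; rewrite (br_jacobi brL) memvD //.
    by apply: mem_bracket => //; apply: idI.
  by apply: mem_bracket => //; apply: idI.
have nilK u : u \in K -> exists n, forall v, iter n (ad u) v = 0.
  (* For [y], [z] in [I] the trace of [ad (br y z) \o D] is, up to sign, the Killing product of [y]
     and [D z], because [D] is a derivation; and [y] is in the radical. *)
  move=> Ku; apply: ltr_eigmap_conj; set D := eigmap _ _.
  have DD : derivation D by apply: eigmap_derivation => a b; rewrite rmorphD.
  apply: (vsp_ind (Q := [set u | ltr (ad u \o D)%VF = 0])) Ku.
    split=> [|a y z /= y0 z0].
      rewrite /= (_ : ad 0 = 0) ?comp_lfun0l ?linear0 //.
      by apply/lfunP => v; rewrite (opE adm) (act0l adm) zero_lfunE.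
    by rewrite (op_linear adm) comp_lfunDl -comp_lfunZl linearP /= y0 z0 mulr0 addr0.
  move=> _ [y Iy [z Iz <-]] /=.
  rewrite (op_br adm) comp_lfunDl comp_lfunNl linearB /=.
  have -> : ltr ((ad z \o ad y) \o D)%VF = ltr (ad y \o (D \o ad z))%VF.
    by rewrite -comp_lfunA ltrC -comp_lfunA.
  rewrite -comp_lfunA -linearB -comp_lfunNr -comp_lfunDr.
  rewrite -opprB -op_derivation // comp_lfunNr linearN /=.
  by have /IE/(_ (D z)) := Iy; rewrite /killing => ->; rewrite oppr0.
have K0 : K = 0%VS.
  apply/eqP/negPn/negP => /eqP K0.
  have [||||||v [Kv v0 vK]] := engel brL (K := K) (A := 0%VS) (B := K).
  - by move=> y z _; apply: idK.
  - by move=> y z _; rewrite !memv0 => /eqP->; rewrite (act0r adm).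
  - by move=> y z _; apply: idK.
  - move=> y z /nilK[n yn] _; exists n; rewrite -[RHS](yn z).
    by elim: n {yn} => //= n ->; rewrite (opE adm).
  - move=> y z /nilK[n yn] _; exists n; rewrite memv0 -(yn z); apply/eqP.
    by elim: n {yn} => //= n ->; rewrite (opE adm).
  - by rewrite subv0; apply/eqP.
  pose Z := vsp [set v | v \in K /\ forall x, x \in K -> br x v = 0].
  have sZ : subspace [set v | v \in K /\ forall x, x \in K -> br x v = 0].
    split=> [|a y z /= [Ky y0] [Kz z0]].
      by split=> [|y _]; rewrite ?mem0v // (act0r adm).
    split=> [|w Kw]; first by rewrite memvD ?memvZ.
    by rewrite (actPr adm) y0 ?z0 // scaler0 addr0.
  have Z0 : Z = 0%VS.
    apply: no_abelian_ideal => [y z|y z] /(vspP _ sZ)[Kz zK]; last first.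
      by move=> /(vspP _ sZ)[_ ->].
    apply/(vspP _ sZ); split=> [|w Kw]; first exact: idK.
    rewrite (br_jacobi brL) zK ?add0r.
      by rewrite zK // (act0r adm).
    by rewrite (br_anti brL) memvN idK.
  have : v \in Z.
    by apply/(vspP _ sZ); split=> // y /vK; rewrite memv0 => /eqP.
  by rewrite Z0 (negPf v0).
have I0 : I = 0%VS.
  apply: no_abelian_ideal => // y z Iy Iz; apply/eqP; rewrite -memv0 -K0.
  exact: mem_bracket.
by move=> /IE; rewrite I0 memv0 => /eqP.
Qed.

Lemma killing_represents (phi : 'Hom(s, C^o)) : exists d, forall x, killing d x = phi x.
Proof.
have klin d : linear (fun x => killing d x : C^o) by exact: killing_linear.
pose kap : s -> 'Hom(s, C^o) := fun d => linfun (fun x => killing d x : C^o).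
have kapE d x : kap d x = killing d x by rewrite /kap linfunE.
have lkap : linear kap.
  move=> a d e; apply/lfunP => x; rewrite add_lfunE scale_lfunE !kapE.
  by rewrite killingC killing_linear ![killing x _]killingC.
pose k := linfun kap; have kE d : k d = kap d by rewrite /k linfunE.
have k0 : lker k == 0%VS.
  apply/eqP/vspace0P => d; rewrite memv_ker kE => /eqP kd.
  by apply: killing_nondegenerate => x; rewrite -kapE kd zero_lfunE.
have /eqP kf : limg k == fullv.
  rewrite eqEdim subvf limg_dim_eq; first by rewrite !dimvf /dim /= muln1.
  by rewrite (eqP k0) capv0.
have : phi \in limg k by rewrite kf memvf.
by move=> /memv_imgP[d _ ->]; exists d => x; rewrite kE kapE.
Qed.

(** The functional sending [x] to the trace of [D \o ad x] is the Killing product with some [d]. The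
    derivation [D - ad d] is then trace-orthogonal to every [ad x], and by invariance its values are
    Killing-orthogonal to everything. *)
Lemma derivation_inner D : derivation D -> exists d, D = ad d.
Proof.
move=> DD; pose phi : s -> C^o := fun x => ltr (D \o ad x)%VF.
have lphi : linear phi.
  by move=> a x y; rewrite /phi (op_linear adm) comp_lfunDr -comp_lfunZr linearP.
have [d dE] := killing_represents (linfun phi).
have {dE} dE x : killing d x = ltr (D \o ad x)%VF by rewrite dE linfunE.
exists d; apply/lfunP => x; apply/eqP; rewrite -subr_eq0; apply/eqP.
apply: killing_nondegenerate => y.
have -> : D x - ad d x = (D - ad d) x by rewrite add_lfunE opp_lfunE.
have DdD : derivation (D - ad d).
  move=> u v; rewrite !add_lfunE !opp_lfunE !(opE adm) DD (br_jacobi brL d).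
  by rewrite (actBl adm) (actBr adm) opprD addrACA.
rewrite /killing op_derivation // comp_lfunDl comp_lfunNl linearB /=.
have -> : ltr ((ad x \o (D - ad d)) \o ad y)%VF = ltr ((D - ad d) \o (ad y \o ad x))%VF.
  by rewrite -comp_lfunA ltrC comp_lfunA.
rewrite -comp_lfunA -linearB -comp_lfunNr -comp_lfunDr -(op_br adm).
by rewrite comp_lfunDl comp_lfunNl linearB /= -dE subrr.
Qed.

Lemma killing_separation (U : {vspace s}) v : v \notin U ->
  exists d, (forall u, u \in U -> killing d u = 0) /\ killing d v != 0.
Proof.
move=> Uv; pose w := v - projv U v.
have w0 : w != 0.
  by rewrite subr_eq0; apply: contra Uv => /eqP->; apply: memv_proj.
pose X : 1.-tuple s := [tuple w].
pose phi : s -> C^o := fun x => coord X 0 (x - projv U x).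
have lphi : linear phi.
  move=> a x y; rewrite /phi -linearP; congr (coord X 0 _).
  by rewrite linearP /= scalerBr opprD addrACA.
have [d dE] := killing_represents (linfun phi).
exists d; split=> [u Uu|]; rewrite dE linfunE //.
  by rewrite /phi projv_id // subrr linear0.
have /(_ 0 0) := coord_free (X := X) _ _; rewrite seq1_free => /(_ w0) /= wE.
by rewrite /phi -/w wE oner_eq0.
Qed.

End Killing.

(** * Cartan subalgebras are abelian and act diagonally *)

Section CartanSubalgebra.
Variables (C : numClosedFieldType) (s : vectType C) (br : s -> s -> s).
Hypothesis brL : lie_algebra br.
Hypothesis no_abelian_ideal : without_abelian_ideal br.
Variable h : {vspace s}.
Hypothesis hC : cartan_subalgebra br [set` h].

Local Notation ad := (op br).
Let adm : lie_module br br := adM brL.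

Let h_br x y : x \in h -> y \in h -> br x y \in h.
Proof. by case: hC => _ hbr _ _; apply: hbr. Qed.

Let h_norm x : (forall y, y \in h -> br x y \in h) -> x \in h.
Proof. by case: hC => _ _ _ hn xh; apply: hn. Qed.

Let lcs n : set s := lower_central_series br [set` h] n.

Lemma bracket_span1 x y n : x \in h -> lcs n y -> lcs n.+1 (br x y).
Proof.
move=> hx ny; exists 1%N, (fun=> 1), (fun=> x), (fun=> y); split=> //.
by rewrite big_ord1 scale1r.
Qed.

Lemma cartan_ad_nilp x y : x \in h -> y \in h -> exists n, iter n (br x) y = 0.
Proof.
move=> hx hy; case: hC => _ _ [n n0] _; exists n; apply: n0.
by elim: n => // n IHn; apply: bracket_span1.
Qed.

Lemma lcs_sub n x : lcs n x -> x \in h.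
Proof.
elim: n x => [//|n IHn] _ [m [c [X [Y [hX nY ->]]]]].
apply: memv_suml => i _; apply: memvZ; apply: h_br; first exact: hX.
exact/IHn/nY.
Qed.

(* The semisimple part of [ad x] is a derivation, hence inner. *)
Lemma cartan_jordan x : x \in h -> exists d,
  [/\ d \in h, diagonalizable (ad d), forall v, gen_eigen (ad (x - d)) 0 v
    & forall y, y \in h -> br d y = 0].
Proof.
move=> hx; have DD : derivation br (eigmap (ad x) id).
  by apply: eigmap_derivation.
have [d Dd] := derivation_inner brL no_abelian_ideal DD.
have dE a v : gen_eigen (ad x) a v -> br d v = a *: v.
  by move=> /(eigmapE id); rewrite Dd (opE adm).
have dh y : y \in h -> br d y = 0.
  move=> hy; rewrite (dE 0) ?scale0r //; have [n xn] := cartan_ad_nilp hx hy.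
  by exists n; rewrite shift0 -[RHS]xn; elim: n {xn} => //= n ->; rewrite (opE adm).
exists d; split=> //.
- by apply: h_norm => y /dh ->; apply: mem0v.
- apply: diagonalizable_spanned => v.
  apply: (gen_eigen_ind (f := ad x) v (subspace_vspace _)) => a u fu.
  by apply: mem_vsp; exists a; rewrite (opE adm); apply: dE.
- move=> v; apply: (gen_eigen_ind (f := ad x) v (gen_eigen_subspace _ _)) => a u [n fu].
  exists n; rewrite shift0 -[RHS]fu.
  have : forall k, gen_eigen (ad x) a (iter k (shift (ad x) a) u).
    by move=> k; exists n; rewrite -iterD addnC iterD fu iter_lfun0.
  move=> gk; elim: n {fu} => //= n ->.
  by rewrite (opE adm) (actBl adm) (dE a) // shiftE (opE adm).
Qed.

(** [n] is orthogonal to each joint eigenvector [v] of the diagonalizable central elements of [h].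
    If one of them has a nonzero eigenvalue on [v], this is invariance; otherwise [v] lies in [h],
    commutes with [n], and [ad n \o ad v] is nilpotent. *)
Lemma cartan_central_nilp n : n \in h -> (forall y, y \in h -> br n y = 0) ->
  (forall v, gen_eigen (ad n) 0 v) -> n = 0.
Proof.
move=> hn nh nilp; apply: (killing_nondegenerate brL no_abelian_ideal) => v0.
pose T := [set f | exists d, [/\ d \in h, forall y, y \in h -> br d y = 0,
  diagonalizable (ad d) & f = ad d]].
have Tdec : v0 \in vsp [set v | v \in fullv /\ forall f, T f -> exists a, f v = a *: v].
  apply: (subvP (joint_eigenvectors (T := T) (U := fullv) _ _)) (memvf v0).
    by move=> _ [d [_ _ dd ->]]; split=> // v _; rewrite memvf.
  move=> _ _ v [d [hd dh _ ->]] [e [he _ _ ->]].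
  by rewrite !(opE adm) (br_jacobi brL) dh // (act0l adm) add0r.
apply: (vsp_ind (killing_subspace brL n) _ Tdec) => v [_ Tv] /=.
have [cv|] := pselect (forall d, T (ad d) -> br d v = 0); last first.
  move=> /existsNP[d /not_implyP[Td dv]]; have [a] := Tv _ Td.
  rewrite (opE adm) => dva; case: (Td) => d' [hd' d'h _ dd'].
  have a0 : a != 0 by apply/eqP => a0; apply: dv; rewrite dva a0 scale0r.
  have : killing br n (a *: v) = 0.
    rewrite -dva -killing_assoc // -(opE adm) (_ : ad n d = - ad d n); last first.
      by rewrite !(opE adm) (br_anti brL).
    rewrite dd' (opE adm) d'h // oppr0 killingC.
    by rewrite killing0r.
  by rewrite killingZr // => /eqP; rewrite mulf_eq0 (negPf a0) => /eqP.
(* The centralizer [c] of these elements lies in [h]: by [cartan_jordan] every element of [h] acts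
   nilpotently on [c], so otherwise Engel's theorem modulo [h] gives an element outside [h] that
   normalizes [h]. *)
have hv : v \in h.
  pose c := vsp [set v | forall d, T (ad d) -> br d v = 0].
  have sc : subspace [set v | forall d, T (ad d) -> br d v = 0].
    split=> [d _|a y z /= cy cz d Td]; first by rewrite (act0r adm).
    by rewrite (actPr adm) cy ?cz // scaler0 addr0.
  have cE w : w \in c <-> forall d, T (ad d) -> br d w = 0 by apply: vspP sc.
  have [/subvP|nch] := boolP (c <= h)%VS; first by apply; apply/cE.
  have Th d y : T (ad d) -> y \in h -> br d y = 0.
    by move=> [e [_ eh _ de]] hy; rewrite -(opE adm) de (opE adm) eh.
  have hc y w : y \in h -> w \in c -> br y w \in c.
    move=> hy /cE cw; apply/cE => d Td; rewrite (br_jacobi brL) (cw d) //.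
    by rewrite (Th d y) // (act0l adm) (act0r adm) addr0.
  have [||||||w [cw nhw hw]] := engel brL (K := h) (A := h) (B := c) => //.
  - exact: cartan_ad_nilp.
  - move=> y w hy cw; have [d [hd dd nd dh]] := cartan_jordan hy.
    have Td : T (ad d) by exists d.
    have [m ym] := nd w; exists m; rewrite (_ : iter m _ _ = 0) ?mem0v //.
    rewrite -[RHS]ym shift0.
    have kc k : iter k (br y) w \in c by elim: k => //= k IHk; apply: hc.
    elim: m {ym} => //= m <-; rewrite (opE adm) (actBl adm).
    by have /cE/(_ d Td)-> := kc m; rewrite subr0.
  - have : w \in h by apply: h_norm => y hy; rewrite (br_anti brL) memvN hw.
    by rewrite (negPf nhw).
rewrite /killing; have [N nN] := gen_eigen0_nilp nilp.
have com w : ad v (ad n w) = ad n (ad v w).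
  rewrite !(opE adm) (br_jacobi brL v n w) (br_anti brL v n) nh //.
  by rewrite oppr0 (act0l adm) add0r.
rewrite (@ltr_nilp _ _ _ N) // => w.
suff -> k : iter k (ad n \o ad v)%VF w = iter k (ad v) (iter k (ad n) w).
  by rewrite nN iter_lfun0.
by elim: k => //= k ->; rewrite comp_lfunE -(iter_commute (g := ad n)).
Qed.

Lemma cartan_central_diag z : z \in h -> (forall y, y \in h -> br z y = 0) ->
  diagonalizable (ad z).
Proof.
move=> hz zh; have [d [hd dd nd dh]] := cartan_jordan hz.
suff /eqP : z - d = 0 by rewrite subr_eq0 => /eqP->.
apply: cartan_central_nilp => // [|y hy]; first by rewrite memvB.
by rewrite (actBl adm) zh ?dh // subrr.
Qed.

(** If [h] is not abelian, the last nonzero term of its lower central series is central in [h] and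
    consists of sums of brackets. For [w] in it, [ad w] is diagonalizable and a sum of commutators
    of operators commuting with it, hence zero. *)
Theorem cartan_abelian x y : x \in h -> y \in h -> br x y = 0.
Proof.
move=> hx hy; apply: contrapT => xy0.
have ex : exists n, `[< lcs n `<=` [set 0] >].
  by case: hC => _ _ [n n0] _; exists n; apply/asboolP.
have /asboolP := ex_minnP ex; case: ex_minnP => m /asboolP m0 mmin _.
case: m => [|[|m]] in m0 mmin.
- by case: xy0; rewrite (m0 x) ?(act0l adm).
- by case: xy0; apply: (m0 (br x y)); apply: bracket_span1.
have : ~ (lcs m.+1 `<=` [set 0]).
  by move=> /asboolP/mmin; rewrite ltnn.
apply=> w mw /=; have hw := lcs_sub mw.
have wh z : z \in h -> br w z = 0.
  by move=> hz; rewrite (br_anti brL) (m0 (br z w)) ?oppr0 //; apply: bracket_span1.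
apply: (ad_eq0_center brL no_abelian_ideal) => v; rewrite -(opE adm).
suff -> : ad w = 0 by rewrite zero_lfunE.
apply: diagonalizable_commutator_eq0; first exact: cartan_central_diag.
have [k [c [X [Y [hX mY wE]]]]] := mw.
rewrite [Z in Z \in _](_ : ad _ = \sum_i c i *: ad (br (X i) (Y i))); last first.
  apply/lfunP => u; rewrite (opE adm) wE (act_suml adm) sum_lfunE.
  by apply: eq_bigr => i _; rewrite scale_lfunE (opE adm) (actZl adm).
apply: memv_suml => i _; apply: memvZ; apply: mem_vsp; exists (ad (X i)), (ad (Y i)).
have com y' u : y' \in h -> ad y' (ad w u) = ad w (ad y' u).
  by move=> hy'; rewrite !(opE adm) (br_jacobi brL) (br_anti brL y') wh // oppr0
    (act0l adm) add0r.
have hYi : Y i \in h by apply: lcs_sub (mY i).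
have hXi : X i \in h by apply: hX.
split=> [u|u|]; [exact: com | exact: com | exact: op_br adm _ _].
Qed.

Lemma cartan_diag x : x \in h -> diagonalizable (ad x).
Proof. by move=> hx; apply: cartan_central_diag => // y; apply: cartan_abelian. Qed.

End CartanSubalgebra.

(** * Graded Lie algebras and graded modules *)

Lemma ltr_stable_lt0 (C : numClosedFieldType) (V : vectType C) (f : 'End(V))
    (U : {vspace V}) : diagonalizable f -> lstable f U ->
  (forall a v, v \in U -> v != 0 -> f v = a *: v -> a < 0) ->
  ltr (f \o projv U)%VF = 0 -> U = 0%VS.
Proof.
move=> df fU neg tr0; have [r _ sp] := genproj_sum f; have [trE dimE] := ltr_stable_diagonalizable sp df fU.
have Ua a : (U :&: lker (shift f a) != 0)%VS -> a < 0.
  move=> /eqP/vspaceN0P[v]; rewrite memv_cap memv_ker shiftE subr_eq0.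
  by move=> /andP[Uv /eqP fv] v0; apply: neg fv.
have : \sum_(a <- r) - a * (\dim (U :&: lker (shift f a)))%:R == 0.
  under eq_bigr do rewrite mulNr.
  by rewrite sumrN -trE tr0 oppr0.
rewrite psumr_eq0 => [/allP t0|a _]; last first.
  have [->|/Ua a0] := eqVneq (U :&: lker (shift f a))%VS 0%VS.
    by rewrite dimv0 mulr0.
  by rewrite mulr_ge0 // oppr_ge0 ltW.
apply/eqP; rewrite -dimv_eq0 dimE big_seq big1 // => a /t0.
have [->|/Ua a0] := eqVneq (U :&: lker (shift f a))%VS 0%VS; first by rewrite dimv0.
by rewrite mulf_eq0 oppr_eq0 lt_eqF //= pnatr_eq0 => /eqP.
Qed.

Lemma ltr_bracket_stable (C : numClosedFieldType) (s l : vectType C)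
    (br : s -> s -> s) (act : s -> l -> l) (A B : {vspace s}) (U : {vspace l}) x :
  lie_module br act -> (forall y v, y \in A -> v \in U -> act y v \in U) ->
  (forall y v, y \in B -> v \in U -> act y v \in U) ->
  x \in bracket_vs br A B -> ltr (op act x \o projv U)%VF = 0.
Proof.
move=> actM AU BU xAB.
apply: (vsp_ind (Q := [set x | ltr (op act x \o projv U)%VF = 0])) xAB.
  split=> [|a y z /= y0 z0].
    rewrite /= (_ : op act 0 = 0) ?comp_lfun0l ?linear0 //.
    by apply/lfunP => v; rewrite (opE actM) (act0l actM) zero_lfunE.
  by rewrite (op_linear actM) comp_lfunDl -comp_lfunZl linearP /= y0 z0 mulr0 addr0.
move=> _ [y Ay [z Bz <-]] /=; rewrite (op_br actM); apply: ltr_comm_stable.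
  by move=> v Uv; rewrite (opE actM) AU.
by move=> v Uv; rewrite (opE actM) BU.
Qed.

(** * Generation of a graded Lie algebra in degree 1 *)

Section GradingElement.
Variables (C : numClosedFieldType) (s : vectType C) (br : s -> s -> s).
Hypothesis brL : lie_algebra br.
Hypothesis no_abelian_ideal : without_abelian_ideal br.
Variable H : s.

Local Notation ad := (op br).
Local Notation killing := (killing br).
Let adm : lie_module br br := adM brL.

(** [H] is kept abstract: it stands for [ES], for [- ES], which reverses the degrees, and for
    elements whose eigenvalues are the heights of the roots up to sign. *)
Definition degree_space (k : int) : {vspace s} := lker (shift (ad H) k%:~R).
Local Notation E := degree_space.

Hypothesis Hdec : forall v, v \in vsp [set v | exists k, v \in E k].
Hypothesis faithful : forall x, x \in E 0 -> (forall y, y \in E 1 -> br y x = 0) -> x = 0.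

Lemma degreeP k v : v \in E k <-> br H v = k%:~R *: v.
Proof.
rewrite memv_ker shiftE (opE adm) subr_eq0.
by split=> [/eqP//|->].
Qed.

Lemma degree_br j k x y : x \in E j -> y \in E k -> br x y \in E (j + k).
Proof.
move=> /degreeP xj /degreeP yk; apply/degreeP.
by rewrite (br_jacobi brL) xj yk (actZl adm) (actZr adm) -scalerDl -intrD.
Qed.

Lemma degree_br_to j k m x y : j + k = m -> x \in E j -> y \in E k -> br x y \in E m.
Proof. by move=> <-; apply: degree_br. Qed.

Lemma degree_diag : diagonalizable (ad H).
Proof.
apply: diagonalizable_spanned => v; move: v (Hdec v); apply/subvP.
apply: vsp_sub => v [k /degreeP vk]; apply: mem_vsp; exists k%:~R.
by rewrite (opE adm).
Qed.

Lemma degree_ind (Q : set s) v : subspace Q ->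
  (forall k v, v \in E k -> Q v) -> Q v.
Proof. by move=> sQ EQ; apply: (vsp_ind sQ _ (Hdec v)) => w [k]; apply: EQ. Qed.

Lemma killing_degree j k x y : x \in E j -> y \in E k -> j + k != 0 -> killing x y = 0.
Proof.
move=> /degreeP xj /degreeP yk jk.
have : killing (br H x) y + killing x (br H y) = 0.
  rewrite (br_anti brL) -scaleN1r killingC (killingZr brL) killingC.
  by rewrite (killing_assoc brL) mulN1r addNr.
rewrite xj yk killingC !(killingZr brL) killingC -mulrDl -intrD => /eqP.
by rewrite mulf_eq0 intr_eq0 (negPf jk) => /eqP.
Qed.

Lemma killing_degree_nondeg k x : x \in E k ->
  (forall y, y \in E (- k) -> killing x y = 0) -> x = 0.
Proof.
move=> xk x0; apply: (killing_nondegenerate brL no_abelian_ideal) => y.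
apply: (degree_ind y (killing_subspace brL x)) => j {}y yj /=.
have [jk|] := eqVneq (k + j) 0; last exact: killing_degree.
by apply: x0; rewrite (_ : - k = j) //; move/eqP: jk; rewrite addrC addr_eq0 => /eqP.
Qed.

(** A separating element may be replaced by its component of degree [- k], the only one that pairs
    with degree [k]. *)
Lemma degree_separation k (U : {vspace s}) v : (U <= E k)%VS -> v \in E k ->
  v \notin U -> exists d, [/\ d \in E (- k), killing d v != 0
    & forall u, u \in U -> killing d u = 0].
Proof.
move=> UE vk Uv; have [d [dU dv]] := killing_separation brL no_abelian_ideal Uv.
have dk u : u \in E k -> killing (genproj (ad H) (- k)%:~R d) u = killing d u.
  move=> uk; rewrite killingC [RHS]killingC.
  have sK : subspace [set d | killing u (genproj (ad H) (- k)%:~R d) = killing u d].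
    split=> [|a y z /= y0 z0]; first by rewrite /= linear0.
    by rewrite linearP !(killing_linear brL) y0 z0.
  apply: (degree_ind d sK) => j {dU dv}d dj /=.
  have gd : gen_eigen (ad H) j%:~R d.
    by apply: eigen_gen_eigen; rewrite (opE adm); apply/degreeP.
  have [jk|jk] := eqVneq j (- k); first by rewrite -jk genproj_id.
  rewrite (genproj_out gd) ?(killing0r brL) ?eqr_int 1?eq_sym //.
  by rewrite killingC (killing_degree dj uk) // addr_eq0.
exists (genproj (ad H) (- k)%:~R d); split.
- by apply/degreeP; rewrite -(opE adm) genproj_eigen //; apply: degree_diag.
- by rewrite dk.
- by move=> u Uu; rewrite dk ?dU //; apply: (subvP UE).
Qed.

(** An element [d] of degree 0 orthogonal to all these brackets commutes with [E 1], by invariance,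
    and is zero by faithfulness. In particular [H] is a sum of brackets. *)
Lemma degree0_bracket : (E 0 <= bracket_vs br (E 1) (E (-1)))%VS.
Proof.
apply/subvP => v v0; apply/negPn/negP => vU.
have UE : (bracket_vs br (E 1) (E (-1)) <= E 0)%VS.
  by apply: bracket_sub => x y x1 y1; apply: degree_br_to x1 y1.
have [d [d0 /negP dv dU]] := degree_separation UE v0 vU.
apply: dv; suff -> : d = 0 by rewrite killingC (killing0r brL).
rewrite oppr0 in d0; apply: faithful => // e e1.
apply: (@killing_degree_nondeg 1); first by apply: degree_br_to e1 d0.
move=> f f1; rewrite (br_anti brL) -scaleN1r killingC (killingZr brL) killingC.
by rewrite (killing_assoc brL) dU ?mulr0 //; apply: mem_bracket.
Qed.

(** The vectors of degree [k] annihilated by [E 1] generate under [E (-1)] a subspace [U] stable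
    under both. On [U], [H] is traceless, being a sum of brackets, but all its eigenvalues are
    negative; so [U] is zero. *)
Lemma degree_singular k f : k < 0 -> f \in E k ->
  (forall e, e \in E 1 -> br e f = 0) -> f = 0.
Proof.
move=> k0 fk f0.
pose F := vsp [set f | f \in E k /\ forall e, e \in E 1 -> br e f = 0].
have sF : subspace [set f | f \in E k /\ forall e, e \in E 1 -> br e f = 0].
  split=> [|a y z /= [yk y0] [zk z0]].
    by split=> [|e _]; rewrite ?mem0v // (act0r adm).
  split=> [|e e1]; first by rewrite memvD ?memvZ.
  by rewrite (actPr adm) y0 ?z0 // scaler0 addr0.
have FE u : u \in F <-> u \in E k /\ forall e, e \in E 1 -> br e u = 0 by apply: vspP sF.
pose W j := iter j (bracket_vs br (E (-1))) F.
pose U := vsp [set v | exists j, v \in W j].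
have WU j v : v \in W j -> v \in U by move=> Wv; apply: mem_vsp; exists j.
have Wdeg j v : v \in W j -> v \in E (k - j%:Z).
  elim: j v => [|j IHj] v; first by rewrite subr0 => /FE[].
  move: v; apply/subvP; apply: bracket_sub => x y x1 /IHj yj.
  by apply: degree_br_to x1 yj; lia.
have W0 j x v : x \in E 0 -> v \in W j -> br x v \in W j.
  move=> x0; elim: j v => [|j IHj] v.
    move=> /FE[vk v1]; apply/FE; split; first by rewrite -[k]add0r; apply: degree_br.
    move=> e e1; rewrite (br_jacobi brL) (v1 e) // (act0r adm) addr0 v1 //.
    by apply: degree_br_to e1 x0.
  move=> Wv; apply: (vsp_ind (Q := [set v | br x v \in W j.+1])) Wv.
    exact: (subspace_act adm).
  move=> _ [y y1 [w Ww <-]] /=; rewrite (br_jacobi brL) memvD ?mem_bracket ?IHj //.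
  by apply: degree_br_to x0 y1.
have Um f' v : f' \in E (-1) -> v \in U -> br f' v \in U.
  move=> f1 Uv; apply: (vsp_ind (Q := [set v | br f' v \in U])) Uv.
    exact: (subspace_act adm).
  by move=> w [j Ww]; apply: (WU j.+1); apply: mem_bracket.
have Wp j e v : e \in E 1 -> v \in W j -> br e v \in U.
  move=> e1; elim: j v => [|j IHj] v; first by move=> /FE[_ ->] //; rewrite mem0v.
  move=> Wv; apply: (vsp_ind (Q := [set v | br e v \in U])) Wv.
    exact: (subspace_act adm).
  move=> _ [y y1 [w Ww <-]] /=; rewrite (br_jacobi brL); apply: memvD.
    by apply: (WU j); apply: W0 => //; apply: degree_br_to e1 y1.
  by apply: Um => //; apply: IHj.
have Up e v : e \in E 1 -> v \in U -> br e v \in U.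
  move=> e1 Uv; apply: (vsp_ind (Q := [set v | br e v \in U])) Uv.
    exact: (subspace_act adm).
  by move=> w [j Ww]; apply: Wp e1 Ww.
have HE : H \in E 0 by apply/degreeP; rewrite (brxx brL) scale0r.
have HU := ltr_bracket_stable adm Up Um (subvP degree0_bracket _ HE).
have U0 : U = 0%VS.
  apply: ltr_stable_lt0 HU; first exact: degree_diag.
    move=> v Uv; rewrite (opE adm); apply: (vsp_ind (Q := [set v | br H v \in U])) Uv.
      exact: (subspace_act adm).
    by move=> w [j Ww]; apply: (WU j); apply: W0.
  move=> a v Uv v0 va; apply: contraNT v0 => a0.
  rewrite -(genproj_id (eigen_gen_eigen va)); apply/eqP.
  apply: (vsp_ind (Q := [set v | genproj (ad H) a v = 0])) Uv.
    by split=> [|c y z /= y0 z0]; rewrite /= ?linear0 // linearP /= y0 z0 scaler0 addr0.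
  move=> w [j /Wdeg/degreeP wj] /=; apply: (genproj_out (b := (k - j%:Z)%:~R)).
    by apply: eigen_gen_eigen; rewrite (opE adm).
  by apply: contraNneq a0 => ->; rewrite ltrz0; lia.
apply/eqP; rewrite -memv0 -U0; apply: (WU 0%N); exact/FE.
Qed.

(** Dual to [degree_singular]: an element of degree [- (k + 1)] orthogonal to the brackets is
    annihilated by [E 1]. *)
Theorem degree_generation k : 0 <= k -> (E (k + 1) <= bracket_vs br (E 1) (E k))%VS.
Proof.
move=> k0; apply/subvP => v vk; apply/negPn/negP => vU.
have UE : (bracket_vs br (E 1) (E k) <= E (k + 1))%VS.
  by apply: bracket_sub => x y x1 yk; apply: degree_br_to x1 yk; rewrite addrC.
have [d [dk /negP dv dU]] := degree_separation UE vk vU.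
apply: dv; suff -> : d = 0 by rewrite killingC (killing0r brL).
apply: (degree_singular _ dk); first by lia.
move=> e e1; apply: (@killing_degree_nondeg (- k)).
  by apply: degree_br_to e1 dk; lia.
rewrite opprK => y yk; rewrite (br_anti brL) -scaleN1r killingC (killingZr brL) killingC.
by rewrite (killing_assoc brL) dU ?mulr0 //; apply: mem_bracket.
Qed.

End GradingElement.

Section Gradations.
Variables (C : numClosedFieldType) (V : vectType C) (gr : int -> set V).
Hypothesis grV : gradation gr.

Let grS p : subspace (gr p). Proof. by case: grV. Qed.

Lemma gradation_span v : v \in vsp [set v | exists p, gr p v].
Proof.
case: grV => _ /(_ v)[r [y [gy ->]]] _.
by apply: memv_suml => p _; apply: mem_vsp; exists p.
Qed.

Lemma gradation_proj p : exists f : 'End(V),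
  forall q v, gr q v -> f v = if q == p then v else 0.
Proof.
pose A := vsp (gr p); pose A' := vsp [set v | exists2 q, q != p & gr q v].
have AA' : (A :&: A' = 0)%VS.
  apply/vspace0P => v /memv_capP[/(vspP _ (grS p)) pv vA'].
  (* Uniqueness in a gradation is stated for sequences without repetition, so a vector of [A'] is
     first written over such a sequence avoiding [p]; being also in [A], it gives a relation over
     [p :: r]. *)
  pose Q : set V := [set v | exists (r : seq int) (y : int -> V),
    [/\ uniq r, p \notin r, forall q, gr q (y q) & v = \sum_(q <- r) y q]].
  have [r [y [ur pr gy vE]]] : Q v.
    apply: vsp_ind vA' => [|w [q qp qw]]; last first.
      exists [:: q], (fun q' => if q' == q then w else 0); split=> //.
      - by rewrite inE eq_sym.
      - by move=> q'; case: eqP => [->|_] //; case: (grS q').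
      - by rewrite big_seq1 eqxx.
    split=> [|a _ _ [r1 [y1 [u1 p1 g1 ->]]] [r2 [y2 [u2 p2 g2 ->]]]].
      exists [::], (fun=> 0); split=> // [q|]; last by rewrite big_nil.
      by case: (grS q).
    pose cut (r : seq int) y (q : int) : V := if q \in r then y q else 0.
    have cutE (r r' : seq int) (y : int -> V) : uniq r -> uniq r' -> {subset r <= r'} ->
        \sum_(q <- r) y q = \sum_(q <- r') cut r y q.
      move=> ur ur' sub; rewrite -big_mkcond -big_filter; apply: perm_big.
      apply: uniq_perm; rewrite ?filter_uniq // => q; rewrite mem_filter andb_idr //.
      exact: sub.
    have gcut r y q : (forall q, gr q (y q)) -> gr q (cut r y q).
      by move=> gy; rewrite /cut; case: ifP => // _; case: (grS q).
    exists (undup (r1 ++ r2)), (fun q => a *: cut r1 y1 q + cut r2 y2 q); split.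
    - exact: undup_uniq.
    - by rewrite mem_undup mem_cat negb_or p1.
    - by move=> q; case: (grS q) => _; apply; apply: gcut.
    - rewrite big_split -scaler_sumr /=; congr (_ *: _ + _); apply: cutE;
        rewrite ?undup_uniq // => q rq; by rewrite mem_undup mem_cat rq ?orbT.
  case: grV => _ _ /(_ (p :: r) (fun q => if q == p then - v else y q)) uni.
  have := uni _ _ _ p (mem_head _ _); rewrite eqxx => /(_ _ _ _)/eqP.
  rewrite oppr_eq0 => v0; apply/eqP/v0; first by rewrite /= pr.
    move=> q; case: eqP => [->|_] //; rewrite -scaleN1r; exact: subspaceZ.
  rewrite big_cons eqxx {1}vE addrC; apply/eqP; rewrite subr_eq0; apply/eqP.
  rewrite big_seq [RHS]big_seq; apply: eq_bigr => q rq; case: eqP => // qp.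
  by rewrite -qp rq in pr.
have full w : w \in (A + A')%VS.
  move: w (gradation_span w); apply/subvP; apply: vsp_sub => w [q qw].
  have [qp|qp] := eqVneq q p.
    by apply: (subvP (addvSl A A')); apply: mem_vsp; rewrite -qp.
  by apply: (subvP (addvSr A A')); apply: mem_vsp; exists q.
exists (daddv_pi A A') => q v qv; case: eqP => [qp|/eqP qp].
  by rewrite daddv_pi_id //; apply: mem_vsp; rewrite -qp.
have /esym/eqP := daddv_pi_add AA' (full v).
rewrite [daddv_pi A' A v]daddv_pi_id; last first.
- by apply: mem_vsp; exists q.
- by rewrite capvC.
by rewrite eq_sym -subr_eq0 addrK => /eqP.
Qed.

Lemma gradation_eigenspace (f : 'End(V)) c p v :
  (forall q v, gr q v -> f v = (q%:~R + c) *: v) ->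
  (v \in lker (shift f (p%:~R + c))) <-> gr p v.
Proof.
move=> fE; rewrite memv_ker shiftE subr_eq0; split=> [/eqP fv|/fE->//].
rewrite -(genproj_id (eigen_gen_eigen fv)).
apply: (vsp_ind (Q := [set v | gr p (genproj f (p%:~R + c) v)]) _ _ (gradation_span v)).
  split=> [|a x y /= gx gy]; first by rewrite /= linear0; case: (grS p).
  by rewrite linearP; case: (grS p) => _; apply.
move=> w [q qw] /=; have fw := eigen_gen_eigen (fE q w qw).
have [qp|qp] := eqVneq q p; first by rewrite genproj_id -qp.
rewrite (genproj_out fw); first by case: (grS p).
by rewrite (inj_eq (addIr _)) eqr_int eq_sym.
Qed.

End Gradations.

Section GradedModules.
Variables (C : numClosedFieldType) (s l : vectType C).
Variables (br : s -> s -> s) (gs : int -> set s) (act : s -> l -> l) (gl : int -> set l).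
Variable ES : s.
Hypothesis gsL : graded_lie_algebra br gs.
Hypothesis no_abelian_ideal : without_abelian_ideal br.
Hypothesis trans : transitive_gr gs br gs.
Hypothesis ESd : forall p X, gs p X -> br ES X = p%:~R *: X.

Let brL : lie_algebra br. Proof. by case: gsL. Qed.
Let adm : lie_module br br := adM brL.
Let gsG : gradation gs. Proof. by case: gsL. Qed.

Local Notation E := (degree_space br ES).

Lemma gsP p x : x \in E p <-> gs p x.
Proof.
have := @gradation_eigenspace _ _ _ gsG (op br ES) 0 p x; rewrite addr0; apply.
by move=> q v qv; rewrite (opE adm) addr0; apply: ESd.
Qed.

Lemma gs_span v : v \in vsp [set v | exists k, v \in E k].
Proof.
move: v (gradation_span gsG v); apply/subvP; apply: vsp_sub => v [p pv].
by apply: mem_vsp; exists p; apply/gsP.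
Qed.

Lemma transE p x : 0 <= p -> x \in E p ->
  (forall y, y \in E (-1) -> br y x = 0) -> x = 0.
Proof.
move=> p0 /gsP xp x0; apply: contrapT => xN0.
by have [y /gsP y1] := trans p0 xp xN0; apply; apply: x0.
Qed.

Let brE j k m x y : j + k = m -> x \in E j -> y \in E k -> br x y \in E m.
Proof. exact: degree_br_to. Qed.

Let EN k : degree_space br (- ES) k = E (- k).
Proof.
apply/vspaceP => x; apply/idP/idP => /(degreeP brL) xk; apply/(degreeP brL).
  by rewrite -[ES]opprK (actNl adm) xk intrN scaleNr.
by rewrite (actNl adm) xk intrN scaleNr opprK.
Qed.

Let ENspan v : v \in vsp [set v | exists k, v \in degree_space br (- ES) k].
Proof.
move: v (gs_span v); apply/subvP; apply: vsp_sub => v [k vk].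
by apply: mem_vsp; exists (- k); rewrite EN opprK.
Qed.

(** Transitivity makes degree 0 faithful on degree -1; the Killing form, which pairs degrees -1 and
    1, transfers this to degree 1. *)
Lemma gs_faithful1 x : x \in E 0 -> (forall y, y \in E 1 -> br y x = 0) -> x = 0.
Proof.
move=> x0 x1; apply: (transE (lexx 0) x0) => f f1.
apply: (killing_degree_nondeg brL no_abelian_ideal gs_span (k := -1)).
  by apply: brE f1 x0.
rewrite opprK => e e1; rewrite (killing_assoc brL) (br_anti brL) x1 // oppr0.
exact: killing0r.
Qed.

Lemma gs_generation_pos k : 0 <= k -> (E (k + 1) <= bracket_vs br (E 1) (E k))%VS.
Proof. exact: (degree_generation brL no_abelian_ideal gs_span gs_faithful1). Qed.

Lemma gs_generation_neg k : 0 <= k -> (E (- (k + 1)) <= bracket_vs br (E (-1)) (E (- k)))%VS.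
Proof.
move=> k0; have := @degree_generation _ _ _ brL no_abelian_ideal (- ES) ENspan _ k k0.
rewrite !EN; apply=> x; rewrite oppr0 => x0 xf; by apply: transE x0 _.
Qed.

Section Module.
Hypothesis actM : lie_module br act.

(* [s] is generated by its components of degree -1, 0 and 1. *)
Lemma local_stable (U : {vspace l}) :
  (forall x v, x \in E (-1) -> v \in U -> act x v \in U) ->
  (forall x v, x \in E 0 -> v \in U -> act x v \in U) ->
  (forall x v, x \in E 1 -> v \in U -> act x v \in U) ->
  forall x v, v \in U -> act x v \in U.
Proof.
move=> Um U0 Up x v Uv.
have sS w : subspace [set x | act x w \in U].
  split=> [|a y z /= yU zU]; first by rewrite /= (act0l actM) mem0v.
  by rewrite (actPl actM) memvD ?memvZ.
have brU (A B : {vspace s}) : (forall x v, x \in A -> v \in U -> act x v \in U) ->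
    (forall x v, x \in B -> v \in U -> act x v \in U) ->
    forall x v, x \in bracket_vs br A B -> v \in U -> act x v \in U.
  move=> AU BU y w yAB Uw; apply: (vsp_ind (sS w) _ yAB) => _ [a Aa [b Bb <-]] /=.
  by rewrite (act_br actM) memvB //; [apply/AU/BU | apply/BU/AU].
have Upos (k : nat) y w : y \in E k%:Z -> w \in U -> act y w \in U.
  elim: k y w => [|k IHk] y w; first exact: U0.
  move=> yk; apply: (brU (E 1) (E k%:Z)) => //.
  by apply: (subvP (gs_generation_pos (le0z_nat k))); rewrite -PoszD addn1.
have Uneg (k : nat) y w : y \in E (- k%:Z) -> w \in U -> act y w \in U.
  elim: k y w => [|k IHk] y w; first by rewrite oppr0; apply: U0.
  move=> yk; apply: (brU (E (-1)) (E (- k%:Z))) => //.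
  by apply: (subvP (gs_generation_neg (le0z_nat k))); rewrite -PoszD addn1.
apply: (vsp_ind (sS v) _ (gs_span x)) => y [k yk] /=.
case: (intP k) yk => [|n|n] yk; first exact: U0.
  exact: Upos yk Uv.
exact: Uneg yk Uv.
Qed.

End Module.

Hypothesis glM : graded_module br gs act gl.
Hypothesis irr : lie_irreducible act.

Let actM : lie_module br act. Proof. by case: glM. Qed.
Let glG : gradation gl. Proof. by case: glM. Qed.

Lemma irreducible_stable (U : {vspace l}) : (forall x v, v \in U -> act x v \in U) ->
  U <> 0%VS -> forall v, v \in U.
Proof.
move=> Us U0; case: irr => _ /(_ [set` U] (subspace_vspace U) Us)[UE|UE] v.
  by case: U0; apply/vspace0P => w Uw; have : [set` U] w by []; rewrite UE.
by have : [set: l] v by []; rewrite -UE.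
Qed.

Let gl_act p q x v : x \in E p -> gl q v -> gl (p + q) (act x v).
Proof. by move=> /gsP px; case: glM => _ _ glact; apply: glact. Qed.

Let glS p : subspace (gl p). Proof. by case: glG. Qed.

(* Schur's lemma for the difference of [ES] and the degree operator. *)
Lemma degree_shift_exists : exists c : C,
  forall p v, gl p v -> act ES v = (p%:~R + c) *: v.
Proof.
have [p0 lp0] : exists p, vsp (gl p) <> 0%VS.
  apply/existsNP => gl0; case: irr => + _; apply; apply/seteqP; split=> [v _ /=|] //.
  apply/eqP; rewrite -memv0; move: v (gradation_span glG v); apply/subvP.
  by apply: vsp_sub => v [p pv]; rewrite -(gl0 p) mem_vsp.
have ES0 : ES \in E 0 by apply/(degreeP brL); rewrite (brxx brL) scale0r.
have [|mu [v0 [v0p v0N0]]] := eigenvector_exists (f := op act ES) _ lp0.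
  move=> v /(vspP _ (glS p0)) vp; apply/(vspP _ (glS p0)).
  by rewrite (opE actM) -[p0]add0r; apply: gl_act.
move: v0p => /(vspP _ (glS p0)) v0p; rewrite (opE actM) => v0mu.
pose c := mu - p0%:~R; exists c => p v pv.
pose W := vsp [set v | exists2 p, gl p v & act ES v = (p%:~R + c) *: v].
have Wall : forall v, v \in W.
  apply: irreducible_stable => [x w Ww|].
    apply: (vsp_ind (subspace_act actM x W) _ Ww) => {Ww}w [q qw wE] /=.
    have sS : subspace [set x | act x w \in W].
      split=> [|a y z /= yU zU]; first by rewrite /= (act0l actM) mem0v.
      by rewrite (actPl actM) memvD ?memvZ.
    apply: (vsp_ind sS _ (gs_span x)) => y [k yk] /=; apply: mem_vsp.
    exists (k + q); first exact: gl_act.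
    rewrite (actAC actM) wE (actZr actM); move/(degreeP brL): (yk) => ->.
    by rewrite (actZl actM) -scalerDl intrD addrA.
  move=> /vspace0P W0; case/eqP: v0N0; apply: W0; apply: mem_vsp; exists p0 => //.
  by rewrite v0mu /c addrC subrK.
have [f fE] := gradation_proj glG p.
have : act ES (f v) = (p%:~R + c) *: f v.
  apply: (vsp_ind (Q := [set v | act ES (f v) = (p%:~R + c) *: f v])) (Wall v).
    split=> [|a x y /= x0 y0]; first by rewrite /= linear0 (act0r actM) scaler0.
    by rewrite linearP /= (actPr actM) x0 y0 scalerDr !scalerA mulrC.
  move=> w [q qw wE] /=; rewrite (fE _ _ qw).
  by case: eqP => [<-|_] //; rewrite (act0r actM) scaler0.
by rewrite (fE _ _ pv) eqxx.
Qed.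

Definition degree_shift : C := sval (cid degree_shift_exists).

Lemma act_ES p v : gl p v -> act ES v = (p%:~R + degree_shift) *: v.
Proof. by rewrite /degree_shift; case: cid => c /= cE; apply: cE. Qed.

(** The component [gl p], recovered as an eigenspace of [ES] and thereby as a [{vspace l}]; see
    [glP]. *)
Definition grade p : {vspace l} := lker (shift (op act ES) (p%:~R + degree_shift)).
Local Notation L := grade.

Lemma glP p v : v \in L p <-> gl p v.
Proof.
apply: (gradation_eigenspace glG) => q w qw; rewrite (opE actM); exact: act_ES.
Qed.

Lemma gradeP p v : v \in L p <-> act ES v = (p%:~R + degree_shift) *: v.
Proof.
rewrite memv_ker shiftE (opE actM) subr_eq0.
by split=> [/eqP//|->].
Qed.

Lemma act_grade p q m x v : p + q = m -> x \in E p -> v \in L q -> act x v \in L m.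
Proof. by move=> <- px /glP qv; apply/glP; apply: gl_act. Qed.

Lemma grade_span v : v \in vsp [set v | exists p, v \in L p].
Proof.
move: v (gradation_span glG v); apply/subvP; apply: vsp_sub => v [p pv].
by apply: mem_vsp; exists p; apply/glP.
Qed.

Definition ladder (e : int) (M : {vspace l}) k := iter k (bracket_vs act (E e)) M.

Section Ladder.
Variables (p : int) (M : {vspace l}).
Hypothesis ML : (M <= L p)%VS.
Hypothesis M0 : forall x v, x \in E 0 -> v \in M -> act x v \in M.

Lemma ladder_grade e k v : v \in ladder e M k -> v \in L (p + e * k%:Z).
Proof.
elim: k v => [|k IHk] v; first by rewrite mulr0 addr0; apply: (subvP ML).
move: v; apply/subvP; apply: bracket_sub => x v xe /IHk vk.
by apply: act_grade xe vk; lia.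
Qed.

Lemma ladder_stable0 e k x v : x \in E 0 -> v \in ladder e M k -> act x v \in ladder e M k.
Proof.
move=> x0; elim: k v => [|k IHk] v; first exact: M0.
move=> vk; apply: (vsp_ind (subspace_act actM x (ladder e M k.+1)) _ vk).
move=> _ [y ye [w wk <-]] /=; rewrite (actAC actM).
apply: memvD; first by apply: mem_bracket => //; apply: brE x0 ye; rewrite add0r.
by apply: mem_bracket => //; apply: IHk.
Qed.

(** [x] is moved to the right past the elements of degree [e]: each commutator has degree 0 and
    preserves the rungs, and the innermost product is in [M] by hypothesis. *)
Lemma ladder_back e k x v :
  (forall x y v, x \in E (- e) -> y \in E e -> v \in M -> act x (act y v) \in M) ->
  x \in E (- e) -> v \in ladder e M k.+1 -> act x v \in ladder e M k.
Proof.
move=> Mb xe; elim: k v => [|k IHk] v vk.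
  apply: (vsp_ind (subspace_act actM x (ladder e M 0)) _ vk).
  by move=> _ [y ye [w wk <-]]; apply: Mb.
apply: (vsp_ind (subspace_act actM x (ladder e M k.+1)) _ vk).
move=> _ [y ye [w wk <-]] /=; rewrite (actAC actM) memvD //.
  by apply: (ladder_stable0 (k := k.+1)) => //; apply: brE xe ye; rewrite addNr.
by apply: mem_bracket => //; apply: IHk.
Qed.

Hypothesis Mpm : forall x y v, x \in E 1 -> y \in E (-1) -> v \in M -> act x (act y v) \in M.
Hypothesis Mmp : forall x y v, x \in E (-1) -> y \in E 1 -> v \in M -> act x (act y v) \in M.
Hypothesis MN0 : M <> 0%VS.

(* The submodule generated by [M] meets the component of degree [p] in [M]
   only, and it is the whole of [l]. *)
Theorem ladder_full e k v : `|e|%N = 1%N -> v \in L (p + e * k%:Z) -> v \in ladder e M k.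
Proof.
move=> e1 vk; pose sg (e : int) := (e == 1) || (e == -1).
have sge : sg e by rewrite /sg; lia.
(* The sum of the ascending and the descending ladder is stable under degrees -1, 0 and 1, hence
   under [s]; its part in a given degree is a single rung. *)
pose W := vsp [set v | exists f k, sg f /\ v \in ladder f M k].
have LW f j w : sg f -> w \in ladder f M j -> w \in W.
  by move=> sf wj; apply: mem_vsp; exists f, j.
have Wf f x w : sg f -> x \in E f -> w \in W -> act x w \in W.
  move=> sf xf Ww; apply: (vsp_ind (subspace_act actM x W) _ Ww) => {Ww}w [g [j [sgg wj]]] /=.
  have [gf|gf] := eqVneq g f.
    by rewrite gf in wj; apply: (LW f j.+1) => //; apply: mem_bracket.
  have gE : f = - g by move: sf sgg gf; rewrite /sg; lia.
  case: j wj => [|j] wj.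
    by apply: (LW f 1%N) => //; apply: mem_bracket.
  apply: (LW g j) => //; apply: ladder_back wj; rewrite -?gE // => y z u.
  move: sgg; rewrite /sg gE => /orP[]/eqP->; [exact: Mmp | exact: Mpm].
have Wall : forall v, v \in W.
  apply: irreducible_stable; last first.
    have [w Mw w0] := vspaceN0P MN0; move/vspace0P => W0; move/eqP: w0; apply.
    by apply: W0; apply: (LW e 0%N).
  apply: (local_stable actM) => [x w|x w x0 Ww|x w]; [exact: Wf| |exact: Wf].
  apply: (vsp_ind (subspace_act actM x W) _ Ww) => {Ww}w [g [j [sgg wj]]] /=.
  by apply: (LW g j) => //; apply: ladder_stable0.
pose f := genproj (op act ES) ((p + e * k%:Z)%:~R + degree_shift).
have ge q w : w \in L q -> gen_eigen (op act ES) (q%:~R + degree_shift) w.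
  by move=> /gradeP wq; apply: eigen_gen_eigen; rewrite (opE actM).
rewrite -(genproj_id (ge _ _ vk)).
apply: (vsp_ind (Q := [set v | f v \in ladder e M k])) (Wall v).
  exact: (subspace_ker f (subspace_vspace _)).
move=> w [g [j [sgg wj]]] /=; have wg := ladder_grade wj.
have [kj|kj] := eqVneq (p + e * k%:Z) (p + g * j%:Z); last first.
  by rewrite /f (genproj_out (ge _ _ wg)) ?mem0v // (inj_eq (addIr _)) eqr_int.
rewrite /f kj genproj_id; last exact: ge.
have [kj'|[k0 j0]] : (k = j /\ e = g) \/ (k = 0%N /\ j = 0%N).
  by move: sge sgg kj; rewrite /sg => /orP[]/eqP-> /orP[]/eqP->; lia.
  by case: kj' => -> ->.
by move: wj; rewrite k0 j0.
Qed.

End Ladder.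

End GradedModules.

(** * Weights *)

Section WeightSpaces.
Variables (C : numClosedFieldType) (s l : vectType C) (h : {vspace s}).
Variables (br : s -> s -> s) (act : s -> l -> l).
Hypothesis actM : lie_module br act.
Local Notation dual := 'Hom(subvs_of h, C^o).
Implicit Types (lam : dual) (v : l).

Lemma weightE lam v x : x \in h -> weight_space act lam v ->
  act x v = lam (vsproj h x) *: v.
Proof. by move=> hx lv; have := lv (vsproj h x); rewrite vsprojK. Qed.

Lemma weight_space_subspace lam : subspace (weight_space act lam).
Proof.
split=> [H|a u v ul vl H]; first by rewrite (act0r actM) scaler0.
by rewrite (actPr actM) ul vl scalerDr !scalerA mulrC.
Qed.

Lemma joint_weight v : (forall x, x \in h -> exists a, act x v = a *: v) ->
  exists lam, weight_space act lam v.
Proof.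
have [-> _|v0 vj] := eqVneq v 0.
  by exists 0 => H; rewrite (act0r actM) scaler0.
(* The coordinate along the single vector [v] reads off the eigenvalue, linearly in the element of
   [h]. *)
pose X : 1.-tuple l := [tuple v].
pose lam : subvs_of h -> C^o := fun H => coord X 0 (act (vsval H) v).
have llam : linear lam.
  by move=> a H K; rewrite /lam linearP /= (actPl actM) linearP.
exists (linfun lam) => H; rewrite linfunE //.
have [a Ha] := vj (vsval H) (subvsP H).
have /(_ 0 0) := coord_free (X := X) _ _; rewrite seq1_free => /(_ v0) /= vE.
rewrite /lam Ha linearZ /= vE; congr (_ *: _); exact: (esym (mulr1 a)).
Qed.

Lemma weights_ex lam : weights act lam -> exists2 v, v != 0 & weight_space act lam v.
Proof.
move=> wl; apply: contrapT => nex; apply: wl; apply/seteqP; split=> v /=.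
  by move=> lv; apply/eqP; apply: contrapT => /negP v0; apply: nex; exists v.
by move=> ->; case: (weight_space_subspace lam).
Qed.

Lemma weights_intro lam v : v != 0 -> weight_space act lam v -> weights act lam.
Proof.
move=> v0 lv wl; move: lv; rewrite wl => /= lv.
by rewrite lv eqxx in v0.
Qed.

Lemma weight_act (alpha lam : dual) x v : lie_module br br -> weight_space br alpha x ->
  weight_space act lam v -> weight_space act (alpha + lam) (act x v).
Proof.
move=> adm xa lv H; rewrite (actAC actM) xa lv (actZl actM) (actZr actM).
by rewrite -scalerDl add_lfunE.
Qed.

Hypothesis diag : forall x, x \in h -> diagonalizable (op act x).
Hypothesis h_comm : forall x y, x \in h -> y \in h -> br x y = 0.

Lemma weight_span (U : {vspace l}) : (forall x v, x \in h -> v \in U -> act x v \in U) ->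
  (U <= vsp [set v | v \in U /\ exists lam, weight_space act lam v])%VS.
Proof.
move=> hU; apply: (subv_trans (joint_eigenvectors
    (T := [set f | exists2 x, x \in h & f = op act x]) _ _)).
- move=> _ [x hx ->]; split; first exact: diag.
  by move=> v Uv; rewrite (opE actM); apply: hU.
- move=> _ _ v [x hx ->] [y hy ->]; rewrite !(opE actM) (actAC actM) h_comm //.
  by rewrite (act0l actM) add0r.
apply: vsp_sub => v [Uv jv]; apply: mem_vsp; split=> //; apply: joint_weight => x hx.
have [|a] := jv (op act x); first by exists x.
by rewrite (opE actM) => xv; exists a.
Qed.

Lemma weight_ind (Q : set l) v : subspace Q ->
  (forall lam w, weight_space act lam w -> Q w) -> Q v.
Proof.
move=> sQ lQ; have full : forall x w, x \in h -> w \in fullv -> act x w \in fullv.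
  by move=> *; rewrite memvf.
apply: (vsp_ind sQ _ (subvP (weight_span full) _ (memvf v))) => w [_ [lam lw]].
exact: lQ lw.
Qed.

End WeightSpaces.

Section Weights.
Variables (C : numClosedFieldType) (s l : vectType C).
Variables (br : s -> s -> s) (gs : int -> set s) (act : s -> l -> l) (gl : int -> set l).
Variables (ES : s) (h : {vspace s}).
Hypothesis gsL : graded_lie_algebra br gs.
Hypothesis no_abelian_ideal : without_abelian_ideal br.
Hypothesis ESd : forall p X, gs p X -> br ES X = p%:~R *: X.
Hypothesis glM : graded_module br gs act gl.
Hypothesis irr : lie_irreducible act.
Hypothesis hC : cartan_subalgebra br [set` h].
Hypothesis hES : ES \in h.

Let brL : lie_algebra br. Proof. by case: gsL. Qed.
Let adm : lie_module br br := adM brL.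
Let actM : lie_module br act. Proof. by case: glM. Qed.
Local Notation dual := 'Hom(subvs_of h, C^o).
Local Notation E := (degree_space br ES).
Local Notation L := (grade gsL ESd glM irr).
Local Notation c := (degree_shift gsL ESd glM irr).

Lemma h_comm x y : x \in h -> y \in h -> br x y = 0.
Proof. exact: (cartan_abelian brL no_abelian_ideal hC). Qed.

Lemma h_diag x : x \in h -> diagonalizable (op br x).
Proof. exact: (cartan_diag brL no_abelian_ideal hC). Qed.

Lemma h_degree0 x : x \in h -> x \in E 0.
Proof. by move=> hx; apply/(degreeP brL); rewrite h_comm // scale0r. Qed.

Lemma h_self_centralizing x : (forall y, y \in h -> br x y = 0) -> x \in h.
Proof.
by move=> xh; case: hC => _ _ _; apply=> y hy; rewrite /= xh // mem0v.
Qed.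

Lemma root_ind (Q : set s) v : subspace Q ->
  (forall alpha : dual, forall w, weight_space br alpha w -> Q w) -> Q v.
Proof. exact: (weight_ind adm h_diag h_comm). Qed.

(** The commuting operators of [h] have a common eigenvector even without diagonalizability; hence
    the weight vectors span a nonzero submodule, which is all of [l]. *)
Lemma act_diag x : x \in h -> diagonalizable (op act x).
Proof.
pose T := [set f | exists2 x, x \in h & f = op act x].
have [||/vspace0P l0|v0 [_ v0N0 Tv0]] := common_eigenvector (T := T) (U := fullv).
- by move=> f _ v _; rewrite memvf.
- move=> _ _ v [y hy ->] [z hz ->]; rewrite !(opE actM) (actAC actM) h_comm //.
  by rewrite (act0l actM) add0r.
- case: irr => + _ => /(_ _)[]; apply/seteqP; split=> v //= _.
  by apply: l0; rewrite memvf.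
have [lam0 v0lam] : exists lam, weight_space (h := h) act lam v0.
  apply: (joint_weight actM) => y hy; have [|a] := Tv0 (op act y); first by exists y.
  by rewrite (opE actM) => yv; exists a.
pose W := vsp [set v | exists lam, weight_space (h := h) act lam v].
have Wall : forall v, v \in W.
  apply: (irreducible_stable irr) => [y v Wv|/vspace0P W0]; last first.
    by case/eqP: v0N0; apply: W0; apply: mem_vsp; exists lam0.
  apply: (vsp_ind (subspace_act actM y W) _ Wv) => {Wv}v [lam vlam] /=.
  have sS : subspace [set x | act x v \in W].
    split=> [|a u w /= yU zU]; first by rewrite /= (act0l actM) mem0v.
    by rewrite (actPl actM) memvD ?memvZ.
  apply: (root_ind y sS) => alpha w wa; apply: mem_vsp; exists (alpha + lam).
  exact: (weight_act actM adm wa vlam).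
move=> hx; apply: diagonalizable_spanned => v; move: v (Wall v); apply/subvP.
apply: vsp_sub => v [lam vlam]; apply: mem_vsp; exists (lam (vsproj h x)).
by rewrite (opE actM); apply: weightE.
Qed.

Lemma act_weight_span (U : {vspace l}) :
  (forall x v, x \in h -> v \in U -> act x v \in U) ->
  (U <= vsp [set v | v \in U /\ exists lam : dual, weight_space act lam v])%VS.
Proof. exact: (weight_span actM act_diag h_comm). Qed.

Lemma ad_weight_span (U : {vspace s}) :
  (forall x v, x \in h -> v \in U -> br x v \in U) ->
  (U <= vsp [set v | v \in U /\ exists lam : dual, weight_space br lam v])%VS.
Proof. exact: (weight_span adm h_diag h_comm). Qed.

Lemma weight_grade (lam : dual) p v : weight_space act lam v ->
  lam (vsproj h ES) = p%:~R + c -> v \in L p.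
Proof. by move=> lv lE; apply/gradeP; rewrite (weightE hES lv) lE. Qed.

Lemma root_degree (alpha : dual) p v : weight_space br alpha v ->
  alpha (vsproj h ES) = p%:~R -> v \in E p.
Proof. by move=> lv lE; apply/(degreeP brL); rewrite (weightE hES lv) lE. Qed.

Lemma scaler_inj (V : lmodType C) (v : V) (a b : C) : v != 0 -> a *: v = b *: v -> a = b.
Proof.
move=> v0 /eqP; rewrite -subr_eq0 -scalerBl scaler_eq0 (negPf v0) orbF subr_eq0.
by move=> /eqP.
Qed.

Lemma grade_weight (lam : dual) p v : v != 0 -> weight_space act lam v -> v \in L p ->
  lam (vsproj h ES) = p%:~R + c.
Proof.
move=> v0 lv /gradeP; rewrite (weightE hES lv); exact: scaler_inj.
Qed.

Lemma degree_root (alpha : dual) p v : v != 0 -> weight_space br alpha v -> v \in E p ->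
  alpha (vsproj h ES) = p%:~R.
Proof.
move=> v0 lv /(degreeP brL); rewrite (weightE hES lv); exact: scaler_inj.
Qed.

(** Since [ES] is in [h], the degree of a weight is its value at [ES], up to the constant by which
    [ES] differs from the degree. *)
Lemma weights_inP p (lam : dual) : weights_in act gl p lam <->
  weights act lam /\ lam (vsproj h ES) = p%:~R + c.
Proof.
split=> -[wl lp]; split=> //.
  have [v v0 lv] := weights_ex actM wl; apply: (grade_weight v0 lv).
  by apply/glP; apply: lp.
by move=> v lv; apply/(glP gsL ESd glM irr); apply: weight_grade lv lp.
Qed.

Lemma weights_degree (lam : dual) : weights act lam ->
  exists p : int, lam (vsproj h ES) = p%:~R + c.
Proof.
move=> wl; have [v v0 lv] := weights_ex actM wl; apply: contrapT => nex.
move/eqP: v0; apply; have fv : gen_eigen (op act ES) (lam (vsproj h ES)) v.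
  by apply: eigen_gen_eigen; rewrite (opE actM); apply: weightE.
rewrite -(genproj_id fv).
pose f := genproj (op act ES) (lam (vsproj h ES)).
apply: (vsp_ind (Q := [set v | f v = 0])) (grade_span gsL ESd glM irr v).
  by split=> [|a y z /= y0 z0]; rewrite /= ?linear0 // linearP /= y0 z0 scaler0 addr0.
move=> w [p /gradeP wp] /=; apply: (genproj_out (b := p%:~R + c)).
  by apply: eigen_gen_eigen; rewrite (opE actM).
by apply/eqP => E; apply: nex; exists p.
Qed.

Lemma roots_inP p (alpha : dual) : roots_in br gs p alpha <->
  [/\ weights br alpha, alpha <> 0 & alpha (vsproj h ES) = p%:~R].
Proof.
split=> [[[wa ap] a0]|[wa a0 ap]]; split=> //.
  have [v v0 va] := weights_ex adm wa; apply: (degree_root v0 va).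
  by apply/(gsP gsL ESd); apply: ap.
by split=> // v va; apply/(gsP gsL ESd); apply: root_degree va ap.
Qed.

(** Invariance makes the weight spaces of [alpha] and [beta] orthogonal unless [alpha + beta] is
    zero; nondegeneracy then leaves a partner of weight [- alpha]. *)
Lemma root_pairing (alpha : dual) x : x != 0 -> weight_space br alpha x ->
  exists2 y, weight_space br (- alpha) y & killing br x y != 0.
Proof.
move=> x0 xa; apply: contrapT => nex; case/eqP: x0.
apply: (killing_nondegenerate brL no_abelian_ideal) => y.
apply: (root_ind y (killing_subspace brL x)) => beta {}y yb /=.
have [ab|ab] := eqVneq (- alpha) beta.
  by apply/eqP; apply: contrapT => /negP k0; apply: nex; exists y; rewrite ?ab.
have [H HN0] : exists H, (alpha + beta) H != 0.
  apply: contrapT => nexH; case/eqP: ab; apply/eqP; rewrite eq_sym -addr_eq0 addrC; apply/eqP.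
  by apply/lfunP => H; rewrite zero_lfunE; apply: contrapT => /eqP H0; apply: nexH; exists H.
have : killing br (br (vsval H) x) y + killing br x (br (vsval H) y) = 0.
  rewrite (br_anti brL) -scaleN1r killingC (killingZr brL) killingC.
  by rewrite (killing_assoc brL) mulN1r addNr.
rewrite xa yb killingC !(killingZr brL) killingC -mulrDl => /eqP.
by rewrite mulf_eq0 -[_ + _](add_lfunE alpha beta) (negPf HN0) => /eqP.
Qed.

Lemma root_opp (alpha : dual) : weights br alpha -> weights br (- alpha).
Proof.
move=> wa; have [x x0 xa] := weights_ex adm wa.
have [y ya k0] := root_pairing x0 xa; apply: (weights_intro _ ya).
by apply: contraNneq k0 => ->; rewrite (killing0r brL).
Qed.

End Weights.

(** * The element [J_s] *)

Section CRStructure.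
Variables (C : numClosedFieldType) (s l : vectType C).
Variables (br : s -> s -> s) (gs : int -> set s) (act : s -> l -> l) (gl : int -> set l).
Variables (ES JS : s).
Hypothesis gsL : graded_lie_algebra br gs.
Hypothesis no_abelian_ideal : without_abelian_ideal br.
Hypothesis trans : transitive_gr gs br gs.
Hypothesis ESd : forall p X, gs p X -> br ES X = p%:~R *: X.
Hypothesis glM : graded_module br gs act gl.
Hypothesis irr : lie_irreducible act.
Hypothesis JS0 : gs 0 JS.
Hypothesis JS2 : forall X, gs (-1) X -> br JS (br JS X) = - X.
Hypothesis JScomm : forall A X, gs 0 A -> gs (-1) X -> br A (br JS X) = br JS (br A X).

Let brL : lie_algebra br. Proof. by case: gsL. Qed.
Let adm : lie_module br br := adM brL.
Let actM : lie_module br act. Proof. by case: glM. Qed.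
Local Notation E := (degree_space br ES).
Local Notation L := (grade gsL ESd glM irr).
Let gsP p x : x \in E p <-> gs p x := gsP gsL ESd p x.

Let brE j k m x y : j + k = m -> x \in E j -> y \in E k -> br x y \in E m.
Proof. exact: degree_br_to. Qed.

Lemma JS_degree : JS \in E 0. Proof. exact/gsP. Qed.

(** [br JS A] has degree 0 and annihilates degree -1, because [A] commutes there with the complex
    structure; transitivity concludes. *)
Lemma JS_central A : A \in E 0 -> br JS A = 0.
Proof.
move=> A0; apply: (transE gsL trans ESd (lexx 0)); first by apply: brE JS_degree A0.
move=> x /gsP x1; rewrite (br_anti brL) (act_br adm) JScomm ?subrr ?oppr0 //.
exact/gsP.
Qed.

(** In degree 1: for [y] of degree -1 and [z] of degree 1, [br y z] commutes with [JS], so [JS]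
    moves from [z] to [y] with a sign. After two moves its square acts on degree -1, where it is
    known, and transitivity concludes. *)
Lemma JS_sqr k x : k = 1 \/ k = -1 -> x \in E k -> br JS (br JS x) = - x.
Proof.
case=> -> x1; last by apply/JS2/gsP.
have JSE z m : z \in E m -> br JS z \in E m.
  by move=> zm; apply: brE JS_degree zm; rewrite add0r.
apply/eqP; rewrite -addr_eq0; apply/eqP.
apply: (transE gsL trans ESd ler01); first by rewrite memvD ?JSE.
move=> y y1; have JSy z : z \in E 1 -> forall y, y \in E (-1) -> br y (br JS z) = - br (br JS y) z.
  move=> z1 {}y {}y1; apply/eqP; rewrite -addr_eq0 addrC; apply/eqP.
  by rewrite -(br_jacobi brL); apply: JS_central; apply: brE y1 z1.
rewrite (actDr adm) JSy ?JSE // JSy ?JSE // opprK JS2; last exact/gsP.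
by rewrite (actNl adm) addNr.
Qed.

Definition isI (e : C) := e = 'i \/ e = - 'i.

Lemma isIN e : isI e -> isI (- e).
Proof. by case=> ->; [right | left; rewrite opprK]. Qed.

Lemma isI_neq0 e : isI e -> e != 0.
Proof. by case=> ->; rewrite ?oppr_eq0 neq0Ci. Qed.

Lemma isI_sqr e : isI e -> e * e = -1.
Proof. by case=> ->; rewrite ?mulrNN -expr2 sqrCi. Qed.

Lemma double_neq0 e : isI e -> e + e != 0.
Proof. by move=> /isI_neq0 e0; rewrite -mulr2n mulrn_eq0 negb_or e0. Qed.

Definition jspace (k : int) (e : C) : {vspace s} := (E k :&: lker (shift (op br JS) e))%VS.

Lemma jspaceP k e x : x \in jspace k e <-> x \in E k /\ br JS x = e *: x.
Proof.
rewrite memv_cap memv_ker shiftE (opE adm) subr_eq0.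
by split=> [/andP[? /eqP]//|[-> ->]]; rewrite /= eqxx.
Qed.

Lemma jspace_dec k e x : isI e -> k = 1 \/ k = -1 -> x \in E k ->
  exists y z, [/\ y \in jspace k e, z \in jspace k (- e) & x = y + z].
Proof.
move=> Ie k1 xk; have ee := isI_sqr Ie.
have JSE : br JS x \in E k by apply: brE JS_degree xk; rewrite add0r.
(* As [e] squares to -1, these are the projections [(1 - e J) / 2] and [(1 + e J) / 2] onto the
   eigenspaces of [e] and [- e]. *)
exists (2^-1 *: (x - e *: br JS x)), (2^-1 *: (x + e *: br JS x)); split.
- apply/jspaceP; split; first by rewrite memvZ ?memvB ?memvZ.
  rewrite (actZr adm) (actBr adm) (actZr adm) (JS_sqr k1 xk).
  rewrite [RHS]scalerA [e * _]mulrC -[RHS]scalerA; congr (_ *: _).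
  by rewrite scalerBr scalerA ee scaleN1r opprK scalerN opprK addrC.
- apply/jspaceP; split; first by rewrite memvZ ?memvD ?memvZ.
  rewrite (actZr adm) (actDr adm) (actZr adm) (JS_sqr k1 xk).
  rewrite [RHS]scalerA [- e * _]mulrC -[RHS]scalerA; congr (_ *: _).
  by rewrite scalerDr scalerA mulNr ee opprK scale1r scaleNr scalerN addrC.
rewrite -scalerDr addrACA addNr addr0 -mulr2n -scaler_nat scalerA mulVf ?scale1r //.
by rewrite pnatr_eq0.
Qed.

Lemma act_JS x v a b : br JS x = a *: x -> act JS v = b *: v ->
  act JS (act x v) = (a + b) *: act x v.
Proof.
by move=> xa vb; rewrite (actAC actM) xa vb (actZl actM) (actZr actM) scalerDl.
Qed.

(** The bracket is an eigenvector of [JS] for [e + e], but it has degree 0, where [JS] acts as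
    zero. *)
Lemma jspace_br0 e x z : isI e -> x \in jspace (-1) e -> z \in jspace 1 e -> br z x = 0.
Proof.
move=> Ie /jspaceP[x1 xe] /jspaceP[z1 ze].
have : br JS (br z x) = 0 by apply: JS_central; apply: brE z1 x1.
rewrite (br_jacobi brL) xe ze (actZl adm) (actZr adm) -scalerDl => /eqP.
by rewrite scaler_eq0 (negPf (double_neq0 Ie)) => /eqP.
Qed.

Let gL p q m x v : p + q = m -> x \in E p -> v \in L q -> act x v \in L m.
Proof. exact: act_grade. Qed.

(** Vectors of degree [p] annihilated by degree -1 generate a submodule contained in degrees at
    least [p]; if it were nonzero, irreducibility would make [L q] zero. *)
Lemma singular_eq0 p q v : q < p -> L q <> 0%VS -> v \in L p ->
  (forall x, x \in E (-1) -> act x v = 0) -> v = 0.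
Proof.
move=> qp Lq0 vp vE.
pose M := vsp [set v | v \in L p /\ forall x, x \in E (-1) -> act x v = 0].
have sM : subspace [set v | v \in L p /\ forall x, x \in E (-1) -> act x v = 0].
  split=> [|a y z /= [yk y0] [zk z0]].
    by split=> [|e _]; rewrite ?mem0v // (act0r actM).
  split=> [|e e1]; first by rewrite memvD ?memvZ.
  by rewrite (actPr actM) y0 ?z0 // scaler0 addr0.
have ME u : u \in M <-> u \in L p /\ forall x, x \in E (-1) -> act x u = 0 by apply: vspP sM.
have [M0|MN0] := pselect (M = 0%VS).
  by apply/eqP; rewrite -memv0 -M0; apply/ME.
have M0 x u : x \in E 0 -> u \in M -> act x u \in M.
  move=> x0 /ME[up u0]; apply/ME; split; first by apply: gL x0 up; rewrite add0r.
  move=> y y1; rewrite (actAC actM) (u0 y) // (act0r actM) addr0.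
  by rewrite u0 //; apply: brE y1 x0.
have lad k : ladder br act ES (-1) M k.+1 = 0%VS.
  elim: k => [|k IHk]; apply/eqP; rewrite -subv0; apply: bracket_sub => x u xE.
    by move=> /ME[_ ->] //; rewrite mem0v.
  move=> uk; have : u \in ladder br act ES (-1) M k.+1 by [].
  by rewrite IHk memv0 => /eqP->; rewrite (act0r actM) mem0v.
have ML : (M <= L p)%VS by apply/subvP => u /ME[].
have Mpm x y u : x \in E 1 -> y \in E (-1) -> u \in M -> act x (act y u) \in M.
  by move=> _ y1 /ME[_ ->] //; rewrite (act0r actM) mem0v.
have Mmp x y u : x \in E (-1) -> y \in E 1 -> u \in M -> act x (act y u) \in M.
  move=> x1 y1 Mu; rewrite (actAC actM); apply: memvD.
    by apply: M0 => //; apply: brE x1 y1.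
  by have /ME[_ ->] := Mu; rewrite // (act0r actM) mem0v.
case: Lq0; apply/vspace0P => w wq; apply/eqP; rewrite -memv0 -(lad `|p - q|.-1%N).
apply: (ladder_full no_abelian_ideal trans ML M0 Mpm Mmp MN0) => //.
by rewrite (_ : p + _ = q) //; lia.
Qed.

(** For [M = L (-1)] the stability hypotheses of [ladder_full] hold by degree, and each lower
    component is a rung of the descending ladder. *)
Lemma fundamental_grade (k : int) : L (-1) <> 0%VS -> k < 0 ->
  (L (k - 1) <= bracket_vs act (E (-1)) (L k))%VS.
Proof.
move=> L1 k0; apply/subvP => v vk; pose n := absz (k + 1).
have kE : k = -1 + (-1) * n%:Z by lia.
have st x u : x \in E 0 -> u \in L (-1) -> act x u \in L (-1) by apply: gL.
have : v \in ladder br act ES (-1) (L (-1)) n.+1.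
  apply: (ladder_full no_abelian_ideal trans (subvv _) st _ _ L1) => //.
  - by move=> x y u x1 y1 u1; apply: (@gL 1 (-2)) => //; apply: (@gL (-1) (-1)).
  - by move=> x y u x1 y1 u1; apply: (@gL (-1) 0) => //; apply: (@gL 1 (-1)).
  - by rewrite (_ : _ + _ = k - 1) //; lia.
move: v {vk}; apply/subvP; apply: bracket_sub => x u x1 un; apply: mem_bracket => //.
by rewrite kE; apply: (ladder_grade _ un).
Qed.

Section Core.
Variable Lj : C -> {vspace l}.
Hypothesis Lj_sub : forall e, isI e -> (Lj e <= L (-1))%VS.
Hypothesis Lj_dec : (L (-1) <= Lj 'i + Lj (- 'i))%VS.
Hypothesis Lj_st : forall e x v, isI e -> x \in E 0 -> v \in Lj e -> act x v \in Lj e.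
Hypothesis Lj_ker : forall e x v, isI e -> x \in jspace (-1) e -> v \in Lj e -> act x v = 0.
Hypothesis Lj_img : forall e x v, isI e -> x \in jspace (-1) e -> v \in L 0 -> act x v \in Lj e.
Hypothesis Lj_ker1 : forall e z v, isI e -> z \in jspace 1 e -> v \in Lj e -> act z v = 0.
Hypothesis L1 : L (-1) <> 0%VS.

(* An eigenvector of [JS] in some [Lj e], of eigenvalue [c + e], lies in the sum [M] of
   the [c + f] eigenspaces of [JS] in [Lj f]. The components of [s] of degree -1, 0 and
   1 preserve [M], up to the degree, so that [M] generates [l]; and [s_1], [s_{-1}] map
   [M] into the [c] eigenspace of [JS]. *)
Theorem scalar_of_splitting : exists c, forall p v, p = 0 \/ p = -2 -> v \in L p -> act JS v = c *: v.
Proof.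
have [e [Ie Lje]] : exists e, isI e /\ Lj e <> 0%VS.
  apply: contrapT => nex; apply: L1; apply/eqP; rewrite -subv0.
  have Lj0 e : isI e -> Lj e = 0%VS by move=> Ie; apply: contrapT => ?; apply: nex; exists e.
  by rewrite (subv_trans Lj_dec) // !Lj0 ?addv0 //; [right | left].
have [|mu [v0 [v0e v0N0]]] := eigenvector_exists (f := op act JS) _ Lje.
  by move=> v ve; rewrite (opE actM); apply: Lj_st => //; apply: JS_degree.
rewrite (opE actM) => v0mu; pose c := mu - e; exists c.
pose Mj e := (Lj e :&: lker (shift (op act JS) (c + e)))%VS.
have MjP f v : v \in Mj f <-> v \in Lj f /\ act JS v = (c + f) *: v.
  rewrite memv_cap memv_ker shiftE (opE actM) subr_eq0.
  by split=> [/andP[? /eqP]//|[-> ->]]; rewrite /= eqxx.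
pose M := vsp [set v | exists2 f, isI f & v \in Mj f].
have MjM f v : isI f -> v \in Lj f -> act JS v = (c + f) *: v -> v \in M.
  by move=> If vf JSv; apply: mem_vsp; exists f => //; apply/MjP.
have Mind (Q : set l) v : subspace Q -> (forall f v, isI f -> v \in Lj f ->
    act JS v = (c + f) *: v -> Q v) -> v \in M -> Q v.
  by move=> sQ fQ Mv; apply: (vsp_ind sQ _ Mv) => w [f If /MjP[]]; apply: fQ.
have ML : (M <= L (-1))%VS.
  by apply: vsp_sub => v [f If /MjP[vf _]]; apply: (subvP (Lj_sub If)).
have JSb x v a : x \in E 0 -> act JS v = a *: v -> act JS (act x v) = a *: act x v.
  by move=> x0 va; rewrite (actAC actM) JS_central // (act0l actM) add0r va (actZr actM).
have M0 x v : x \in E 0 -> v \in M -> act x v \in M.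
  move=> x0; apply: (Mind _ v (subspace_act actM x M)) => f {}v If vf JSv /=.
  by apply: MjM If (Lj_st If x0 vf) _; apply: JSb.
(* Only the [- f] part of [x] acts on [Lj f], and it takes the eigenvalue of [JS] from [c + f] to
   [c]. *)
have down f x v : isI f -> x \in E (-1) -> v \in Lj f ->
    exists2 y, y \in jspace (-1) (- f) & act x v = act y v.
  move=> If x1 vf; have [|y [z [yf zf ->]]] := jspace_dec If _ x1; first by right.
  by exists z => //; rewrite (actDl actM) (Lj_ker If yf vf) add0r.
have up f x v : isI f -> x \in E 1 -> v \in Lj f ->
    exists2 y, y \in jspace 1 (- f) & act x v = act y v.
  move=> If x1 vf; have [|y [z [yf zf ->]]] := jspace_dec If _ x1; first by left.
  by exists z => //; rewrite (actDl actM) (Lj_ker1 If yf vf) add0r.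
have low v x : x \in E (-1) -> v \in L 0 -> act JS v = c *: v -> act x v \in M.
  move=> x1 v0' JSv; have Ii : isI 'i by left.
  have [|y [z [yf zf ->]]] := jspace_dec Ii _ x1; first by right.
  have low1 f u : isI f -> u \in jspace (-1) f -> act u v \in M.
    move=> If uf; apply: (MjM f) => //; first exact: Lj_img.
    by move: uf => /jspaceP[_ uf]; rewrite (act_JS uf JSv) addrC.
  by rewrite (actDl actM) memvD ?(low1 _ _ Ii yf) ?(low1 _ _ (isIN Ii) zf).
have JSup f x v : isI f -> x \in E 1 -> v \in Lj f -> act JS v = (c + f) *: v ->
    act JS (act x v) = c *: act x v.
  move=> If x1 vf JSv; have [y /jspaceP[_ ye] ->] := up f x v If x1 vf.
  by rewrite (act_JS ye JSv) addrCA addNr addr0.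
have JSdown f x v : isI f -> x \in E (-1) -> v \in Lj f -> act JS v = (c + f) *: v ->
    act JS (act x v) = c *: act x v.
  move=> If x1 vf JSv; have [y /jspaceP[_ ye] ->] := down f x v If x1 vf.
  by rewrite (act_JS ye JSv) addrCA addNr addr0.
have Mmp x y v : x \in E (-1) -> y \in E 1 -> v \in M -> act x (act y v) \in M.
  move=> x1 y1 Mv; have sS : subspace [set v | act x (act y v) \in M].
    split=> [|a u w /= Mu Mw]; first by rewrite /= !(act0r actM) mem0v.
    by rewrite !(actPr actM) memvD ?memvZ.
  move: Mv; apply: (Mind _ v sS) => f {}v If vf JSv /=.
  apply: low => //; last exact: JSup JSv.
  by apply: (@gL 1 (-1)) => //; apply: (subvP (Lj_sub If)).
have Mpm x y v : x \in E 1 -> y \in E (-1) -> v \in M -> act x (act y v) \in M.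
  move=> x1 y1 Mv; have sS : subspace [set v | act x (act y v) \in M].
    split=> [|a u w /= Mu Mw]; first by rewrite /= !(act0r actM) mem0v.
    by rewrite !(actPr actM) memvD ?memvZ.
  move: Mv; apply: (Mind _ v sS) => f {}v If vf JSv /=.
  have [y' y'f ->] := down f y v If y1 vf.
  have [|z [z' [zf z'f ->]]] := jspace_dec If _ x1; first by left.
  have y'1 : y' \in E (-1) by case/jspaceP: y'f.
  have z1 : z \in E 1 by case/jspaceP: zf.
  have z'1 : z' \in E 1 by case/jspaceP: z'f.
  (* The [f] part [z] of [x] annihilates [v], which leaves a bracket of degree 0; the [- f] part
     [z'] commutes with [y'], which reduces to [Mmp]. *)
  rewrite (actDl actM) memvD // (actAC actM).
    rewrite (Lj_ker1 If zf vf) (act0r actM) addr0; apply: M0; last exact: MjM vf JSv.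
    by apply: brE z1 y'1.
  rewrite (jspace_br0 (isIN If) y'f z'f) (act0l actM) add0r; apply: Mmp => //.
  exact: MjM vf JSv.
have MN0 : M <> 0%VS.
  move=> /vspace0P M00; case/eqP: v0N0; apply: M00.
  by apply: (MjM e) => //; rewrite /c subrK.
have full := ladder_full no_abelian_ideal trans ML M0 Mpm Mmp MN0.
have sc : subspace [set v | act JS v = c *: v].
  split=> [|a u w /= u0 w0]; first by rewrite /= (act0r actM) scaler0.
  by rewrite (actPr actM) u0 w0 scalerDr !scalerA mulrC.
have sact x : subspace [set w | act JS (act x w) = c *: act x w].
  split=> [|a u w /= u0 w0]; first by rewrite /= !(act0r actM) scaler0.
  by rewrite !(actPr actM) u0 w0 scalerDr !scalerA mulrC.
move=> p v [->|->] vp.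
  apply: (vsp_ind sc _ (full 1 1%N v erefl vp)) => _ [x x1 [w Mw <-]] /=.
  by apply: (Mind _ w (sact x) _ Mw) => f u If uf JSu; apply: JSup JSu.
apply: (vsp_ind sc _ (full (-1) 1%N v erefl vp)) => _ [x x1 [w Mw <-]] /=.
by apply: (Mind _ w (sact x) _ Mw) => f u If uf JSu; apply: JSdown JSu.
Qed.

End Core.

End CRStructure.

(** * Root strings *)

Section TraceSigns.
Variables (C : numClosedFieldType) (V : vectType C) (f : 'End(V)) (U : {vspace V}).
Hypothesis df : diagonalizable f.
Hypothesis fU : lstable f U.

Lemma ltr_stable_le0 : (forall a v, v \in U -> v != 0 -> f v = a *: v -> a <= 0) ->
  ltr (f \o projv U)%VF <= 0 /\
  (ltr (f \o projv U)%VF = 0 -> forall v, v \in U -> f v = 0).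
Proof.
move=> npos; have [r _ sp] := genproj_sum f.
have [trE _] := ltr_stable_diagonalizable sp df fU.
have Ua a : (U :&: lker (shift f a) != 0)%VS -> a <= 0.
  move=> /eqP/vspaceN0P[v]; rewrite memv_cap memv_ker shiftE subr_eq0.
  by move=> /andP[Uv /eqP fv] v0; apply: npos fv.
have term a : 0 <= - a * (\dim (U :&: lker (shift f a)))%:R.
  have [->|/Ua a0] := eqVneq (U :&: lker (shift f a))%VS 0%VS.
    by rewrite dimv0 mulr0.
  by rewrite mulr_ge0 // oppr_ge0.
have trN : - ltr (f \o projv U)%VF
    = \sum_(a <- r) - a * (\dim (U :&: lker (shift f a)))%:R.
  by rewrite trE -sumrN; apply: eq_bigr => a _; rewrite mulNr.
split; first by rewrite -oppr_ge0 trN sumr_ge0.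
move=> tr0 v Uv; have /eqP := trN; rewrite tr0 oppr0 eq_sym psumr_eq0 //.
move=> /allP t0; rewrite [v]sp linear_sum big_seq big1 //= => a /t0 /=.
rewrite genproj_eigen // mulf_eq0 oppr_eq0 pnatr_eq0 dimv_eq0.
move=> /orP[/eqP->|/eqP Ua0]; first by rewrite scale0r.
suff : genproj f a v \in (U :&: lker (shift f a))%VS.
  by rewrite Ua0 memv0 => /eqP->; rewrite scaler0.
by rewrite memv_cap genproj_stable // memv_ker shiftE genproj_eigen // subrr eqxx.
Qed.

(** The difference of the traces is the trace on [U] modulo [S], where by hypothesis only
    nonnegative eigenvalues occur. *)
Lemma ltr_quotient_ge0 (S : {vspace V}) : lstable f S -> (S <= U)%VS ->
  (forall a v, v \in U -> f v = a *: v -> 0 <= a \/ v \in S) ->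
  ltr (f \o projv S)%VF <= ltr (f \o projv U)%VF.
Proof.
move=> fS SU nneg; have [r _ sp] := genproj_sum f.
have [-> _] := ltr_stable_diagonalizable sp df fU.
have [-> _] := ltr_stable_diagonalizable sp df fS.
rewrite -subr_ge0 -sumrB; apply: sumr_ge0 => a _; rewrite -mulrBr.
have le : (S :&: lker (shift f a) <= U :&: lker (shift f a))%VS by apply: capvS.
have [a0|a0] := boolP (0 <= a); first by rewrite mulr_ge0 // subr_ge0 ler_nat dimvS.
suff -> : (U :&: lker (shift f a) = S :&: lker (shift f a))%VS by rewrite subrr mulr0.
apply/eqP; rewrite eqEsubv le andbT; apply/subvP => v.
rewrite !memv_cap => /andP[Uv fv]; rewrite fv andbT.
move: fv; rewrite memv_ker shiftE subr_eq0 => /eqP /(nneg _ _ Uv)[a0'|//].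
by rewrite a0' in a0.
Qed.

End TraceSigns.

Section RootStrings.
Variables (C : numClosedFieldType) (s l : vectType C).
Variables (br : s -> s -> s) (gs : int -> set s) (act : s -> l -> l) (gl : int -> set l).
Variables (ES : s) (h : {vspace s}).
Hypothesis gsL : graded_lie_algebra br gs.
Hypothesis no_abelian_ideal : without_abelian_ideal br.
Hypothesis ESd : forall p X, gs p X -> br ES X = p%:~R *: X.
Hypothesis glM : graded_module br gs act gl.
Hypothesis irr : lie_irreducible act.
Hypothesis hC : cartan_subalgebra br [set` h].
Hypothesis hES : ES \in h.

Let brL : lie_algebra br. Proof. by case: gsL. Qed.
Let adm : lie_module br br := adM brL.
Let actM : lie_module br act. Proof. by case: glM. Qed.
Local Notation dual := 'Hom(subvs_of h, C^o).
Local Notation E := (degree_space br ES).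
Local Notation L := (grade gsL ESd glM irr).
Local Notation c := (degree_shift gsL ESd glM irr).
Local Notation ev lam x := ((lam : dual) (vsproj h x)).

Variables (beta lam : dual) (X Z : s).
Hypothesis Xb : weight_space br beta X.
Hypothesis Zb : weight_space br (- beta) Z.
Hypothesis XZ : killing br X Z != 0.
Hypothesis bES : ev beta ES = -1.

Let hcomm x y : x \in h -> y \in h -> br x y = 0.
Proof. exact: (h_comm gsL no_abelian_ideal hC). Qed.

Let t := br X Z.

Lemma coroot_mem : t \in h.
Proof.
apply: (h_self_centralizing hC) => H hH; rewrite (br_anti brL).
have /(_ (vsproj h H)) := weight_act adm adm Xb Zb.
by rewrite vsprojK // subrr zero_lfunE scale0r => ->; rewrite oppr0.
Qed.

(** If [beta] vanished at [t], both [X] and [Z] would commute with [t], their bracket, and the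
    diagonalizable [op br t] would be zero, so [t] too. But the Killing product of [ES] and [t] is
    [- killing br X Z]. *)
Lemma coroot_neq0 : ev beta t != 0.
Proof.
have kt : killing br ES t = - killing br X Z.
  rewrite -(killing_assoc brL) (weightE hES Xb) bES scaleN1r.
  by rewrite killingC -scaleN1r (killingZr brL) mulN1r killingC.
apply/eqP => bt0; have tX : br t X = 0.
  by rewrite (weightE coroot_mem Xb) bt0 scale0r.
have tZ : br t Z = 0.
  by rewrite (weightE coroot_mem Zb) opp_lfunE bt0 oppr0 scale0r.
suff t0 : t = 0 by move: kt; rewrite t0 (killing0r brL) => /eqP; rewrite eq_sym oppr_eq0 (negPf XZ).
apply: (ad_eq0_center brL no_abelian_ideal) => y; rewrite -(opE adm).
suff -> : op br t = 0 by rewrite zero_lfunE.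
apply: diagonalizable_commutator_eq0.
  exact: (h_diag gsL no_abelian_ideal hC coroot_mem).
apply: mem_vsp; exists (op br X), (op br Z); split=> [v|v|]; last exact: op_br.
  by rewrite !(opE adm) (br_jacobi brL X) (br_anti brL X t) tX oppr0 (act0l adm) add0r.
by rewrite !(opE adm) (br_jacobi brL Z) (br_anti brL Z t) tZ oppr0 (act0l adm) add0r.
Qed.

(** The sum of the weight spaces of [lam + a *: beta] over all scalars [a]: only the action of the
    kernel of [beta] in [h] is prescribed. *)
Let Vset : set l := [set v | forall H, H \in h -> ev beta H = 0 -> act H v = ev lam H *: v].

Let Vsub : subspace Vset.
Proof.
split=> [H _ _|a u v Vu Vv H hH b0]; first by rewrite (act0r actM) scaler0.
by rewrite (actPr actM) Vu ?Vv // scalerDr !scalerA mulrC.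
Qed.

Let V := vsp Vset.
Let VP v : v \in V <-> Vset v. Proof. exact: vspP Vsub. Qed.

Let V_weight (a : C) x v : weight_space br (a *: beta) x -> v \in V ->
  act x v \in V.
Proof.
move=> xb /VP Vv; apply/VP => H hH b0.
rewrite (actAC actM) (weightE hH xb) scale_lfunE b0 scaler0 scale0r (act0l actM) add0r.
by rewrite Vv // (actZr actM).
Qed.

Let XV v : v \in V -> act X v \in V.
Proof. by apply: (V_weight (a := 1)); rewrite scale1r. Qed.
Let ZV v : v \in V -> act Z v \in V.
Proof. by apply: (V_weight (a := -1)); rewrite scaleN1r. Qed.
Let hV x v : x \in h -> v \in V -> act x v \in V.
Proof.
move=> hx; apply: (V_weight (a := 0)); rewrite scale0r => H.
by rewrite zero_lfunE scale0r hcomm ?subvsP.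
Qed.

Hypothesis lES : ev lam ES = -1 + c.

(** The weight in degree [p] of the string is [lam - (p + 1) beta], because [lam] has degree -1 and
    [beta] has degree -1 as a root: a multiple of [ES] corrects [H] to an element of the kernel of
    [beta]. *)
Let V_grade p v H : v \in V -> v \in L p -> H \in h ->
  act H v = (ev lam H - (p + 1)%:~R * ev beta H) *: v.
Proof.
move=> /VP Vv /gradeP vp hH; pose K := H + ev beta H *: ES.
have hK : K \in h by rewrite memvD ?memvZ.
have bK : ev beta K = 0.
  by rewrite /K !linearD !linearZ /= bES [_ *: _]mulrN1 subrr.
have -> : act H v = act K v - ev beta H *: act ES v.
  by rewrite /K (actDl actM) (actZl actM) addrK.
rewrite Vv // vp scalerA -scalerBl; congr (_ *: _).
have -> : ev lam K = ev lam H + ev beta H * (-1 + c).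
  by rewrite /K !linearD !linearZ /= lES.
by rewrite intrD; ring.
Qed.

Let m : C := ev lam t.
Let tau : C := ev beta t.

(** Normalized to act by [- (p + 1)] in degree [p] of the string. On a subspace stable under [X] and
    [Z], where [t] is traceless, its trace is [- (m / tau)] times the dimension. *)
Let g : 'End(l) := tau^-1 *: (op act t - m *: \1%VF).

Let gE v : g v = tau^-1 *: (act t v - m *: v).
Proof. by rewrite /g scale_lfunE add_lfunE opp_lfunE scale_lfunE id_lfunE (opE actM). Qed.

Let g_grade p v : v \in V -> v \in L p -> g v = - (p + 1)%:~R *: v.
Proof.
move=> Vv vp; rewrite gE (V_grade Vv vp coroot_mem) -scalerBl scalerA; congr (_ *: _).
have tau0 : tau != 0 := coroot_neq0.
by rewrite -/m -/tau; field.
Qed.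

Let V_span v : v \in V -> v \in vsp [set v | v \in V /\ exists p, v \in L p].
Proof.
move=> Vv; have hVV x w : x \in h -> w \in V -> act x w \in V by apply: hV.
move: v Vv; apply: (subvP (subv_trans
  (act_weight_span gsL no_abelian_ideal glM irr hC hVV) _)).
apply: vsp_sub => v [Vv [mu vmu]]; have [->|v0] := eqVneq v 0; first exact: mem0v.
apply: mem_vsp; split=> //.
have [p pmu] := weights_degree gsL ESd glM irr hES (weights_intro v0 vmu).
by exists p; apply: weight_grade vmu pmu.
Qed.

Let g_diag : diagonalizable g.
Proof.
have td := act_diag gsL no_abelian_ideal glM irr hC coroot_mem.
apply: diagonalizable_spanned => v.
apply: (gen_eigen_ind (f := op act t) v (subspace_vspace _)) => a w /td.
rewrite (opE actM) => ta; apply: mem_vsp; exists (tau^-1 * (a - m)).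
by rewrite gE ta -scalerBl scalerA.
Qed.

Hypothesis XX0 : forall w, weight_space act (lam - beta) w -> act X (act X w) = 0.

(* If the [lam - beta] weight space [V_nu] is not zero, it is mapped by [X] onto
   the [lam] weight space: with [m = lam t / beta t], where [t = [X, Z]], the trace
   of [t] on the string in degrees [>= 0] completed by [X V_nu] gives [m > 0], and
   its trace on the whole string then excludes that it be larger in degree -1. *)
Theorem string_onto w0 : w0 != 0 -> weight_space act (lam - beta) w0 ->
  forall v, weight_space act lam v ->
  v \in vsp [set act X w | w in weight_space act (lam - beta)].
Proof.
move=> w0N0 w0nu v0 v0lam; have tau0 : tau != 0 := coroot_neq0.
pose XVnu := [set act X w | w in weight_space (h := h) act (lam - beta)].
have VnuP w : weight_space act (lam - beta) w <-> w \in V /\ w \in L 0.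
  split=> [wnu|[Vw w_0] H].
    split.
      apply/VP => H hH b0; rewrite (weightE hH wnu) add_lfunE opp_lfunE b0 subr0 //.
    apply: weight_grade wnu _ => //.
    by rewrite add_lfunE opp_lfunE bES lES opprK addrAC addNr.
  rewrite (V_grade Vw w_0 (subvsP H)) vsvalK add_lfunE opp_lfunE add0r.
  by rewrite mul1r.
have VlamP w : weight_space act lam w <-> w \in V /\ w \in L (-1).
  split=> [wlam|[Vw w_1] H].
    split; first by apply/VP => H hH _; rewrite (weightE hH wlam).
    by apply: weight_grade wlam _ => //; rewrite lES.
  by rewrite (V_grade Vw w_1 (subvsP H)) vsvalK addNr mul0r subr0.
(* The string in degrees at least 0, together with the image under [X] of its degree 0; [X] acts on
   that image as zero, by [XX0]. *)
pose S := vsp [set v | (exists p : int, [/\ 0 <= p, v \in V & v \in L p]) \/ XVnu v].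
have X1 : X \in E (-1) by apply/(degreeP brL); rewrite (weightE hES Xb) bES.
have Z1 : Z \in E 1.
  by apply/(degreeP brL); rewrite (weightE hES Zb) opp_lfunE bES opprK.
have Spos (p : int) w : 0 <= p -> w \in V -> w \in L p -> w \in S.
  by move=> p0 Vw wp; apply: mem_vsp; left; exists p.
have SXV w : weight_space act (lam - beta) w -> act X w \in S.
  by move=> wnu; apply: mem_vsp; right; exists w.
have XVnuV w : XVnu w -> w \in V /\ w \in L (-1).
  move=> [u /VnuP[Vu u0] <-]; split; first exact: XV.
  by apply: act_grade X1 u0.
have XS w : w \in S -> act X w \in S.
  apply: (vsp_ind (subspace_act actM X S)) => {}w [[p [p0 Vw wp]]|[u unu <-]] /=; last first.
    by rewrite XX0 ?mem0v.
  have [p1|p1] := eqVneq p 0; first by apply: SXV; apply/VnuP; rewrite -p1.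
  have p_gt0 : 1 <= p by rewrite -gtz0_ge1 lt_neqAle eq_sym p1.
  by apply: (@Spos (p - 1)) (XV Vw) _; rewrite ?subr_ge0 //; apply: act_grade X1 wp; rewrite addrC.
have ZS w : w \in S -> act Z w \in S.
  apply: (vsp_ind (subspace_act actM Z S)) => {}w [[p [p0 Vw wp]]|/XVnuV[Vw w1]] /=.
    by apply: (@Spos (p + 1)) (ZV Vw) _; rewrite ?addr_ge0 //; apply: act_grade Z1 wp; rewrite addrC.
  by apply: (@Spos 0) (ZV Vw) _ => //; apply: act_grade Z1 w1.
have gstab (U : {vspace l}) : (forall w, w \in U -> act X w \in U) -> (forall w, w \in U -> act Z w \in U) ->
    lstable g U.
  move=> XU ZU w Uw; rewrite gE memvZ // memvB ?memvZ // /t (act_br actM).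
  by rewrite memvB ?XU ?ZU ?XU.
have trg (U : {vspace l}) : (forall w, w \in U -> act X w \in U) -> (forall w, w \in U -> act Z w \in U) ->
    ltr (g \o projv U)%VF = - (m / tau) * (\dim U)%:R.
  move=> XU ZU; rewrite /g -comp_lfunZl linearZ /= comp_lfunDl comp_lfunNl linearB /=.
  rewrite /t (op_br actM) ltr_comm_stable; last 2 first.
  - by move=> w Uw; rewrite (opE actM) XU.
  - by move=> w Uw; rewrite (opE actM) ZU.
  rewrite -comp_lfunZl comp_lfun1l linearZ /= ltr_idem ?limg_proj; last first.
    by apply/lfunP => w; rewrite comp_lfunE projv_proj.
  by rewrite sub0r; ring.
have SV : (S <= V)%VS by apply: vsp_sub => w [[p []]|/XVnuV[]].
have SgE a w : w \in S -> w != 0 -> g w = a *: w -> a <= 0.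
  move=> Sw wN0 ga; apply: contraNT wN0 => a0; apply/eqP.
  rewrite -(genproj_id (eigen_gen_eigen ga)).
  apply: (vsp_ind (Q := [set v | genproj g a v = 0])) Sw.
    by split=> [|d x y /= x0 y0]; rewrite /= ?linear0 // linearP /= x0 y0 scaler0 addr0.
  have gen0 (p : int) u : -1 <= p -> u \in V -> u \in L p -> genproj g a u = 0.
    move=> p0 Vu up; apply: (genproj_out (eigen_gen_eigen (g_grade Vu up))).
    by apply: contraNneq a0 => ->; rewrite oppr_le0 ler0z -lerBlDr sub0r.
  move=> u [[p [p0 Vu up]]|/XVnuV[Vu u1]] /=; last exact: gen0 Vu u1.
  by apply: gen0 Vu up; apply: le_trans p0.
have [trle treq] := ltr_stable_le0 g_diag (gstab S XS ZS) SgE.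
have /VnuP[Vw0 w00] := w0nu.
have Sw0 : w0 \in S by apply: (@Spos 0).
have dimS : (0 < \dim S)%N.
  by rewrite lt0n dimv_eq0; apply: contraNneq w0N0 => S0; rewrite -memv0 -S0.
rewrite (trg S XS ZS) in trle treq.
(* On [S] the eigenvalues [- (p + 1)] of [g] are nonpositive, and -1 occurs at [w0], so the trace is
   negative. *)
have mtau : 0 < m / tau.
  rewrite lt_neqAle; apply/andP; split.
    apply/eqP => mt0; have := treq _ w0 Sw0; rewrite -mt0 oppr0 mul0r => /(_ erefl)/eqP.
    by rewrite (g_grade Vw0 w00) scaler_eq0 (negPf w0N0) oppr_eq0 intr_eq0.
  by move: trle; rewrite mulNr oppr_le0 pmulr_lge0 // ltr0n.
(* Beyond [S] only degrees at most -1 contribute, where [g] is nonnegative, so the trace on [V] is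
   at least that on [S]. Both are the same negative multiple of the dimension, so [V] is no larger
   than [S]. *)
have VS : (V <= S)%VS.
  have /eqP-> : S == V; last exact: subvv.
  rewrite eqEdim SV /=.
  suff : - (m / tau) * (\dim S)%:R <= - (m / tau) * (\dim V)%:R.
    by rewrite !mulNr lerN2 ler_pM2l // ler_nat.
  rewrite -(trg S XS ZS) -(trg V XV ZV).
  apply: (ltr_quotient_ge0 g_diag) => //.
  - by apply: gstab; [exact: XV | exact: ZV].
  - exact: gstab.
  move=> a w Vw ga; have [a0|a0] := boolP (0 <= a); [by left | right].
  rewrite -(genproj_id (eigen_gen_eigen ga)).
  apply: (vsp_ind (Q := [set v | genproj g a v \in S])) (V_span Vw).
    exact: (subspace_ker (genproj g a) (subspace_vspace S)).
  move=> u [Vu [p up]] /=; have [p0|p0] := boolP (0 <= p).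
    by apply: genproj_stable; [exact: gstab | apply: Spos p0 Vu up].
  rewrite (genproj_out (eigen_gen_eigen (g_grade Vu up))) ?mem0v //.
  by apply: contraNneq a0 => ->; rewrite oppr_ge0 lerz0 lezD1 ltNge.
have /VlamP[Vv0 v01] := v0lam.
have gv0 : g v0 = 0 *: v0 by rewrite (g_grade Vv0 v01) addNr oppr0.
rewrite -(genproj_id (eigen_gen_eigen gv0)).
apply: (vsp_ind (Q := [set v | genproj g 0 v \in vsp XVnu])) (subvP VS _ Vv0).
  exact: (subspace_ker (genproj g 0) (subspace_vspace _)).
move=> u [[p [p0 Vu up]]|Xu] /=.
  rewrite (genproj_out (eigen_gen_eigen (g_grade Vu up))) ?mem0v //.
  by rewrite eq_sym oppr_eq0 intr_eq0 gt_eqF // ltr_wpDl.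
have [Vu u1] := XVnuV _ Xu.
rewrite genproj_id; first exact: mem_vsp.
by apply: eigen_gen_eigen; rewrite (g_grade Vu u1) addNr oppr0.
Qed.

End RootStrings.

(** * Conditions (ii), (iii) and (iv) *)

Section WeightConditions.
Variables (C : numClosedFieldType) (s l : vectType C).
Variables (br : s -> s -> s) (gs : int -> set s) (act : s -> l -> l) (gl : int -> set l).
Variables (ES JS : s) (h : {vspace s}).
Hypothesis gsL : graded_lie_algebra br gs.
Hypothesis no_abelian_ideal : without_abelian_ideal br.
Hypothesis trans : transitive_gr gs br gs.
Hypothesis ESd : forall p X, gs p X -> br ES X = p%:~R *: X.
Hypothesis glM : graded_module br gs act gl.
Hypothesis irr : lie_irreducible act.
Hypothesis JS0 : gs 0 JS.
Hypothesis JS2 : forall X, gs (-1) X -> br JS (br JS X) = - X.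
Hypothesis JScomm : forall A X, gs 0 A -> gs (-1) X -> br A (br JS X) = br JS (br A X).
Hypothesis hC : cartan_subalgebra br [set` h].
Hypothesis hES : ES \in h.

Let brL : lie_algebra br. Proof. by case: gsL. Qed.
Let adm : lie_module br br := adM brL.
Let actM : lie_module br act. Proof. by case: glM. Qed.
Local Notation dual := 'Hom(subvs_of h, C^o).
Local Notation E := (degree_space br ES).
Local Notation L := (grade gsL ESd glM irr).
Local Notation c := (degree_shift gsL ESd glM irr).
Local Notation ev lam x := ((lam : dual) (vsproj h x)).
Local Notation P := (weights (h := h) act).
Local Notation jspace := (jspace br ES JS).

Let JSc A : A \in E 0 -> br JS A = 0.
Proof. exact: (JS_central gsL trans ESd JS0 JScomm). Qed.

Let brE j k m x y : j + k = m -> x \in E j -> y \in E k -> br x y \in E m.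
Proof. exact: degree_br_to. Qed.

Let actE p q m x v : p + q = m -> x \in E p -> v \in L q -> act x v \in L m.
Proof. exact: act_grade. Qed.

(** [h] contains [ES] and is abelian, so it has degree 0, where [JS] is central; and it is its own
    centralizer. *)
Lemma JS_cartan : JS \in h.
Proof.
apply: (h_self_centralizing hC) => y hy; apply: JSc.
exact: (h_degree0 gsL no_abelian_ideal hC hES).
Qed.

Let hJS := JS_cartan.

Lemma root_JS0 (alpha : dual) : weights br alpha -> ev alpha ES = 0 -> ev alpha JS = 0.
Proof.
move=> /(weights_ex adm)[x x0 xa] aE.
have xE : x \in E 0 by apply/(degreeP brL); rewrite (weightE hES xa) aE.
have := JSc xE; rewrite (weightE hJS xa) => /eqP.
by rewrite scaler_eq0 (negPf x0) orbF => /eqP.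
Qed.

Lemma root_JS1 k (alpha : dual) : k = 1 \/ k = -1 -> weights br alpha ->
  ev alpha ES = k%:~R -> isI (ev alpha JS).
Proof.
move=> k1 /(weights_ex adm)[x x0 xa] aE.
have xE : x \in E k by apply/(degreeP brL); rewrite (weightE hES xa) aE.
have := JS_sqr gsL trans ESd JS0 JS2 JScomm k1 xE.
rewrite (weightE hJS xa) (actZr adm) (weightE hJS xa) scalerA -scaleN1r => /eqP.
rewrite -subr_eq0 -scalerBl scaler_eq0 (negPf x0) orbF subr_eq0 -sqrCi -expr2.
by rewrite eqf_sqr => /orP[]/eqP->; [left | right].
Qed.

Lemma roots_atP e (alpha : dual) : roots_at br gs JS e alpha <->
  [/\ weights br alpha, ev alpha ES = -1 & ev alpha JS = e].
Proof.
rewrite /roots_at /=; split=> [[/(roots_inP gsL ESd hES)[wa _ aE] aJ]|[wa aE aJ]]; split=> //.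
apply/(roots_inP gsL ESd hES); split=> // a0; move/eqP: aE.
by rewrite a0 zero_lfunE eq_sym oppr_eq0 oner_eq0.
Qed.

(** Condition (ii), tested on the two components separately instead of on their sum. *)
Definition scalar_cond (c0 : C) :=
  forall p v, p = 0 \/ p = -2 -> v \in L p -> act JS v = c0 *: v.

Lemma scalar_weight c0 p (mu : dual) : scalar_cond c0 -> p = 0 \/ p = -2 ->
  P mu -> ev mu ES = p%:~R + c -> ev mu JS = c0.
Proof.
move=> sc p02 /(weights_ex actM)[v v0 vmu] muE.
have vp : v \in L p by apply: weight_grade vmu muE.
apply: (scaler_inj v0).
by rewrite -(weightE hJS vmu); apply: sc vp.
Qed.

Lemma scalar_not_weight c0 p (mu : dual) d : scalar_cond c0 -> p = 0 \/ p = -2 ->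
  ev mu ES = p%:~R + c -> ev mu JS = c0 + d -> d != 0 -> ~ P mu.
Proof.
move=> sc p02 muE muJ d0 wmu; move/eqP: d0; apply.
by apply: (addrI c0); rewrite -muJ addr0; apply: scalar_weight muE.
Qed.

Let i2_neq0 : ('i + 'i : C) != 0.
Proof. by apply: double_neq0; left. Qed.

Let Ni2_neq0 : (- 'i - 'i : C) != 0.
Proof. by apply: double_neq0; right. Qed.

(** Each excluded weight would have degree 0 or -2, where the value at [JS] is [c0], but its value
    differs from [c0] by ['i + 'i] up to sign. *)
Lemma scalar_no_forbidden c0 : scalar_cond c0 ->
  no_forbidden_weight P (weights_in act gl (-2)) (roots_at br gs JS 'i)
    (roots_at br gs JS (- 'i)).
Proof.
move=> sc lam /(weights_inP gsL ESd glM irr hES)[wlam lE].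
have lJ := scalar_weight sc (or_intror (erefl (-2))) wlam lE.
split=> [a b|a b|a b|a b] /roots_atP[_ aE aJ] /roots_atP[_ bE bJ].
- apply: (scalar_not_weight sc (or_introl erefl) _ _ Ni2_neq0);
    by rewrite !add_lfunE !opp_lfunE ?lE ?lJ ?aE ?bE ?aJ ?bJ; ring.
- apply: (scalar_not_weight sc (or_intror erefl) _ _ Ni2_neq0);
    by rewrite !add_lfunE !opp_lfunE ?lE ?lJ ?aE ?bE ?aJ ?bJ; ring.
- apply: (scalar_not_weight sc (or_introl erefl) _ _ i2_neq0);
    by rewrite !add_lfunE !opp_lfunE ?lE ?lJ ?aE ?bE ?aJ ?bJ; ring.
- apply: (scalar_not_weight sc (or_intror erefl) _ _ i2_neq0);
    by rewrite !add_lfunE !opp_lfunE ?lE ?lJ ?aE ?bE ?aJ ?bJ; ring.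
Qed.

Lemma degree_weight_span k : (E k <=
  vsp [set x | x \in E k /\ exists alpha : dual, weight_space br alpha x])%VS.
Proof.
apply: (ad_weight_span gsL no_abelian_ideal hC) => x v hx vk.
have x0 := h_degree0 gsL no_abelian_ideal hC hES hx.
by apply: brE x0 vk; rewrite add0r.
Qed.

(** By trilinearity weight vectors suffice, and among them those with a nonzero product, whose total
    weight is then a weight of [l]. *)
Lemma weight_triple (j k : int) (M U : {vspace l}) :
  (forall x v, x \in h -> v \in M -> act x v \in M) ->
  (forall (a b lam : dual) x y v, x \in E j -> y \in E k -> v \in M ->
     weight_space br a x -> weight_space br b y -> weight_space act lam v ->
     act x (act y v) != 0 -> act x (act y v) \in U) ->
  forall x y v, x \in E j -> y \in E k -> v \in M -> act x (act y v) \in U.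
Proof.
move=> hM wU x y v xj yk Mv.
have s1 u : subspace [set x | act x u \in U].
  split=> [|a p q /= pU qU]; first by rewrite /= (act0l actM) mem0v.
  by rewrite (actPl actM) memvD ?memvZ.
have s2 x' u : subspace [set y | act x' (act y u) \in U].
  split=> [|a p q /= pU qU]; first by rewrite /= (act0l actM) (act0r actM) mem0v.
  by rewrite (actPl actM) (actPr actM) memvD ?memvZ.
have s3 x' y' : subspace [set u | act x' (act y' u) \in U].
  split=> [|a p q /= pU qU]; first by rewrite /= !(act0r actM) mem0v.
  by rewrite !(actPr actM) memvD ?memvZ.
apply: (vsp_ind (s1 (act y v)) _ (subvP (degree_weight_span j) _ xj)).
move=> {xj}x [xj [a xa]]; apply: (vsp_ind (s2 x v) _ (subvP (degree_weight_span k) _ yk)).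
move=> {yk}y [yk [b yb]].
have Ms := act_weight_span gsL no_abelian_ideal glM irr hC hM.
apply: (vsp_ind (s3 x y) _ (subvP Ms _ Mv)) => {Mv}v [Mv [lam vl]] /=.
have [->|n0] := eqVneq (act x (act y v)) 0; first exact: mem0v.
exact: wU xa yb vl n0.
Qed.

(** The two mixed exclusions make the eigenspace [M] of [JS] in degree -2 return to itself under a
    step up and a step down, in either order. The two others then fix the value of [JS] after two
    steps up, which fill [L 0]. *)
Lemma no_forbidden_scalar : L (-2) <> 0%VS ->
  no_forbidden_weight P (weights_in act gl (-2)) (roots_at br gs JS 'i)
    (roots_at br gs JS (- 'i)) ->
  exists c0, scalar_cond c0.
Proof.
move=> L2 nf.
have JSL v p : v \in L p -> act JS v \in L p.
  by move=> vp; apply: actE (JS_degree gsL ESd JS0) vp; rewrite add0r.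
have [|c0 [v0 [v0L v0N0]]] := eigenvector_exists (f := op act JS) _ L2.
  by move=> v vL; rewrite (opE actM) JSL.
rewrite (opE actM) => v0c; exists c0.
pose M := (L (-2) :&: lker (shift (op act JS) c0))%VS.
have MP v : v \in M <-> v \in L (-2) /\ act JS v = c0 *: v.
  rewrite memv_cap memv_ker shiftE (opE actM) subr_eq0.
  by split=> [/andP[? /eqP]//|[-> ->]]; rewrite /= eqxx.
have M0 x v : x \in E 0 -> v \in M -> act x v \in M.
  move=> x0 /MP[vL vc]; apply/MP; split.
    by apply: actE x0 vL.
  by rewrite (actAC actM) JSc // (act0l actM) add0r vc (actZr actM).
have hM x v : x \in h -> v \in M -> act x v \in M.
  by move=> hx; apply: M0; apply: (h_degree0 gsL no_abelian_ideal hC hES).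
have MN0 : M <> 0%VS.
  move=> /vspace0P M00; case/eqP: v0N0; apply: M00; exact/MP.
have act_neq0 x v : act x v != 0 -> v != 0.
  by apply: contraNneq => ->; rewrite (act0r actM).
have actl_neq0 x v : act x v != 0 -> x != 0.
  by apply: contraNneq => ->; rewrite (act0l actM).
have step a x k : weight_space (h := h) br a x -> x \in E k -> x != 0 ->
    weights br a /\ ev a ES = k%:~R.
  move=> xa xk x0; split; first exact: (weights_intro x0 xa).
  exact: (degree_root gsL hES x0 xa xk).
have Mlam (lam : dual) v : v \in M -> v != 0 -> weight_space act lam v ->
    weights_in act gl (-2) lam /\ ev lam JS = c0.
  move=> /MP[vL vc] vN0 vl; split; last first.
    by apply: (scaler_inj vN0); rewrite -(weightE hJS vl) vc.
  apply/(weights_inP gsL ESd glM irr hES); split; first exact: (weights_intro vN0 vl).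
  exact: (grade_weight _ vN0 vl vL).
(* By the second and fourth exclusions, a weight obtained by subtracting [d] and adding [a] forces
   both roots to be of the same type. *)
have mixed (lam a d : dual) : weights_in act gl (-2) lam -> weights br a ->
    weights br d -> ev a ES = -1 -> ev d ES = -1 -> P (lam - d + a) -> ev a JS = ev d JS.
  move=> lam2 wa wd aE dE wmu; have [n1 n2 n3 n4] := nf _ lam2.
  have [aJ|aJ] := root_JS1 (or_intror erefl) wa aE;
    have [dJ|dJ] := root_JS1 (or_intror erefl) wd dE; rewrite aJ dJ //.
    by case: (n4 a d); [exact/roots_atP | exact/roots_atP | rewrite addrAC].
  by case: (n2 d a); [exact/roots_atP | exact/roots_atP | ].
(* By the first and third exclusions, two roots subtracted in succession are of opposite types. *)
have pure (lam a d : dual) : weights_in act gl (-2) lam -> weights br a ->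
    weights br d -> ev a ES = -1 -> ev d ES = -1 -> P (lam - d - a) ->
    ev a JS + ev d JS = 0.
  move=> lam2 wa wd aE dE wmu; have [n1 n2 n3 n4] := nf _ lam2.
  have [aJ|aJ] := root_JS1 (or_intror erefl) wa aE;
    have [dJ|dJ] := root_JS1 (or_intror erefl) wd dE; rewrite aJ dJ ?subrr ?addNr //.
    by case: (n1 d a) => //; exact/roots_atP.
  by case: (n3 d a) => //; exact/roots_atP.
have oppr_root (a : dual) : weights br a -> ev a ES = 1 -> weights br (- a) /\ ev (- a) ES = -1.
  move=> wa aE; split; first exact: (root_opp gsL no_abelian_ideal hC wa).
  by rewrite opp_lfunE aE.
have Mk k x y v : k = 1 \/ k = -1 -> x \in E k -> y \in E (- k) -> v \in M ->
    act x (act y v) \in M.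
  move=> k1; apply: (weight_triple hM) => a b lam {}x {}y {}v xk yk Mv xa yb vl n0.
  have x0 := actl_neq0 _ _ n0; have y0 := actl_neq0 _ _ (act_neq0 _ _ n0).
  have v0' := act_neq0 _ _ (act_neq0 _ _ n0).
  have [wa aE] := step _ _ _ xa xk x0; have [wb bE] := step _ _ _ yb yk y0.
  have [lam2 lJ] := Mlam _ _ Mv v0' vl.
  have wl := weight_act actM adm xa (weight_act actM adm yb vl).
  have wP : P (a + (b + lam)) by apply: (weights_intro n0 wl).
  have ab0 : ev a JS + ev b JS = 0.
    case: k1 xk yk aE bE => -> xk yk aE bE.
      have [wa' aE'] := oppr_root _ wa aE.
      rewrite (mixed lam b (- a)) // ?opp_lfunE ?subrr //.
      by rewrite opprK -addrA addrC -addrA.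
    have [wb' bE'] := oppr_root _ wb bE.
    rewrite (mixed lam a (- b)) // ?opp_lfunE ?addNr //.
    by rewrite opprK addrC [lam + b]addrC.
  apply/MP; split.
    have y1 : act y v \in L (- k - 2).
      by have /MP[vL _] := Mv; apply: actE yk vL.
    by apply: actE xk y1; rewrite addrA subrr add0r.
  by rewrite (weightE hJS wl) !add_lfunE lJ addrA ab0 add0r.
have ML : (M <= L (-2))%VS by apply: capvSl.
have full := ladder_full no_abelian_ideal trans ML M0
  (fun x y v x1 y1 => Mk 1 x y v (or_introl erefl) x1 y1)
  (fun x y v x1 y1 => Mk (-1) x y v (or_intror erefl) x1 y1) MN0.
move=> p v [->|->] vp; last first.
  by have /MP[] := full 1 0%N v erefl vp.
have : v \in lker (shift (op act JS) c0); last first.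
  by rewrite memv_ker shiftE (opE actM) subr_eq0 => /eqP.
have := full 1 2%N v erefl vp; move: v {vp}; apply/subvP.
apply: bracket_sub => x u x1 u1.
apply: (vsp_ind (subspace_act actM x _) _ u1) => _ [y y1 [v Mv <-]] /=.
apply: (weight_triple hM _ x1 y1 Mv) => a b lam {x1 y1 u1}x {}y {Mv}v xk yk Mv xa yb vl n0.
have x0 := actl_neq0 _ _ n0; have y0 := actl_neq0 _ _ (act_neq0 _ _ n0).
have v0' := act_neq0 _ _ (act_neq0 _ _ n0).
have [wa aE] := step _ _ _ xa xk x0; have [wb bE] := step _ _ _ yb yk y0.
have [lam2 lJ] := Mlam _ _ Mv v0' vl.
have wl := weight_act actM adm xa (weight_act actM adm yb vl).
have wP : P (a + (b + lam)) by apply: (weights_intro n0 wl).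
have [wa' aE'] := oppr_root _ wa aE; have [wb' bE'] := oppr_root _ wb bE.
have : ev (- a) JS + ev (- b) JS = 0.
  apply: (pure lam) => //; rewrite !opprK addrC; by rewrite [lam + b]addrC.
rewrite !opp_lfunE -opprD => /eqP; rewrite oppr_eq0 => /eqP ab0.
by rewrite memv_ker shiftE (opE actM) (weightE hJS wl) !add_lfunE lJ addrA ab0 add0r subrr.
Qed.

(** [act x v] has degree -2, where [JS] acts by [c0]; moving [JS] past [x] costs [e *: act x v]. *)
Lemma scalar_jspace c0 e x v : scalar_cond c0 -> x \in jspace (-1) e ->
  v \in L (-1) -> act x (act JS v - c0 *: v) = - e *: act x v.
Proof.
move=> sc /(jspaceP ES JS gsL)[x1 xe] v1.
have xv : act x v \in L (-2) by apply: actE x1 v1.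
have := sc _ _ (or_intror erefl) xv.
rewrite (actAC actM) xe (actZl actM) => xJ.
by rewrite (actBr actM) (actZr actM) -xJ opprD addrCA subrr addr0 scaleNr.
Qed.

(* On [l_{-1}], [JS - c0] squares to [-1]: this holds after applying any element of
   [s_{-1}], and no nonzero element of [l_{-1}] is annihilated by [s_{-1}]. *)
Lemma scalar_sqr c0 v : L (-2) <> 0%VS -> scalar_cond c0 -> v \in L (-1) ->
  let w := act JS v - c0 *: v in act JS w - c0 *: w = - v.
Proof.
move=> L2 sc v1 w.
have JSL u : u \in L (-1) -> act JS u - c0 *: u \in L (-1).
  move=> u1; rewrite memvB ?memvZ //; have J0 := JS_degree gsL ESd JS0.
  by apply: actE J0 u1.
apply/eqP; rewrite -addr_eq0; apply/eqP.
have Ii : @isI C 'i by left.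
have w1 : w \in L (-1) by apply: JSL.
apply: (singular_eq0 no_abelian_ideal trans (p := -1) (q := -2) _ L2) => //.
  by rewrite memvD ?JSL.
have main e x : isI e -> x \in jspace (-1) e -> act x (act JS w - c0 *: w + v) = 0.
  move=> Ie xe; rewrite (actDr actM) (scalar_jspace sc xe w1) (scalar_jspace sc xe v1).
  by rewrite scalerA mulrNN (isI_sqr Ie) scaleN1r addNr.
move=> x x1.
have [|y [z [ye ze ->]]] := jspace_dec gsL trans ESd JS0 JS2 JScomm Ii _ x1; first by right.
by rewrite (actDl actM) (main _ _ Ii ye) (main _ _ (isIN Ii) ze) addr0.
Qed.

Lemma scalar_weight1 c0 (lam : dual) : L (-2) <> 0%VS -> scalar_cond c0 ->
  P lam -> ev lam ES = -1 + c -> isI (ev lam JS - c0).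
Proof.
move=> L2 sc wl lE; have [v v0 vl] := weights_ex actM wl.
have v1 : v \in L (-1) by apply: weight_grade vl _.
have := scalar_sqr L2 sc v1; rewrite /= (weightE hJS vl) -scalerBl (actZr actM).
rewrite (weightE hJS vl) scalerA [c0 *: _]scalerA -scalerBl -scaleN1r => /eqP.
rewrite -subr_eq0 -scalerBl scaler_eq0 (negPf v0) orbF subr_eq0 [_ * ev lam JS]mulrC.
rewrite -mulrBl -expr2 -sqrCi eqf_sqr => /orP[]/eqP->; [by left | by right].
Qed.

Variable B : seq dual.
Local Notation B0 := ([set` B] `&` roots_in br gs 0).
Local Notation Bj e := ([set` B] `&` roots_at br gs JS e).

(** The parts are told apart by the values [c0 + 'i] and [c0 - 'i] at [JS]. Roots of degree 0 vanish
    at [JS]; a weight excluded in (b) would have degree 0 or -2 and a value other than [c0]. *)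
Lemma scalar_CR_partition c0 : L (-2) <> 0%VS -> scalar_cond c0 ->
  CR_partition P (weights_in act gl (-1)) B0 (Bj 'i) (Bj (- 'i)).
Proof.
move=> L2 sc; pose Pj e := [set lam | [/\ P lam, ev lam ES = -1 + c & ev lam JS = c0 + e]].
have JB0 b : B0 b -> ev b ES = 0 /\ ev b JS = 0.
  move=> [_ /(roots_inP gsL ESd hES)[wb _ bE]]; split=> //.
  exact: root_JS0.
have JBj e b : Bj e b -> ev b ES = -1 /\ ev b JS = e by move=> [_ /roots_atP[]].
exists (Pj 'i), (Pj (- 'i)); split.
- apply/seteqP; split=> lam.
    move=> /(weights_inP gsL ESd glM irr hES)[wl lE].
    have [lJ|lJ] := scalar_weight1 L2 sc wl lE; [left | right]; split=> //;
      by rewrite -lJ addrC subrK.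
  by case=> -[wl lE _]; apply/(weights_inP gsL ESd glM irr hES).
- apply/seteqP; split=> // lam [[_ _ lJ] [_ _]]; rewrite lJ => /addrI/eqP.
  by rewrite -addr_eq0 (negPf i2_neq0).
- split=> lam [[a [wa aE aJ] [b /JB0[bE bJ] <-]] wl]; split=> //;
    by rewrite add_lfunE ?opp_lfunE ?aE ?aJ ?bE ?bJ ?oppr0 addr0.
split; apply/seteqP; split=> // lam [[a [wa aE aJ] [b /JBj[bE bJ] <-]]].
- apply: (scalar_not_weight sc (or_intror erefl) _ _ i2_neq0);
    by rewrite !add_lfunE ?opp_lfunE ?aE ?bE ?aJ ?bJ; ring.
- apply: (scalar_not_weight sc (or_introl erefl) _ _ i2_neq0);
    by rewrite !add_lfunE ?opp_lfunE ?aE ?bE ?aJ ?bJ; ring.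
- apply: (scalar_not_weight sc (or_intror erefl) _ _ Ni2_neq0);
    by rewrite !add_lfunE ?opp_lfunE ?aE ?bE ?aJ ?bJ; ring.
- apply: (scalar_not_weight sc (or_introl erefl) _ _ Ni2_neq0);
    by rewrite !add_lfunE ?opp_lfunE ?aE ?bE ?aJ ?bJ; ring.
Qed.

End WeightConditions.

(** * Simple roots and the grading by heights *)

Lemma free_functionals_eval1 (C : fieldType) (U : vectType C) (B : seq 'Hom(U, C^o)) :
  free B -> exists u, forall b, b \in B -> b u = 1.
Proof.
move=> fB; pose X := in_tuple B; have /freeP fX : free X by [].
pose e := vbasis (fullv : {vspace U}).
pose A := \matrix_(i < size B, j < \dim (fullv : {vspace U})) (X`_i e`_j : C).
(* The matrix of independent functionals in a basis has a right inverse [D]; applied to the constant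
   vector 1, it gives the coordinates sought. *)
have /row_freeP[D AD] : row_free A.
  rewrite -kermx_eq0; apply/rowV0P => v /sub_kermxP vA.
  apply/rowP => i; rewrite mxE; apply: (fX (fun i => v 0 i)) => {i}.
  apply/lfunP => u; rewrite zero_lfunE (coord_vbasis (memvf u)) linear_sum big1 // => j _.
  rewrite linearZ /= sum_lfunE; have /matrixP/(_ 0 j) := vA; rewrite !mxE.
  under eq_bigr do rewrite mxE; move=> vj.
  by under eq_bigr do rewrite scale_lfunE; rewrite [X in _ *: X]vj scaler0.
pose x := D *m const_mx 1 : 'cV_(\dim (fullv : {vspace U})).
have Ax : A *m x = const_mx 1 by rewrite mulmxA AD mul1mx.
exists (\sum_j x j 0 *: e`_j) => b bB.
have bi : (index b B < size B)%N by rewrite index_mem.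
have := congr1 (fun M : 'cV_(size B) => M (Ordinal bi) 0) Ax; rewrite !mxE /= => <-.
rewrite linear_sum; apply: eq_bigr => j _.
by rewrite linearZ /= [A _ _]mxE /= nth_index // mulrC.
Qed.

Section SimpleRoots.
Variables (C : numClosedFieldType) (s : vectType C) (br : s -> s -> s) (h : {vspace s}).
Variable gs : int -> set s.
Hypothesis gsL : graded_lie_algebra br gs.
Hypothesis no_abelian_ideal : without_abelian_ideal br.
Hypothesis hC : cartan_subalgebra br [set` h].
Local Notation dual := 'Hom(subvs_of h, C^o).
Variable B : seq dual.
Hypothesis sB : simple_roots br B.

Let brL : lie_algebra br. Proof. by case: gsL. Qed.
Let adm : lie_module br br := adM brL.
Let hcomm x y : x \in h -> y \in h -> br x y = 0.
Proof. exact: (cartan_abelian brL no_abelian_ideal hC). Qed.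
Let hdiag x : x \in h -> diagonalizable (op br x).
Proof. exact: (cartan_diag brL no_abelian_ideal hC). Qed.
Let fB : free B. Proof. by case: sB. Qed.

Let scE (a : C) (b : C^o) : a *: b = a * b. Proof. by []. Qed.

Definition comb (k : dual -> nat) : dual := \sum_(b <- B) (k b)%:R *: b.

Lemma combE k u : comb k u = \sum_(b <- B) (k b)%:R * b u.
Proof. by rewrite /comb sum_lfunE; apply: eq_bigr => b _; rewrite scale_lfunE. Qed.

Lemma root_comb (alpha : dual) : Defs.roots br alpha -> exists k (e : bool),
  alpha = (-1) ^+ e *: comb k.
Proof.
case: sB => _ _ rB /rB[k]; have -> : \sum_(b <- B) b *+ k b = comb k.
  by apply: eq_bigr => b _; rewrite scaler_nat.
by case=> ->; exists k; [exists false; rewrite scale1r | exists true; rewrite scaleN1r].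
Qed.

(** All simple roots take the value 1 there, so that a root takes its signed height. *)
Definition height_elt : subvs_of h := sval (cid (free_functionals_eval1 fB)).
Local Notation u0 := height_elt.

Lemma height_simple b : b \in B -> b u0 = 1.
Proof. by rewrite /height_elt; case: cid => u /= uB; apply: uB. Qed.

Lemma height_comb k : comb k u0 = (\sum_(b <- B) k b)%:R.
Proof.
rewrite combE natr_sum big_seq [RHS]big_seq; apply: eq_bigr => b bB.
by rewrite height_simple // mulr1.
Qed.

Lemma comb_eq0 k : (\sum_(b <- B) k b = 0)%N -> comb k = 0.
Proof.
move=> /eqP; rewrite sum_nat_seq_eq0 => /allP k0.
rewrite /comb big_seq big1 // => b /k0 /= /eqP->; by rewrite scale0r.
Qed.

Lemma comb_eq1 k : (\sum_(b <- B) k b = 1)%N -> exists2 b, b \in B & comb k = b.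
Proof.
move=> /sum_nat_seq_eq1[b [bB _ kb1 k0]]; exists b => //.
rewrite /comb (bigD1_seq b) ?(free_uniq fB) //= kb1 scale1r big_seq_cond.
by rewrite big1 ?addr0 // => b' /andP[b'B b'b]; rewrite k0 // scale0r.
Qed.

(* The roots have eigenvalues [(-1) ^+ e] times their height. *)
Definition height_deg (e : bool) : s := (-1) ^+ e *: vsval u0.
Local Notation D e := (degree_space br (height_deg e)).

Let uh : vsval u0 \in h. Proof. exact: subvsP. Qed.

Let Hh e : height_deg e \in h. Proof. by rewrite memvZ. Qed.

Lemma height_degP e n (alpha : dual) x : x != 0 -> weight_space br alpha x ->
  (x \in D e n) <-> (-1) ^+ e * alpha u0 = n%:~R.
Proof.
move=> x0 xa; rewrite (degreeP brL) /height_deg (actZl adm) (weightE uh xa) vsvalK scalerA.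
split=> [|->//]; exact: scaler_inj.
Qed.

Lemma root_height (alpha : dual) x : x != 0 -> weight_space br alpha x ->
  x \in h \/ exists (e : bool) n k,
    [/\ alpha = (-1) ^+ e *: comb k, x \in D e n.+1%:Z & (\sum_(b <- B) k b = n.+1)%N].
Proof.
move=> x0 xa; have [a0|/eqP a0] := eqVneq alpha 0.
  left; apply: (h_self_centralizing hC) => y hy.
  by rewrite (br_anti brL) (weightE hy xa) a0 zero_lfunE scale0r oppr0.
have ra : Defs.roots br alpha by split=> //; apply: weights_intro xa.
have [k [e aE]] := root_comb ra; right; exists e.
case kE : (\sum_(b <- B) k b)%N => [|n].
  by case: a0; rewrite aE comb_eq0 // scaler0.
exists n, k; split=> //; apply/(height_degP e _ x0 xa).
by rewrite aE scale_lfunE height_comb kE scE mulrA -expr2 sqrr_sign mul1r.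
Qed.

Let D_stable e n x v : x \in h -> v \in D e n -> br x v \in D e n.
Proof.
move=> hx /(degreeP brL) vn; apply/(degreeP brL); rewrite (br_jacobi brL) vn (actZr adm).
by rewrite (hcomm (Hh e) hx) (act0l adm) add0r.
Qed.

Let D_span e n : (D e n <= vsp [set x | x \in D e n /\
  exists alpha : dual, weight_space br alpha x])%VS.
Proof. exact: (weight_span adm hdiag hcomm (@D_stable e n)). Qed.

Lemma height_dec e v : v \in vsp [set v | exists k, v \in D e k].
Proof.
apply: (weight_ind adm hdiag hcomm (Q := [set v | v \in vsp _])).
  exact: subspace_vspace.
move=> alpha w wa; have [->|w0] := eqVneq w 0; first exact: mem0v.
have [hw|[e' [n [k [_ wn _]]]]] := root_height w0 wa; apply: mem_vsp.
  by exists 0; apply/(degreeP brL); rewrite (hcomm (Hh e) hw) scale0r.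
exists ((-1) ^+ (e (+) e') * n.+1%:Z); apply/(height_degP e _ w0 wa).
move: wn => /(height_degP e' _ w0 wa) wn.
rewrite signr_addb intrM -wn rmorphM !rmorphXn /= rmorphN1.
by rewrite -mulrA; congr (_ * _); rewrite mulrA -expr2 sqrr_sign mul1r.
Qed.

Lemma height_degree1 e (alpha : dual) x : x != 0 -> weight_space br alpha x ->
  x \in D e 1 -> exists2 b, b \in B & alpha = (-1) ^+ e *: b.
Proof.
move=> x0 xa /(height_degP e _ x0 xa) x1.
have [hx|[e' [n [k [aE _ kE]]]]] := root_height x0 xa.
  have xx := weightE uh xa; rewrite hcomm // vsvalK in xx.
  move/esym/eqP: xx; rewrite scaler_eq0 (negPf x0) orbF => /eqP au.
  by move: x1; rewrite au mulr0 => /eqP; rewrite eq_sym oner_eq0.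
move: x1; rewrite aE scale_lfunE height_comb kE scE mulrA -signr_addb.
case: (boolP (e (+) e')) => [ee|/negPf ee].
  rewrite expr1 mulN1r => /eqP; rewrite -subr_eq0 -opprD oppr_eq0.
  by rewrite (_ : 1 = 1%:R) // -natrD pnatr_eq0 addSn.
rewrite expr0 mul1r => /eqP; rewrite (_ : 1%:~R = 1%:R) // eqr_nat => /eqP n0.
have [b bB kb] := comb_eq1 (etrans kE n0).
by exists b => //; rewrite kb; move: ee; case: (e); case: (e').
Qed.

Let fin0 e x : x \in D e 0 -> x \in h.
Proof.
move=> x0; apply: (vsp_ind (subspace_vspace h) _ (subvP (D_span e 0) _ x0)).
move=> {x0}w [w0 [alpha wa]] /=; have [->|wN0] := eqVneq w 0; first exact: mem0v.
have [//|[e' [n [k [aE _ kE]]]]] := root_height wN0 wa.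
move: w0 => /(height_degP e _ wN0 wa) /eqP.
rewrite aE scale_lfunE height_comb kE scE mulrA -signr_addb.
by rewrite mulf_eq0 signr_eq0 pnatr_eq0.
Qed.

(** [x] lies in [h], and commuting with the simple root vectors of sign [e] it is a zero of all
    simple roots, hence of all roots; so it is central. *)
Lemma height_faithful e x : x \in D e 0 -> (forall y, y \in D e 1 -> br y x = 0) -> x = 0.
Proof.
move=> /fin0 hx x0; have bx b : b \in B -> b (vsproj h x) = 0.
  move=> bB; have rb : Defs.roots br b by case: sB => _ + _; apply.
  have [y y0 yb] : exists2 y, y != 0 & weight_space br ((-1) ^+ e *: b) y.
    apply: (weights_ex adm); case: rb => wb _.
    case: e {x0}; rewrite ?expr0 ?scale1r ?expr1 ?scaleN1r //.
    exact: (root_opp gsL no_abelian_ideal hC wb).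
  have : br y x = 0.
    apply: x0; apply/(height_degP e _ y0 yb).
    by rewrite scale_lfunE height_simple // scE mulrA -expr2 sqrr_sign mul1r.
  rewrite (br_anti brL) (weightE hx yb) scale_lfunE => /eqP.
  by rewrite oppr_eq0 scaler_eq0 (negPf y0) orbF scE mulf_eq0 signr_eq0 => /eqP.
apply: (ad_eq0_center brL no_abelian_ideal) => y.
apply: (weight_ind adm hdiag hcomm (Q := [set y | br x y = 0])).
  split=> [|a p q /= p0 q0]; first by rewrite /= (act0r adm).
  by rewrite (actPr adm) p0 q0 scaler0 addr0.
move=> alpha w wa /=; have [->|w0] := eqVneq w 0; first exact: (act0r adm).
have [hw|[e' [n [k [aE _ kE]]]]] := root_height w0 wa; first exact: hcomm.
rewrite (weightE hx wa) aE scale_lfunE combE big_seq big1 => [|b bB].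
  by rewrite scaler0 scale0r.
by rewrite bx // mulr0.
Qed.

(** The generation theorem for the grading by heights; it makes induction on the height of a root
    possible. *)
Lemma height_generation e (n : nat) :
  (D e n.+1%:Z <= bracket_vs br (D e 1) (D e n%:Z))%VS.
Proof.
have := degree_generation brL no_abelian_ideal (height_dec e) (@height_faithful e) (le0z_nat n).
by rewrite -PoszD addn1.
Qed.

End SimpleRoots.

(** * From a partition of the weights of degree -1 to condition (ii) *)

Section PartitionScalar.
Variables (C : numClosedFieldType) (s l : vectType C).
Variables (br : s -> s -> s) (gs : int -> set s) (act : s -> l -> l) (gl : int -> set l).
Variables (ES JS : s) (h : {vspace s}).
Hypothesis gsL : graded_lie_algebra br gs.
Hypothesis no_abelian_ideal : without_abelian_ideal br.
Hypothesis trans : transitive_gr gs br gs.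
Hypothesis ESd : forall p X, gs p X -> br ES X = p%:~R *: X.
Hypothesis glM : graded_module br gs act gl.
Hypothesis irr : lie_irreducible act.
Hypothesis JS0 : gs 0 JS.
Hypothesis JS2 : forall X, gs (-1) X -> br JS (br JS X) = - X.
Hypothesis JScomm : forall A X, gs 0 A -> gs (-1) X -> br A (br JS X) = br JS (br A X).
Hypothesis hC : cartan_subalgebra br [set` h].
Hypothesis hES : ES \in h.
Local Notation dual := 'Hom(subvs_of h, C^o).
Variable B : seq dual.
Hypothesis sB : simple_roots br B.

Let brL : lie_algebra br. Proof. by case: gsL. Qed.
Let adm : lie_module br br := adM brL.
Let actM : lie_module br act. Proof. by case: glM. Qed.
Local Notation E := (degree_space br ES).
Local Notation L := (grade gsL ESd glM irr).
Local Notation c := (degree_shift gsL ESd glM irr).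
Local Notation ev lam x := ((lam : dual) (vsproj h x)).
Local Notation P := (weights (h := h) act).
Local Notation jspace := (jspace br ES JS).
Local Notation D e := (degree_space br (height_deg sB e)).
Local Notation B0 := ([set` B] `&` roots_in br gs 0).
Local Notation Bj e := ([set` B] `&` roots_at br gs JS e).

Hypothesis BE : [set` B] = B0 `|` Bj 'i `|` Bj (- 'i).
Hypothesis L1 : L (-1) <> 0%VS.

Let hJS : JS \in h.
Proof. exact: (JS_cartan gsL no_abelian_ideal trans ESd JS0 JScomm hC hES). Qed.

Let JSc A : A \in E 0 -> br JS A = 0.
Proof. exact: (JS_central gsL trans ESd JS0 JScomm). Qed.

Let actE p q m x v : p + q = m -> x \in E p -> v \in L q -> act x v \in L m.
Proof. exact: act_grade. Qed.

Lemma simple_cases b : b \in B -> (ev b ES = 0 /\ ev b JS = 0 /\ B0 b) \/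
  exists2 e, isI e & [/\ ev b ES = -1, ev b JS = e & Bj e b].
Proof.
move=> bB; have [[bB0|bBi]|bBi] : (B0 `|` Bj 'i `|` Bj (- 'i)) b by rewrite -BE.
- left; move: (bB0) => [_ /(roots_inP gsL ESd hES)[wb _ bE]]; split=> //; split=> //.
  exact: (root_JS0 gsL no_abelian_ideal trans ESd JS0 JScomm hC hES).
- right; exists 'i; first exact: or_introl.
  by move: (bBi) => [_ /(roots_atP JS gsL ESd hES)[]].
- right; exists (- 'i); first exact: or_intror.
  by move: (bBi) => [_ /(roots_atP JS gsL ESd hES)[]].
Qed.

Lemma comb_ES k : exists m : nat, ev (comb B k) ES = - m%:R.
Proof.
rewrite combE big_seq; elim/big_rec: _ => [|b x bB [m ->]]; first by exists 0%N; rewrite oppr0.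
have [[-> _]|[e _ [-> _ _]]] := simple_cases bB; first by exists m; rewrite mulr0 add0r.
by exists (k b + m)%N; rewrite mulrN1 natrD opprD.
Qed.

Variable Pe : C -> set dual.
Hypothesis Pe_in : forall e lam, isI e -> Pe e lam -> weights_in act gl (-1) lam.
Hypothesis Pe_all : forall lam, weights_in act gl (-1) lam -> Pe 'i lam \/ Pe (- 'i) lam.
Hypothesis Pe_st : forall f lam b (e : bool), isI f -> Pe f lam -> B0 b ->
  P (lam + (-1) ^+ e *: b) -> Pe f (lam + (-1) ^+ e *: b).
Hypothesis Pe_down : forall f lam b, isI f -> Pe f lam -> Bj f b -> ~ P (lam + b).
Hypothesis Pe_up : forall f lam b, isI f -> Pe f lam -> Bj (- f) b -> ~ P (lam - b).

Definition Lpart f : {vspace l} :=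
  vsp [set v | exists2 lam, Pe f lam & weight_space act lam v].
Local Notation Lj := Lpart.

Lemma Lpart_ind f (Q : set l) v : subspace Q ->
  (forall lam w, w != 0 -> Pe f lam -> weight_space act lam w -> Q w) -> v \in Lj f -> Q v.
Proof.
move=> sQ wQ; apply: (vsp_ind sQ) => w [lam Pl wl].
have [->|w0] := eqVneq w 0; first by case: sQ.
exact: wQ Pl wl.
Qed.

Lemma mem_Lpart f lam v : Pe f lam -> weight_space act lam v -> v \in Lj f.
Proof. by move=> Pl vl; apply: mem_vsp; exists lam. Qed.

Lemma Lpart_sub f : isI f -> (Lj f <= L (-1))%VS.
Proof.
move=> If; apply: vsp_sub => v [lam /(Pe_in If)[_ lamL] /lamL].
by move=> v1; apply/(glP gsL ESd glM irr).
Qed.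

Definition pres x := forall f v, isI f -> v \in Lj f -> act x v \in Lj f.
Definition annih (d : int) f x := (forall v, v \in Lj f -> act x v = 0) /\
  (d = -1 -> forall v, v \in L 0 -> act x v \in Lj f).
(** What [scalar_of_splitting] requires of [x]. Being implications on the degree of [x], these
    conditions are not linear in [x]: the induction on heights runs on weight vectors, and
    [degree0_pres] and [jspace_annih] pass to sums by projecting. *)
Definition good x := (x \in E 0 -> pres x) /\
  (forall d f, d = 1 \/ d = -1 -> isI f -> x \in jspace d f -> annih d f x).

Lemma pres_subspace : subspace pres.
Proof.
split=> [f v _ _|a x y px py f v If vf]; first by rewrite (act0l actM) mem0v.
by rewrite (actPl actM) memvD ?memvZ ?px ?py.
Qed.

Lemma annih_subspace d f : subspace (annih d f).
Proof.
split=> [|a x y [x1 x2] [y1 y2]].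
  by split=> [v _|_ v _]; rewrite (act0l actM) ?mem0v.
split=> [v vf|d1 v v0]; rewrite (actPl actM); first by rewrite x1 ?y1 // scaler0 addr0.
by rewrite memvD ?memvZ ?x2 ?y2.
Qed.

Let weight_in k x (alpha : dual) : weight_space br alpha x -> ev alpha ES = k%:~R -> x \in E k.
Proof. by move=> xa aE; apply/(degreeP brL); rewrite (weightE hES xa) aE. Qed.

Lemma good_h x : x \in h -> good x.
Proof.
move=> hx; have x0 := h_degree0 gsL no_abelian_ideal hC hES hx.
split=> [_ f v If vf|d f d1 If /(jspaceP ES JS gsL)[xd _]].
  apply: (Lpart_ind (subspace_act actM x (Lj f)) _ vf) => lam w _ Pl wl /=.
  by rewrite (weightE hx wl) memvZ // (mem_Lpart Pl wl).
suff -> : x = 0 by case: (annih_subspace d f).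
have x00 : br ES x = 0 by move/(degreeP brL): x0 => ->; rewrite scale0r.
move: xd => /(degreeP brL); rewrite x00 => /esym/eqP; rewrite scaler_eq0 intr_eq0.
by case: d1 => -> /= /eqP.
Qed.

(** For a simple root of degree 0, condition (a) gives the stability of the parts; for the others,
    condition (b) gives the annihilation. *)
Lemma good_simple (e : bool) b y : b \in B -> weight_space br ((-1) ^+ e *: b) y -> good y.
Proof.
move=> bB yb; have [->|y0] := eqVneq y 0.
  by split=> [_|d f _ _ _]; [case: pres_subspace | case: (annih_subspace d f)].
have bev x : ev ((-1) ^+ e *: b) x = (-1) ^+ e * ev b x by rewrite scale_lfunE.
have actw (lam : dual) v : weight_space act lam v -> act y v != 0 ->
    P (lam + (-1) ^+ e *: b) /\ weight_space act (lam + (-1) ^+ e *: b) (act y v).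
  move=> vl n0; have yl := weight_act actM adm yb vl; rewrite addrC in yl.
  by split=> //; apply: (weights_intro n0 yl).
split=> [yE0|d f d1 If /(jspaceP ES JS gsL)[yd yf]].
  have [[bE [bJ bB0]]|[f _ [bE _ _]]] := simple_cases bB; last first.
    have := degree_root gsL hES y0 yb yE0; rewrite bev bE => /eqP.
    by rewrite mulf_eq0 signr_eq0 oppr_eq0 oner_eq0.
  move=> f v If vf; apply: (Lpart_ind (subspace_act actM y (Lj f)) _ vf).
  move=> lam w _ Pl wl /=; have [->|n0] := eqVneq (act y w) 0; first exact: mem0v.
  have [wP yw] := actw _ _ wl n0; apply: mem_Lpart yw; exact: Pe_st.
have dE := degree_root gsL hES y0 yb yd; rewrite bev in dE.
have fE : (-1) ^+ e * ev b JS = f.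
  by apply: (scaler_inj y0); rewrite -bev -(weightE hJS yb).
have [[bE _]|[g Ig [bE bJ bBg]]] := simple_cases bB.
  by move/eqP: dE; rewrite bE mulr0 eq_sym intr_eq0; case: d1 => ->.
rewrite bE bJ in dE fE.
have killw : forall v, v \in Lj f -> act y v = 0.
  move=> v vf; have sQ : subspace [set v | act y v = 0].
    split=> [|a u w /= u0 w0]; first by rewrite /= (act0r actM).
    by rewrite (actPr actM) u0 w0 scaler0 addr0.
  apply: (Lpart_ind sQ _ vf) => lam w _ Pl wl /=; apply/eqP; apply: contrapT => /negP n0.
  have [wP _] := actw _ _ wl n0.
  case: e fE wP {yb bev actw dE} => fE wP.
    apply: (Pe_up If Pl (b := b)); last by rewrite expr1 scaleN1r in wP.
    by rewrite -fE expr1 mulN1r opprK.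
  apply: (Pe_down If Pl (b := b)); last by rewrite expr0 scale1r in wP.
  by rewrite -fE expr0 mul1r.
split=> // dm v v0; rewrite dm in dE yd.
have e0 : e = false.
  case: e dE {fE yb bev actw} => //; rewrite expr1 mulrNN mulr1 => /eqP.
  by rewrite -subr_eq0 opprK -mulr2n mulrn_eq0 oner_eq0.
have hL x w : x \in h -> w \in L 0 -> act x w \in L 0.
  by move=> /(h_degree0 gsL no_abelian_ideal hC hES) x0 w0; apply: actE x0 w0.
have Ls := act_weight_span gsL no_abelian_ideal glM irr hC hL.
apply: (vsp_ind (subspace_act actM y (Lj f)) _ (subvP Ls _ v0)) => {v0}v [v0 [lam vl]] /=.
have [->|n0] := eqVneq (act y v) 0; first exact: mem0v.
have [wP yw] := actw _ _ vl n0; rewrite e0 expr0 scale1r in wP yw fE.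
rewrite mul1r in fE.
have vN0 : v != 0 by apply: contraNneq n0 => ->; rewrite (act0r actM).
have in1 : weights_in act gl (-1) (lam + b).
  apply/(weights_inP gsL ESd glM irr hES); split=> //.
  have lE := grade_weight hES vN0 vl v0.
  by rewrite add_lfunE lE bE add0r addrC.
have Plam : P lam by apply: (weights_intro vN0 vl).
(* The weight [lam + b] has degree -1. In the part [- f], subtracting [b] from it would lead outside
   the weights, but it leads back to [lam]. *)
have Pf : Pe f (lam + b) \/ Pe (- f) (lam + b).
  case: If => ->; first exact: Pe_all.
  by rewrite opprK; case: (Pe_all in1); [right | left].
case: Pf => Pf; first exact: mem_Lpart Pf yw.
case: (Pe_up (isIN If) Pf (b := b)); last by rewrite addrK.
by rewrite opprK -fE.
Qed.

(** Simple roots have degree 0 or -1, so the degrees of the roots of sign [e] never have opposite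
    signs; this excludes cancellation in [good_step]. *)
Lemma signed_degree e n (alpha : dual) z : z != 0 -> weight_space br alpha z ->
  z \in D e n.+1%:Z -> exists m : nat, ev alpha ES = - ((-1) ^+ e * m%:R).
Proof.
move=> z0 za zn.
have [hz|[e' [n' [k [aE zn' _]]]]] := root_height gsL hC sB z0 za.
  have [->|] := pselect (alpha = 0); first by exists 0%N; rewrite zero_lfunE mulr0 oppr0.
  move=> a0; case: a0; apply/lfunP => H; rewrite zero_lfunE; apply: (scaler_inj z0).
  by rewrite -za scale0r (h_comm gsL no_abelian_ideal hC) // subvsP.
have ee : e' = e.
  have := (height_degP gsL sB e _ z0 za).1 zn; have := (height_degP gsL sB e' _ z0 za).1 zn'.
  case: (e); case: (e') => //; rewrite expr0 expr1 mul1r mulN1r => h1 h2;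
    have /esym/eqP := congr2 +%R h1 h2; by rewrite ?subrr ?addNr -intrD intr_eq0.
have [m mE] := comb_ES k; exists m.
by rewrite aE scale_lfunE mE ee; exact: mulrN.
Qed.

Let actM_br x y v : act (br x y) v = act x (act y v) - act y (act x v).
Proof. exact: (act_br actM). Qed.

Lemma pres_br x y : pres x -> pres y -> pres (br x y).
Proof. by move=> px py f v If vf; rewrite actM_br memvB ?px ?py ?px. Qed.

Lemma annih_br d f x z : isI f -> x \in E 0 -> pres x -> annih d f z -> annih d f (br x z).
Proof.
move=> If x0 px [z1 z2]; split=> [v vf|d1 v v0]; rewrite actM_br.
  by rewrite (z1 v vf) (act0r actM) z1 ?subrr //; apply: px.
have xv : act x v \in L 0 by apply: actE x0 v0.
by rewrite memvB ?z2 // px ?z2.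
Qed.

Lemma annihN d f z : annih d f z -> annih d f (- z).
Proof. by move=> zf; rewrite -scaleN1r; apply: subspaceZ => //; apply: annih_subspace. Qed.

(** The degrees of [y] and [z] do not cancel: if [br y z] has degree 0, so have both, and if it has
    degree 1 or -1, exactly one of them has degree 0. The bracket thus acts as a commutator with an
    operator that preserves the parts. *)
Lemma good_step (e : bool) n b (alpha : dual) y z : b \in B -> weight_space br ((-1) ^+ e *: b) y ->
  weight_space br alpha z -> z \in D e n.+1%:Z -> good z -> good (br y z).
Proof.
move=> bB yb za zn [gz0 gz]; have [gy0 gy] := good_simple bB yb.
have [->|w0] := eqVneq (br y z) 0.
  by split=> [_|d f _ _ _]; [case: pres_subspace | case: (annih_subspace d f)].
have y0 : y != 0 by apply: contraNneq w0 => ->; rewrite (act0l adm).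
have z0 : z != 0 by apply: contraNneq w0 => ->; rewrite (act0r adm).
have [m aE] := signed_degree z0 za zn.
have wb := weight_act adm adm yb za.
have sg2 : (-1) ^+ e * (-1) ^+ e = 1 :> C by rewrite -expr2 sqrr_sign.
have bev x : ev ((-1) ^+ e *: b + alpha) x = (-1) ^+ e * ev b x + ev alpha x.
  by rewrite add_lfunE scale_lfunE.
have yE k : ev b ES = 0 -> k = 0 -> y \in E k.
  by move=> bE ->; apply: weight_in yb _; rewrite scale_lfunE bE; apply: mulr0.
(* If [b] has degree -1, the total degree is [m.+1] in absolute value: never 0, and 1 only for
   [m = 0]. *)
have key : ev b ES = -1 -> forall k : int, (- k%:~R = (-1) ^+ e * (m.+1)%:R :> C) \/
    ev ((-1) ^+ e *: b + alpha) ES <> k%:~R.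
  move=> bE k; have [H|H] := pselect (ev ((-1) ^+ e *: b + alpha) ES = k%:~R); last by right.
  by left; rewrite -H bev bE aE -addn1 natrD; ring.
split=> [wE0|d f d1 If /(jspaceP ES JS gsL)[wd wf]].
  have wES := degree_root gsL hES w0 wb wE0.
  have [[bE _]|[g _ [bE _ _]]] := simple_cases bB; last first.
    case: (key bE 0) => // /eqP; rewrite oppr0 eq_sym mulf_eq0 signr_eq0 pnatr_eq0 //.
  have zE : z \in E 0 by apply: weight_in za _; rewrite -wES bev bE mulr0 add0r.
  by apply: pres_br; [exact/gy0/yE | exact: gz0].
have wES := degree_root gsL hES w0 wb wd.
have wJS : ev ((-1) ^+ e *: b + alpha) JS = f.
  by apply: (scaler_inj w0); rewrite -(weightE hJS wb).
have [[bE [bJ _]]|[g Ig [bE bJ bBg]]] := simple_cases bB.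
  have y00 : y \in E 0 by apply: yE.
  apply: annih_br => //; first exact: gy0.
  apply: gz => //; apply/(jspaceP ES JS gsL); split.
    by apply: weight_in za _; rewrite -wES bev bE mulr0 add0r.
  by rewrite (weightE hJS za) -wJS bev bJ mulr0 add0r.
have m0 : m = 0%N /\ d%:~R = - (-1) ^+ e :> C.
  case: (key bE d) => // dm.
  have : (m.+1)%:R = 1 :> C.
    have : `|(- d%:~R : C)| = 1 by rewrite normrN; case: d1 => ->; rewrite ?normrN normr1.
    by rewrite dm normrM normr_sign mul1r normr_nat.
  move=> m1; move: dm; rewrite m1 mulr1 => /eqP; rewrite eqr_oppLR => /eqP ->; split=> //.
  by apply/eqP; rewrite -eqSS -(eqr_nat C) m1.
case: m0 => m0 dE; have zE : z \in E 0.
  by apply: weight_in za _; rewrite aE m0 mulr0 oppr0.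
have zJ : ev alpha JS = 0.
  have := JSc zE; rewrite (weightE hJS za) => /eqP.
  by rewrite scaler_eq0 (negPf z0) orbF => /eqP.
rewrite (br_anti brL); apply: annihN; apply: annih_br => //; first exact: gz0.
apply: gy => //; apply/(jspaceP ES JS gsL); split.
  by apply: weight_in yb _; rewrite scale_lfunE bE dE; apply: mulrN1.
by rewrite (weightE hJS yb) -wJS bev zJ addr0 scale_lfunE.
Qed.

Let D_span (e : bool) n : (D e n <= vsp [set x | x \in D e n /\
  exists alpha : dual, weight_space br alpha x])%VS.
Proof.
apply: (ad_weight_span gsL no_abelian_ideal hC) => x v hx /(degreeP brL) vn.
apply/(degreeP brL); rewrite (br_jacobi brL) vn (actZr adm).
rewrite (h_comm gsL no_abelian_ideal hC _ hx) ?(act0l adm) ?add0r //.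
by rewrite memvZ // subvsP.
Qed.

Lemma good_span (e : bool) n : (D e n.+1%:Z <= vsp [set x | [/\ exists alpha : dual,
  weight_space br alpha x, x \in D e n.+1%:Z & good x]])%VS.
Proof.
elim: n => [|n IHn].
  apply: (subv_trans (D_span e 1)); apply: vsp_sub => x [x1 [alpha xa]].
  have [->|x0] := eqVneq x 0; first exact: mem0v.
  apply: mem_vsp; split=> //; first by exists alpha.
  have [b bB ab] := height_degree1 gsL no_abelian_ideal hC x0 xa x1.
  by apply: (good_simple bB (e := e)); rewrite -ab.
apply: (subv_trans (height_generation gsL no_abelian_ideal hC sB e n.+1)).
set W := vsp _; apply: bracket_sub => y z y1 zn.
have sW u : subspace [set y | br y u \in W].
  split=> [|a p q /= pW qW]; first by rewrite /= (act0l adm) mem0v.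
  by rewrite (actPl adm) memvD ?memvZ.
apply: (vsp_ind (sW z) _ (subvP (D_span e 1) _ y1)) => {y1}y [y1 [beta yb]] /=.
apply: (vsp_ind (subspace_act adm y W) _ (subvP IHn _ zn)) => {zn}z [[alpha za] zn gz] /=.
have [->|y0] := eqVneq y 0; first by rewrite (act0l adm) mem0v.
have [b bB bE] := height_degree1 gsL no_abelian_ideal hC y0 yb y1.
rewrite bE in yb; apply: mem_vsp; split.
- by exists ((-1) ^+ e *: b + alpha); apply: (weight_act adm adm yb za).
- by apply: (degree_br_to brL _ y1 zn).
- exact: (good_step bB yb za zn gz).
Qed.

Lemma good_all x : x \in vsp [set x | (exists alpha : dual, weight_space br alpha x) /\ good x].
Proof.
set W := vsp _.
apply: (root_ind gsL no_abelian_ideal hC (Q := [set` W])); first exact: subspace_vspace.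
move=> alpha w wa /=; have [->|w0] := eqVneq w 0; first exact: mem0v.
have [hw|[e [n [k [_ wn _]]]]] := root_height gsL hC sB w0 wa.
  by apply: mem_vsp; split; [exists alpha | exact: good_h].
move: w wn {wa w0}; apply/subvP; apply: (subv_trans (good_span e n)).
by apply: vsp_sub => w [wa _ gw]; apply: mem_vsp.
Qed.

Let proj_weight (y : s) k w (alpha : dual) : y \in h -> weight_space br alpha w ->
  genproj (op br y) k w = if ev alpha y == k then w else 0.
Proof.
move=> hy wa; have fw : gen_eigen (op br y) (ev alpha y) w.
  by apply: eigen_gen_eigen; rewrite (opE adm) (weightE hy wa).
case: eqP => [<-|/eqP ak]; first by rewrite genproj_id.
by rewrite (genproj_out fw) // eq_sym.
Qed.

Lemma degree0_pres x : x \in E 0 -> pres x.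
Proof.
move=> x0; pose f := genproj (op br ES) 0.
have fx : f x = x.
  apply: genproj_id; apply: eigen_gen_eigen; rewrite (opE adm).
  by move/(degreeP brL): x0 => ->.
rewrite -fx; apply: (vsp_ind (Q := [set x | pres (f x)])) (good_all x).
  exact: (subspace_ker f pres_subspace).
move=> w [[alpha wa] [gw _]] /=; rewrite /f (proj_weight _ hES wa).
case: eqP => [aE|_]; last by case: pres_subspace.
exact/gw/(weight_in wa).
Qed.

Lemma jspace_annih d f x : d = 1 \/ d = -1 -> isI f -> x \in jspace d f -> annih d f x.
Proof.
move=> d1 If /(jspaceP ES JS gsL)[xd xf].
pose q := (genproj (op br JS) f \o genproj (op br ES) d%:~R)%VF.
have dx : genproj (op br ES) d%:~R x = x.
  apply: genproj_id; apply: eigen_gen_eigen; rewrite (opE adm).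
  by move/(degreeP brL): xd => ->.
have qx : q x = x.
  rewrite comp_lfunE dx; apply: genproj_id; apply: eigen_gen_eigen.
  by rewrite (opE adm).
rewrite -qx; apply: (vsp_ind (Q := [set x | annih d f (q x)])) (good_all x).
  exact: (subspace_ker q (annih_subspace d f)).
move=> w [[alpha wa] [_ gw]] /=; rewrite comp_lfunE (proj_weight _ hES wa).
have z0 : annih d f 0 by case: (annih_subspace d f).
case: eqP => [aE|_]; last by rewrite linear0.
rewrite (proj_weight _ hJS wa); case: eqP => [aJ|_] //.
apply: gw => //; apply/(jspaceP ES JS gsL); split; first exact: weight_in aE.
by rewrite (weightE hJS wa) aJ.
Qed.

Theorem partition_scalar : exists c0, scalar_cond JS gsL ESd glM irr c0.
Proof.
have Ld : (L (-1) <= Lj 'i + Lj (- 'i))%VS.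
  have hL x w : x \in h -> w \in L (-1) -> act x w \in L (-1).
    by move=> /(h_degree0 gsL no_abelian_ideal hC hES) x0 w0; apply: actE x0 w0.
  apply: (subv_trans (act_weight_span gsL no_abelian_ideal glM irr hC hL)).
  apply: vsp_sub => v [v1 [lam vl]]; have [->|v0] := eqVneq v 0; first exact: mem0v.
  have in1 : weights_in act gl (-1) lam.
    apply/(weights_inP gsL ESd glM irr hES); split; first exact: (weights_intro v0 vl).
    exact: (grade_weight hES v0 vl v1).
  case: (Pe_all in1) => Pl.
    by apply: (subvP (addvSl _ _)); apply: mem_Lpart Pl vl.
  by apply: (subvP (addvSr _ _)); apply: mem_Lpart Pl vl.
apply: (scalar_of_splitting no_abelian_ideal trans JS0 JS2 JScomm Lpart_sub Ld) => //.
- by move=> e x v Ie x0; apply: degree0_pres.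
- by move=> e x v Ie /(jspace_annih (or_intror erefl) Ie)[xe _]; apply: xe.
- by move=> e x v Ie /(jspace_annih (or_intror erefl) Ie)[_ xe]; apply: xe.
- by move=> e x v Ie /(jspace_annih (or_introl erefl) Ie)[xe _]; apply: xe.
Qed.

End PartitionScalar.

(** * Partial Levi-Tanaka extensions *)

Section CRScalar.
Variables (C : numClosedFieldType) (s l : vectType C).
Variables (br : s -> s -> s) (gs : int -> set s) (act : s -> l -> l) (gl : int -> set l).
Variables (ES JS : s) (h : {vspace s}).
Hypothesis gsL : graded_lie_algebra br gs.
Hypothesis no_abelian_ideal : without_abelian_ideal br.
Hypothesis trans : transitive_gr gs br gs.
Hypothesis ESd : forall p X, gs p X -> br ES X = p%:~R *: X.
Hypothesis glM : graded_module br gs act gl.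
Hypothesis irr : lie_irreducible act.
Hypothesis JS0 : gs 0 JS.
Hypothesis JS2 : forall X, gs (-1) X -> br JS (br JS X) = - X.
Hypothesis JScomm : forall A X, gs 0 A -> gs (-1) X -> br A (br JS X) = br JS (br A X).
Hypothesis hC : cartan_subalgebra br [set` h].
Hypothesis hES : ES \in h.
Local Notation dual := 'Hom(subvs_of h, C^o).

Let brL : lie_algebra br. Proof. by case: gsL. Qed.
Let adm : lie_module br br := adM brL.
Let actM : lie_module br act. Proof. by case: glM. Qed.
Local Notation E := (degree_space br ES).
Local Notation L := (grade gsL ESd glM irr).
Local Notation c := (degree_shift gsL ESd glM irr).
Local Notation ev lam x := ((lam : dual) (vsproj h x)).
Local Notation jspace := (jspace br ES JS).

Hypothesis L1 : L (-1) <> 0%VS.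
Variable J' : l -> l.
Hypothesis J'1 : forall v, v \in L (-1) -> J' v \in L (-1).
Hypothesis J'lin : forall a u v, u \in L (-1) -> v \in L (-1) ->
  J' (a *: u + v) = a *: J' u + J' v.
Hypothesis J'2 : forall v, v \in L (-1) -> J' (J' v) = - v.
Hypothesis J'br : forall x v, x \in E (-1) -> v \in L (-1) -> act (br JS x) (J' v) = act x v.
Hypothesis J'0 : forall x v, x \in E 0 -> v \in L (-1) -> act x (J' v) = J' (act x v).
Hypothesis J'img : forall x v, x \in E (-1) -> v \in L 0 -> J' (act x v) = act (br JS x) v.

Let hJS : JS \in h.
Proof. exact: (JS_cartan gsL no_abelian_ideal trans ESd JS0 JScomm hC hES). Qed.

Let actE p q m x v : p + q = m -> x \in E p -> v \in L q -> act x v \in L m.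
Proof. exact: act_grade. Qed.

Let h0 x : x \in h -> x \in E 0.
Proof. exact: (h_degree0 gsL no_abelian_ideal hC hES). Qed.

Let Jset e : set l := [set v | v \in L (-1) /\ J' v = e *: v].

Let JsetS e : subspace (Jset e).
Proof.
have J'00 : J' 0 = 0.
  by have := J'lin (-1) (mem0v (L (-1))) (mem0v _); rewrite scaler0 addr0 scaleN1r addNr.
split=> [|a u v [u1 uJ] [v1 vJ]]; first by split; rewrite ?mem0v // J'00 scaler0.
split; first by rewrite memvD ?memvZ.
by rewrite J'lin // uJ vJ scalerDr !scalerA mulrC.
Qed.

Let Lj e := vsp (Jset e).
Let LjP e v : v \in Lj e <-> v \in L (-1) /\ J' v = e *: v.
Proof. exact: vspP. Qed.

Let Lj_st e x v : isI e -> x \in E 0 -> v \in Lj e -> act x v \in Lj e.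
Proof.
move=> _ x0 /LjP[v1 vJ]; apply/LjP; split; first by apply: actE x0 v1.
by rewrite -J'0 // vJ (actZr actM).
Qed.

(** On eigenvectors for the same [e], the compatibility of the two complex structures multiplies
    [act x v] by [e * e = -1] without changing it. *)
Let Lj_ker e x v : isI e -> x \in jspace (-1) e -> v \in Lj e -> act x v = 0.
Proof.
move=> Ie /(jspaceP ES JS gsL)[x1 xe] /LjP[v1 vJ]; have := J'br x1 v1.
rewrite xe vJ (actZl actM) (actZr actM) scalerA (isI_sqr Ie) scaleN1r => /eqP.
by rewrite eq_sym -addr_eq0 -mulr2n -scaler_nat scaler_eq0 pnatr_eq0 => /eqP.
Qed.

Let Lj_img e x v : isI e -> x \in jspace (-1) e -> v \in L 0 -> act x v \in Lj e.
Proof.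
move=> Ie /(jspaceP ES JS gsL)[x1 xe] v0; apply/LjP; split; first by apply: actE x1 v0.
by rewrite J'img // xe (actZl actM).
Qed.

Let Lj_disj e v : isI e -> v \in Lj e -> v \in Lj (- e) -> v = 0.
Proof.
move=> Ie /LjP[v1 vJ] /LjP[_]; rewrite vJ => /eqP.
rewrite -subr_eq0 -scalerBl opprK scaler_eq0 (negPf (double_neq0 Ie)) => /eqP.
by [].
Qed.

(* If [act z v] is not zero, for weight vectors [z] and [v], the root string through
   the weight of [v] puts [v] in the image of [l_0], hence in the other eigenspace. *)
Let Lj_ker1 e z v : isI e -> z \in jspace 1 e -> v \in Lj e -> act z v = 0.
Proof.
move=> Ie ze ve.
have sz u : subspace [set z | act z u = 0].
  split=> [|a x y /= x0 y0]; first by rewrite /= (act0l actM).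
  by rewrite (actPl actM) x0 y0 scaler0 addr0.
have sv x : subspace [set u | act x u = 0].
  split=> [|a u w /= u0 w0]; first by rewrite /= (act0r actM).
  by rewrite (actPr actM) u0 w0 scaler0 addr0.
have hz x w : x \in h -> w \in jspace 1 e -> br x w \in jspace 1 e.
  move=> hx /(jspaceP ES JS gsL)[w1 we]; apply/(jspaceP ES JS gsL); split.
    by apply: (degree_br_to brL _ (h0 hx) w1); rewrite add0r.
  rewrite (br_jacobi brL) (h_comm gsL no_abelian_ideal hC hJS hx) (act0l adm) add0r.
  by rewrite we (actZr adm).
apply: (vsp_ind (sz v) _ (subvP (ad_weight_span gsL no_abelian_ideal hC hz) _ ze)).
move=> {ze}z [ze [gam zg]] /=.
have hv x w : x \in h -> w \in Lj e -> act x w \in Lj e by move=> /h0; apply: Lj_st.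
apply: (vsp_ind (sv z) _ (subvP (act_weight_span gsL no_abelian_ideal glM irr hC hv) _ ve)).
move=> {ve}v [ve [lam vl]] /=; apply/eqP; apply: contrapT => /negP n0.
have z0 : z != 0 by apply: contraNneq n0 => ->; rewrite (act0l actM).
have v0 : v != 0 by apply: contraNneq n0 => ->; rewrite (act0r actM).
have [x xg kzx] := root_pairing gsL no_abelian_ideal hC z0 zg.
have /(jspaceP ES JS gsL)[z1 zJ] := ze.
have gES := degree_root gsL hES z0 zg z1.
have gJS : ev gam JS = e by apply: (scaler_inj z0); rewrite -(weightE hJS zg).
have bES : ev (- gam) ES = -1 by rewrite opp_lfunE gES.
have x1 : x \in E (-1) by apply: (root_degree gsL hES xg); rewrite bES.
have xe : x \in jspace (-1) (- e).
  apply/(jspaceP ES JS gsL); split=> //.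
  by rewrite (weightE hJS xg) opp_lfunE gJS.
have zg' : weight_space br (- - gam) z by rewrite opprK.
have kxz : killing br x z != 0 by rewrite killingC.
have v1 : v \in L (-1) by case/LjP: ve.
have lES : ev lam ES = -1 + c by exact: (grade_weight hES v0 vl v1).
have nuL w : weight_space act (lam - - gam) w -> w \in L 0.
  move=> wnu; apply: (weight_grade hES wnu).
  by rewrite add_lfunE opprK lES gES addrAC addNr.
(* [x] maps degree 0 into the [- e] eigenspace, which it annihilates. *)
have XX0 w : weight_space act (lam - - gam) w -> act x (act x w) = 0.
  move=> /nuL w_0; exact: (Lj_ker (isIN Ie) xe (Lj_img (isIN Ie) xe w_0)).
have zv : weight_space act (lam - - gam) (act z v).
  by rewrite opprK addrC; apply: (weight_act actM adm zg vl).
have := string_onto no_abelian_ideal hC hES xg zg' kxz bES lES XX0 n0 zv vl.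
move=> vx; case/eqP: v0; apply: (Lj_disj Ie ve).
move: v vx {ve vl n0 v1 zv}; apply/subvP; apply: vsp_sub => _ [w /nuL w_0 <-].
exact: (Lj_img (isIN Ie) xe w_0).
Qed.

Theorem CR_scalar : exists c0, scalar_cond JS gsL ESd glM irr c0.
Proof.
have Ls e : isI e -> (Lj e <= L (-1))%VS by move=> _; apply/subvP => v /LjP[].
have Ld : (L (-1) <= Lj 'i + Lj (- 'i))%VS.
  apply/subvP => v v1; have Jv1 := J'1 v1.
  have Ii : @isI C 'i by left.
  have -> : v = 2^-1 *: (- 'i *: J' v + v) + 2^-1 *: ('i *: J' v + v).
    rewrite -scalerDr addrACA scaleNr addNr add0r -mulr2n -scaler_nat scalerA.
    by rewrite mulVf ?scale1r // pnatr_eq0.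
  have main e : isI e -> 2^-1 *: (- e *: J' v + v) \in Lj e.
    move=> Ie; apply/memvZ/LjP; split; first by rewrite memvD ?memvZ.
    rewrite J'lin // J'2 // scaleNr scalerN opprK scalerDr scalerA mulrN (isI_sqr Ie).
    by rewrite opprK scale1r addrC.
  by apply: memv_add; [exact: main | have := main _ (isIN Ii); rewrite opprK].
exact: (scalar_of_splitting no_abelian_ideal trans JS0 JS2 JScomm Ls Ld Lj_st Lj_ker Lj_img Lj_ker1 L1).
Qed.

End CRScalar.

(** * The Abelian extension as a graded Lie algebra *)

Section Extension.
Variables (F : fieldType) (g M : lmodType F).
Variables (br : g -> g -> g) (gs : int -> set g) (act : g -> M -> M) (gl : int -> set M).

Lemma pair_ext (U V : Type) (u v : U * V) : u.1 = v.1 -> u.2 = v.2 -> u = v.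
Proof. by case: u v => u1 u2 [v1 v2] /= -> ->. Qed.

Lemma sum_fst (U V : lmodType F) (I : Type) (r : seq I) (f : I -> U * V) :
  (\sum_(i <- r) f i).1 = \sum_(i <- r) (f i).1.
Proof. by elim/big_rec2: _ => //= i x y _ <-. Qed.

Lemma sum_snd (U V : lmodType F) (I : Type) (r : seq I) (f : I -> U * V) :
  (\sum_(i <- r) f i).2 = \sum_(i <- r) (f i).2.
Proof. by elim/big_rec2: _ => //= i x y _ <-. Qed.

(** A decomposition may list a degree several times; multiplicities bring two decompositions to a
    common list without repetition. *)
Lemma sum_count (V : lmodType F) (r r' : seq int) (y : int -> V) : uniq r' ->
  {subset r <= r'} -> \sum_(p <- r) y p = \sum_(p <- r') y p *+ count_mem p r.
Proof.
move=> ur'; elim: r => [|a r IHr] sr.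
  by rewrite big_nil big1 // => p _; rewrite mulr0n.
rewrite big_cons IHr => [|p rp]; last by apply: sr; rewrite inE rp orbT.
under [RHS]eq_bigr => p _ do rewrite /= mulrnDr.
rewrite big_split /=; congr (_ + _).
rewrite (bigD1_seq a) ?sr ?mem_head //= eqxx mulr1n big1 ?addr0 // => p pa.
by rewrite eq_sym (negPf pa).
Qed.

Lemma ext_gradation : gradation gs -> gradation gl -> gradation (ext_grading gs gl).
Proof.
move=> [gsS gsE gsU] [glS glE glU]; split.
- move=> p; have [s0 sD] := gsS p; have [l0 lD] := glS p.
  by split=> [|a x y [x1 x2] [y1 y2]]; split=> //=; [exact: sD | exact: lD].
- move=> [x v]; have [r1 [y1 [y1P ->]]] := gsE x; have [r2 [y2 [y2P ->]]] := glE v.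
  pose r := undup (r1 ++ r2); have ur : uniq r by apply: undup_uniq.
  exists r, (fun p => (y1 p *+ count_mem p r1, y2 p *+ count_mem p r2)); split.
    by move=> p; split; rewrite /= -scaler_nat; apply: subspaceZ.
  rewrite (sum_count (r := r1) y1 ur) => [|p rp]; last by rewrite mem_undup mem_cat rp.
  rewrite (sum_count (r := r2) y2 ur) => [|p rp]; last by rewrite mem_undup mem_cat rp orbT.
  by apply: pair_ext; rewrite ?sum_fst ?sum_snd.
move=> r y ur yP y0 p pr; rewrite [y p]surjective_pairing.
rewrite (gsU r (fun p => (y p).1)) // => [|q|]; first last.
- by rewrite -sum_fst y0.
- by case: (yP q).
rewrite (glU r (fun p => (y p).2)) // => [q|]; last by rewrite -sum_snd y0.
by case: (yP q).
Qed.

Lemma ext_lie_algebra : lie_algebra br -> lie_module br act ->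
  lie_algebra (ext_bracket br act).
Proof.
move=> [brr brl brx jac] [ar al ab].
have act0 x : act x 0 = 0.
  by have := ar x (-1) 0 0; rewrite scaler0 addr0 scaleN1r addNr.
split=> [[x v] a [y u] [z w]|[x v] a [y u] [z w]|[x v]|[x v] [y u] [z w]];
  rewrite /ext_bracket /=; apply: pair_ext => //=.
- by rewrite brr.
- by rewrite ar al scalerBr opprD addrACA.
- by rewrite brl.
- by rewrite ar al scalerBr opprD addrACA.
- by rewrite subrr.
have actB t : {morph act t : p q / p - q}.
  by move=> p q; rewrite -scaleN1r addrC ar scaleN1r addrC.
rewrite !actB !ab !opprB.
have E (a b c d e f : M) : a - b + (d - c) + (c - e + (b - f)) + (f - d + (e - a)) = 0.
  rewrite !addrA (ACl ((1*12)*(2*7)*(3*10)*(4*5)*(6*11)*(8*9))) /=.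
  by rewrite !(addNr, subrr, addr0).
exact: E.
Qed.

End Extension.

Section BracketSpan.
Variables (F : fieldType) (g M : lmodType F) (act : g -> M -> M).
Variables (A : set g) (U : set M).

Lemma bracket_span_mem X Y : A X -> U Y -> bracket_span act A U (act X Y).
Proof.
move=> AX UY; exists 1%N, (fun=> 1), (fun=> X), (fun=> Y).
by split=> //; rewrite big_ord1 scale1r.
Qed.

Lemma bracket_span_subspace : subspace (bracket_span act A U).
Proof.
split.
  have f0 T : 'I_0 -> T by case.
  by exists 0%N, (fun=> 0), (f0 g), (f0 M); split=> [[]|[]|] //; rewrite big_ord0.
move=> a _ _ [n [c [X [Y [AX UY ->]]]]] [m [d [X' [Y' [AX' UY' ->]]]]].
pose sel T (f : 'I_n -> T) (f' : 'I_m -> T) (i : 'I_(n + m)) :=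
  match split i with inl j => f j | inr k => f' k end.
have selL T (f : 'I_n -> T) (f' : 'I_m -> T) j : sel T f f' (lshift m j) = f j.
  by rewrite /sel (unsplitK (inl _)).
have selR T (f : 'I_n -> T) (f' : 'I_m -> T) j : sel T f f' (rshift n j) = f' j.
  by rewrite /sel (unsplitK (inr _)).
exists (n + m)%N, (sel _ (fun i => a * c i) d), (sel _ X X'), (sel _ Y Y').
split=> [i|i|]; first 1 [by rewrite /sel; case: (split i)|by rewrite /sel; case: (split i)|].
rewrite big_split_ord scaler_sumr; congr (_ + _); apply: eq_bigr => i _.
  by rewrite !selL scalerA.
by rewrite !selR.
Qed.

End BracketSpan.

(** * Restriction of the base field to the real numbers *)

Section Realification.
Variable R : realType.
Local Notation C := R[i].

Lemma realified_scale (V : lmodType C) (a : R) (x : realified V) :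
  a *: x = (a%:C%C : C) *: (x : V).
Proof. by []. Qed.

Lemma realified_subspace (V : lmodType C) (U : set V) :
  subspace U -> @subspace R (realified V) U.
Proof. by move=> [U0 UD]; split=> // a x y; apply: UD. Qed.

Lemma realified_gradation (V : lmodType C) (gr : int -> set V) :
  gradation gr -> @gradation R (realified V) gr.
Proof. by move=> [gS gE gU]; split=> // p; apply/realified_subspace. Qed.

Lemma realified_linear (U V : lmodType C) (f : U -> V) : linear f ->
  linear (f : realified U -> realified V).
Proof. by move=> lf a x y; rewrite !realified_scale; apply: lf. Qed.

Lemma realified_lie_algebra (g : lmodType C) (br : g -> g -> g) :
  lie_algebra br -> @lie_algebra R (realified g) br.
Proof.
by move=> [brr brl brx jac]; split=> // x; apply: realified_linear; [apply: brr | apply: brl].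
Qed.

Lemma realified_lie_module (g M : lmodType C) (br : g -> g -> g) (act : g -> M -> M) :
  lie_module br act -> @lie_module R (realified g) (realified M) br act.
Proof.
by move=> [ar al ab]; split=> // x; apply: realified_linear; [apply: ar | apply: al].
Qed.

Lemma realified_graded_module (g M : lmodType C) (br : g -> g -> g) (gs : int -> set g)
    (act : g -> M -> M) (gl : int -> set M) : graded_module br gs act gl ->
  @graded_module R (realified g) (realified M) br gs act gl.
Proof.
move=> [actM glG actD]; split=> //; first exact: realified_lie_module.
exact: realified_gradation.
Qed.

(** A complex abelian ideal is also a real ideal, and the first term of its derived series is
    zero. *)
Lemma semisimple_no_abelian_ideal (g : vectType C) (br : g -> g -> g) :
  @lie_semisimple R (realified g) br ->
  without_abelian_ideal br.
Proof.
move=> ss I Ibr Iab; apply/eqP; rewrite -subv0; apply/subvP => x Ix; rewrite memv0.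
apply/eqP; apply: (ss [set` I]) => //.
  split=> //; first exact: realified_subspace (subspace_vspace I).
exists 1%N => _ [n [c [X [Y [IX IY ->]]]]] /=.
by apply: big1 => i _; rewrite Iab ?scaler0 //; [apply: IX | apply: IY].
Qed.

End Realification.

Section ComplexType.
Variables (R : realType) (s l : vectType R[i]).
Variables (br : s -> s -> s) (gs : int -> set s) (J : s -> s).
Variables (act : s -> l -> l) (gl : int -> set l) (ES JS : s).
Hypothesis gsL : graded_lie_algebra br gs.
Hypothesis sCR : @graded_CR_algebra R (realified s) br gs J.
Hypothesis fund : @fundamental_gr R (realified s) (realified s) gs br gs.
Hypothesis no_abelian_ideal : without_abelian_ideal br.
Hypothesis trans : transitive_gr gs br gs.
Hypothesis ESd : forall p X, gs p X -> br ES X = p%:~R *: X.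
Hypothesis glM : graded_module br gs act gl.
Hypothesis irr : lie_irreducible act.
Hypothesis JS0 : gs 0 JS.
Hypothesis JSJ : forall X, gs (-1) X -> br JS X = J X.

Let brL : lie_algebra br. Proof. by case: gsL. Qed.
Let adm : lie_module br br := adM brL.
Let actM : lie_module br act. Proof. by case: glM. Qed.
Local Notation E := (degree_space br ES).
Local Notation L := (grade gsL ESd glM irr).
Local Notation lP := (glP gsL ESd glM irr).
Local Notation sP := (gsP gsL ESd).

Let gs0 p : gs p 0. Proof. by apply/sP; rewrite mem0v. Qed.
Let gl0 p : gl p 0. Proof. by apply/lP; rewrite mem0v. Qed.

Let J1 X : gs (-1) X -> gs (-1) (J X).
Proof. by case: sCR => _ [J1 _ _ _ _]; apply: J1. Qed.

Let JK X : gs (-1) X -> J (J X) = - X.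
Proof. by case: sCR => _ [_ _ JK _ _]; apply: JK. Qed.

Lemma CR_JS2 X : gs (-1) X -> br JS (br JS X) = - X.
Proof. by move=> X1; rewrite (JSJ X1) (JSJ (J1 X1)) JK. Qed.

Lemma CR_JScomm A X : gs 0 A -> gs (-1) X -> br A (br JS X) = br JS (br A X).
Proof.
move=> A0 X1; have AX1 : gs (-1) (br A X) by case: gsL => _ _ brG; apply: (brG 0 (-1)).
by rewrite (JSJ X1) (JSJ AX1); case: sCR => _ [_ _ _ _ Jc]; apply: Jc.
Qed.

Let J0 : J 0 = 0. Proof. by rewrite -JSJ // (act0r adm). Qed.

Let JN X : gs (-1) X -> J (- X) = - J X.
Proof.
move=> X1; rewrite -!JSJ ?(actNr adm) //.
by apply/sP; rewrite memvN; apply/sP.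
Qed.

Section ToScalar.
Variable h : {vspace s}.
Hypothesis hC : cartan_subalgebra br [set` h].
Hypothesis hES : ES \in h.
Hypothesis L1 : L (-1) <> 0%VS.

Lemma Levi_Tanaka_scalar : @partial_Levi_Tanaka R (realified s) (realified l) br gs J act gl ->
  exists c0, scalar_cond JS gsL ESd glM irr c0.
Proof.
move=> [_ _ [J' [_ [K1 K2 K3 K4 K5]]] _ ndeg].
have J'1 v : gl (-1) v -> gl (-1) (J' v).
  by move=> v1; have [] := K1 (0, v) (conj (gs0 _) v1).
have J'R (a : R) u v : gl (-1) u -> gl (-1) v ->
    J' ((a%:C%C : R[i]) *: u + v) = (a%:C%C : R[i]) *: J' u + J' v.
  by move=> u1 v1; case: (K2 a (0, u) (0, v) (conj (gs0 _) u1) (conj (gs0 _) v1)).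
have J'00 : J' 0 = 0.
  have := J'R (-1) _ _ (gl0 (-1)) (gl0 (-1)).
  by rewrite rmorphN1 scaler0 addr0 scaleN1r addNr.
have J'D u v : gl (-1) u -> gl (-1) v -> J' (u + v) = J' u + J' v.
  by move=> u1 v1; have := J'R 1 _ _ u1 v1; rewrite rmorph1 !scale1r.
have J'Z (a : R) u : gl (-1) u -> J' ((a%:C%C : R[i]) *: u) = (a%:C%C : R[i]) *: J' u.
  by move=> u1; have := J'R a _ _ u1 (gl0 (-1)); rewrite !addr0 J'00 addr0.
have J'2 v : gl (-1) v -> J' (J' v) = - v.
  by move=> v1; case: (K3 (0, v) (conj (gs0 _) v1)).
have J'br X v : gs (-1) X -> gl (-1) v -> act (J X) (J' v) = act X v.
  move=> X1 v1; have := K4 (X, 0) (0, v) (conj X1 (gl0 _)) (conj (gs0 _) v1).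
  by case=> _; rewrite /= J0 !(act0l actM) !subr0.
have J'0 A v : gs 0 A -> gl (-1) v -> act A (J' v) = J' (act A v).
  move=> A0 v1; have := K5 (A, 0) (0, v) (conj A0 (gl0 _)) (conj (gs0 _) v1).
  by case=> _; rewrite /= J0 !(act0l actM) !subr0.
have glZ p a v : gl p v -> gl p (a *: v) by move=> /lP vp; apply/lP; apply: memvZ.
have glD p u v : gl p u -> gl p v -> gl p (u + v).
  by move=> /lP up /lP vp; apply/lP; apply: memvD.
have J'N v : gl (-1) v -> J' (- v) = - J' v.
  by move=> v1; have := J'Z (-1) v v1; rewrite rmorphN1 !scaleN1r.
have actD p q m x v : p + q = m -> gs p x -> gl q v -> gl m (act x v).
  by move=> <-; case: glM => _ _; apply.
(* Degree 0 of the extension contains [l_0]: the axiom on degree 0, for [B] and [X], determines the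
   complex structure on the image of [l_0]. *)
have J'img X B : gs (-1) X -> gl 0 B -> J' (act X B) = act (J X) B.
  move=> X1 B0; have XB : gl (-1) (act X B) by apply: actD X1 B0.
  have := K5 (0, B) (X, 0) (conj (gs0 _) B0) (conj X1 (gl0 _)).
  by case=> _; rewrite /= J'00 !(act0l actM) !sub0r (J'N _ XB) => /oppr_inj.
(* [l_{-1}] is nondegenerate, and [s_{-1}] does not separate [J' (i v)] and [i J' v]. *)
have J'i v : gl (-1) v -> J' ('i%C *: v) = 'i%C *: J' v.
  move=> v1; apply/eqP; rewrite -subr_eq0; apply/eqP; apply: contrapT => d0.
  set d := J' _ - _ in d0.
  have d1 : gl (-1) d.
    by apply/lP/memvB; apply/lP; [apply/J'1/glZ | apply/glZ/J'1].
  have [|[X w] /= [X1 w1]] := ndeg (0, d) (conj (gs0 _) d1); first by case.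
  apply; apply: pair_ext; rewrite /= ?(act0r adm) // (act0l actM) subr0.
  (* [X] is the image of [- J X] under [J], so compatibility with the bracket trades [J'] for the
     action of [- J X], which is complex linear. *)
  have X1' : gs (-1) (- J X) by apply/sP; rewrite memvN; apply/sP/J1.
  have -> : act X d = act (J (- J X)) d by rewrite (JN (J1 X1)) (JK X1) opprK.
  rewrite /d (actBr actM) (actZr actM).
  by rewrite !J'br // ?(actZr actM) ?subrr //; apply: glZ.
have J'lin (a : R[i]) u v : gl (-1) u -> gl (-1) v -> J' (a *: u + v) = a *: J' u + J' v.
  move=> u1 v1; rewrite J'D //; last exact: glZ.
  congr (_ + _); rewrite [a]complexE !scalerDl J'D; [|exact: glZ|exact: glZ].
  rewrite (J'Z _ _ u1) -!scalerA J'i; last exact: glZ.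
  by rewrite (J'Z _ _ u1).
apply: (CR_scalar no_abelian_ideal trans JS0 CR_JS2 CR_JScomm hC hES L1 (J' := J')).
- by move=> v /lP v1; apply/lP/J'1.
- by move=> a u v /lP u1 /lP v1; apply: J'lin.
- by move=> v /lP v1; apply: J'2.
- by move=> x v /sP x1 /lP v1; rewrite JSJ // J'br.
- by move=> x v /sP x1 /lP v1; apply: J'0.
- by move=> x v /sP x1 /lP v1; rewrite JSJ // J'img.
Qed.

End ToScalar.

Section FromScalar.
Variable c0 : R[i].
Hypothesis L1 : L (-1) <> 0%VS.
Hypothesis L2 : L (-2) <> 0%VS.
Hypothesis sc : scalar_cond JS gsL ESd glM irr c0.
Hypothesis tck : @trivial_common_kernel R (realified s) (realified l) br gs act.

Let actD p q m x v : p + q = m -> gs p x -> gl q v -> gl m (act x v).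
Proof. by move=> <-; case: glM => _ _; apply. Qed.

Let singular p v : -2 < p -> gl p v -> (forall x, gs (-1) x -> act x v = 0) -> v = 0.
Proof.
move=> p2 /lP vp v0; apply: (singular_eq0 no_abelian_ideal trans p2 L2 vp) => x /sP.
exact: v0.
Qed.

Lemma scalar_transitive : transitive_gr gs act gl.
Proof.
move=> p v p0 vp v0; apply: contrapT => nx; apply: v0; apply: (singular _ vp).
  exact: lt_le_trans p0.
by move=> x x1; apply: contrapT => xv; apply: nx; exists x.
Qed.

(* If [act x] is zero on [l_{-1}], it is zero in the lower degrees, as [l] is fundamental,
   and in the higher ones, by transitivity. *)
Let faithful1 x : gs (-1) x -> (forall y, gs (-1) y -> br x y = 0) ->
  (forall v, gl (-1) v -> act x v = 0) -> x = 0.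
Proof.
move=> x1 xc xv; apply: (tck x1 xc) => v.
have sx : subspace [set v | act x v = 0].
  by split=> [|a u w /= u0 w0]; rewrite /= ?(act0r actM) // (actPr actM) u0 w0 scaler0 addr0.
have down (n : nat) w : w \in L (-1 - n%:Z) -> act x w = 0.
  elim: n w => [|n IHn] w; first by move=> /lP; apply: xv.
  move=> wn; have : w \in bracket_vs act (E (-1)) (L (-1 - n%:Z)).
    apply: (subvP (fundamental_grade no_abelian_ideal trans L1 _)); first by lia.
    by rewrite (_ : _ - 1 = -1 - n.+1%:Z) //; lia.
  move=> /(vsp_ind sx); apply=> _ [y /sP y1 [u un <-]] /=.
  by rewrite (actAC actM) xc // (act0l actM) add0r IHn // (act0r actM).
have up (n : nat) w : gl (-1 + n%:Z) w -> act x w = 0.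
  elim: n w => [|n IHn] w; first exact: xv.
  move=> wn; apply: (singular (p := -1 + n%:Z)); first by lia.
    by apply: actD x1 wn; lia.
  move=> y y1; rewrite (actAC actM) (br_anti brL) xc // oppr0 (act0l actM) add0r.
  by apply: IHn; apply: actD y1 wn; lia.
apply: (vsp_ind sx _ (grade_span gsL ESd glM irr v)) => w [p wp] /=.
have [p1|p1] := leP p (-1).
  by apply: (down (absz (-1 - p)%R)); rewrite (_ : -1 - _ = p) //; lia.
apply: (up (absz (p + 1)%R)); apply/lP; rewrite (_ : -1 + _ = p) //; lia.
Qed.

(** Brackets with [s_{-1}] and with [l_{-1}] are tested separately: [faithful1] removes the
    component in [s], and the component in [l], then annihilated by [s_{-1}], is zero by
    [singular]. *)
Lemma scalar_nondegenerate : @nondegenerate_gr R (realified s * realified l)%type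
  (realified s * realified l)%type (ext_grading gs gl) (ext_bracket br act) (ext_grading gs gl).
Proof.
move=> [x v] /= [x1 v1] xv0; apply: contrapT => nu; apply: xv0.
have br0 y w : gs (-1) y -> gl (-1) w -> br y x = 0 /\ act y v - act x w = 0.
  move=> y1 w1; apply: contrapT => n0; apply: nu; exists (y, w) => // -[??].
  by apply: n0.
have x0 : x = 0.
  apply: faithful1 => // [y y1|w w1].
    by rewrite (br_anti brL) (br0 _ _ y1 (gl0 _)).1 oppr0.
  have := (br0 _ _ (gs0 _) w1).2; rewrite (act0l actM) sub0r => /eqP.
  by rewrite oppr_eq0 => /eqP.
apply: pair_ext => //=; apply: (singular _ v1) => // y y1.
by have := (br0 _ _ y1 (gl0 _)).2; rewrite x0 (act0l actM) subr0.
Qed.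

Lemma scalar_fundamental : @fundamental_gr R (realified s * realified l)%type
  (realified s * realified l)%type (ext_grading gs gl) (ext_bracket br act) (ext_grading gs gl).
Proof.
move=> p p0; set S := bracket_span _ _ _.
have sS : subspace S by apply: bracket_span_subspace.
have extS x v y w : gs (-1) x -> gl (-1) v -> gs p y -> gl p w ->
    S (br x y, act x w - act y v).
  move=> x1 v1 yp wp; apply: (@bracket_span_mem R (realified s * realified l)%type (realified s * realified l)%type
    (ext_bracket br act) _ _ (x, v) (y, w)); by split.
apply/seteqP; split=> [[x v] [/= xp vp]|].
  rewrite (_ : (x, v) = (x : realified s, 0 : realified l) + (0, v)); last first.
    by apply: pair_ext; rewrite /= ?addr0 ?add0r.
  apply: (subspaceD sS).
    have : bracket_span (br : realified s -> realified s -> realified s) (gs (-1)) (gs p) x.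
      by rewrite -fund.
    move=> [n [c [X [Y [X1 Yp ->]]]]].
    rewrite (_ : (_, 0) = \sum_(i < n) c i *: (br (X i) (Y i) : realified s, 0 : realified l)).
      apply: subspace_sum => // i _; apply: subspaceZ => //.
      have := extS _ _ _ _ (X1 i) (gl0 _) (Yp i) (gl0 _).
      by rewrite !(act0r actM) subr0.
    apply: pair_ext; rewrite ?sum_fst ?sum_snd //=.
    by rewrite big1 // => i _; rewrite scaler0.
  have vb : v \in bracket_vs act (E (-1)) (L p).
    by apply: (subvP (fundamental_grade no_abelian_ideal trans L1 p0)); apply/lP.
  (* The span [S] is only real. A complex coefficient is absorbed into the factor from [s_{-1}], a
     complex subspace; claiming all complex multiples at once makes the property complex linear. *)
  have : forall a : R[i], S (0, a *: v).
    apply: (vsp_ind (Q := [set v | forall a : R[i], S (0, a *: v)])) vb.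
      split=> [a|a u w /= uS wS b]; first by rewrite /= scaler0; case: sS.
      have := subspaceD sS (uS (b * a)) (wS b).
      by congr S; apply: pair_ext => /=; rewrite ?addr0 // scalerDr scalerA.
    move=> _ [x' /sP x1 [u /lP up <-]] a /=.
    have ax1 : gs (-1) (a *: x') by apply/sP/memvZ/sP.
    have := extS _ _ _ _ ax1 (gl0 _) (gs0 _) up.
    by rewrite (act0r adm) (act0l actM) subr0 (actZl actM).
  by move=> /(_ 1); rewrite scale1r.
move=> _ [n [c [X [Y [X1 Yp ->]]]]].
have [[_ gsG brD] [_ glG _]] := (gsL, glM).
have [eS _ _] := ext_gradation (realified_gradation gsG) (realified_gradation glG).
apply: (@subspace_sum R (realified s * realified l)%type _ _ _ _ _ (eS (p - 1))) => i _; apply: (subspaceZ _ (eS _)).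
have [[x1 v1] [yp wp]] := (X1 i, Yp i); split; rewrite /= addrC; first exact: brD.
apply/lP/memvB; apply/lP; first exact: actD x1 wp.
by apply: actD yp v1; rewrite addrC.
Qed.

Local Notation J' := (fun v : l => act JS v - c0 *: v).

(** An element of [jspace (-1) e] contributes the factor [e] through [J] and [- e] through [J'],
    with product 1. That [J'] commutes with the part of degree 0 coming from [l_0] means that [JS]
    acts on it by [c0]. *)
Lemma scalar_CR_module : @CR_module R (realified s) (realified l) br gs J act gl.
Proof.
have J'lin (a : R[i]) u v : J' (a *: u + v) = a *: J' u + J' v.
  by rewrite (actPr actM) scalerBr !scalerDr !scalerA mulrC opprD addrACA.
have [_ [_ Jlin _ Jbr Jcomm]] := sCR.
have actJ x v : gs (-1) x -> gl (-1) v -> act (J x) (J' v) = act x v.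
  move=> /sP x1 /lP v1; rewrite -JSJ; last exact/sP.
  have Ii : @isI R[i] 'i by left.
  have [|y [z [ye ze ->]]] := jspace_dec gsL trans ESd JS0 CR_JS2 CR_JScomm Ii _ x1; first by right.
  have main e w : isI e -> w \in jspace br ES JS (-1) e -> act (br JS w) (J' v) = act w v.
    move=> Ie we; have [_ ->] := (jspaceP ES JS gsL (-1) e w).1 we.
    rewrite (actZl actM) (scalar_jspace sc we v1) scalerA mulrN (isI_sqr Ie) opprK.
    by rewrite scale1r.
  by rewrite (actDr adm) !(actDl actM) (main _ _ Ii ye) (main _ _ (isIN Ii) ze).
exists J'; split.
  have [[_ gsG brD] [_ glG _]] := (gsL, glM).
  split.
  - by apply: ext_lie_algebra; [apply: realified_lie_algebra | apply: realified_lie_module].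
  - by apply: ext_gradation; apply: realified_gradation.
  - move=> p q [x v] [y w] [/= xp vp] [/= yq wq]; split; first exact: brD.
    by apply/lP/memvB; apply/lP; [apply: actD xp wq | apply: actD yq vp; rewrite addrC].
have J'1 v : gl (-1) v -> gl (-1) (J' v).
  move=> v1; apply/lP/memvB; last exact/memvZ/lP.
  by apply/lP; apply: actD JS0 v1.
split.
- by move=> [x v] [x1 v1]; split; [apply: J1 | apply: J'1].
- move=> a [x v] [y w] [/= x1 v1] [/= y1 w1]; apply: pair_ext => /=; first exact: Jlin.
  exact: J'lin.
- move=> [x v] [/= x1 v1]; apply: pair_ext => /=; first exact: JK.
  by apply: (scalar_sqr no_abelian_ideal trans JS0 CR_JS2 CR_JScomm L2 sc); apply/lP.
- move=> [x v] [y w] [/= x1 v1] [/= y1 w1]; apply: pair_ext => /=; first exact: Jbr.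
  by rewrite !actJ.
move=> [a b] [x v] [/= a0 b0] [/= x1 v1]; apply: pair_ext => /=; first exact: Jcomm.
have Ja : act JS (act a v) = act a (act JS v).
  rewrite (actAC actM) (JS_central gsL trans ESd JS0 CR_JScomm) ?(act0l actM) ?add0r //.
  exact/sP.
have Jb : act JS b = c0 *: b by apply: (sc (or_introl erefl)); apply/lP.
rewrite !(actBr actM) Ja (actAC actM JS) Jb !(actZr actM) scalerBr JSJ //.
by rewrite opprD opprB !addrA subrK addrAC.
Qed.

Lemma scalar_Levi_Tanaka : @partial_Levi_Tanaka R (realified s) (realified l) br gs J act gl.
Proof.
split; first exact: realified_graded_module.
- exact: scalar_transitive.
- exact: scalar_CR_module.
- exact: scalar_fundamental.
- exact: scalar_nondegenerate.
Qed.

End FromScalar.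

End ComplexType.

Lemma CR_partition_scalar (C : numClosedFieldType) (s l : vectType C)
    (br : s -> s -> s) (gs : int -> set s) (act : s -> l -> l) (gl : int -> set l)
    (ES JS : s) (h : {vspace s}) (B : seq 'Hom(subvs_of h, C^o))
    (gsL : graded_lie_algebra br gs) (ESd : forall p X, gs p X -> br ES X = p%:~R *: X)
    (glM : graded_module br gs act gl) (irr : lie_irreducible act) :
  without_abelian_ideal br ->
  transitive_gr gs br gs -> gs 0 JS ->
  (forall X, gs (-1) X -> br JS (br JS X) = - X) ->
  (forall A X, gs 0 A -> gs (-1) X -> br A (br JS X) = br JS (br A X)) ->
  cartan_subalgebra br [set` h] -> ES \in h -> simple_roots br B ->
  let B0 := [set` B] `&` roots_in br gs 0 in
  let Bj e := [set` B] `&` roots_at br gs JS e in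
  [set` B] = B0 `|` Bj 'i `|` Bj (- 'i) ->
  grade gsL ESd glM irr (-1) <> 0%VS ->
  CR_partition (weights act) (weights_in act gl (-1)) B0 (Bj 'i) (Bj (- 'i)) ->
  exists c0, scalar_cond JS gsL ESd glM irr c0.
Proof.
move=> nab trans JS0 JS2 JScomm hC hES sB B0 Bj BE L1.
move=> [P10 [P01 [Pm1 _ [st1 st2 st3 st4] [b1 b2 b3 b4]]]].
(* The parts are indexed by the eigenvalues ['i] and [- 'i], so that both are treated at once. *)
pose Pe (e : C) := if e == 'i then P10 else P01.
have Ni : - 'i == 'i :> C = false.
  by apply: negbTE; rewrite eq_sym -addr_eq0; apply: double_neq0; left.
have Pei : Pe 'i = P10 by rewrite /Pe eqxx.
have PeNi : Pe (- 'i) = P01 by rewrite /Pe Ni.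
have empty (A Q : set 'Hom(subvs_of h, C^o)) x : A `&` Q = set0 -> A x -> ~ Q x.
  by move=> AQ Ax Qx; have : (A `&` Q) x by []; rewrite AQ.
apply: (partition_scalar nab trans JS0 JS2 JScomm hC hES sB BE L1 (Pe := Pe)).
- by move=> e lam [->|->]; rewrite ?Pei ?PeNi Pm1; [left | right].
- by move=> lam; rewrite Pei PeNi Pm1; case; [left | right].
- move=> f lam b [] If fl bB; rewrite ?expr1 ?expr0 ?scaleN1r ?scale1r => wl;
    case: If fl => ->; rewrite ?Pei ?PeNi => fl.
  + by apply: st2; split=> //; exists lam => //; exists b.
  + by apply: st4; split=> //; exists lam => //; exists b.
  + by apply: st1; split=> //; exists lam => //; exists b.
  + by apply: st3; split=> //; exists lam => //; exists b.
- move=> f lam b [->|->]; rewrite ?Pei ?PeNi => fl bB.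
    by apply: (empty _ _ _ b1); exists lam => //; exists b.
  by apply: (empty _ _ _ b3); exists lam => //; exists b.
move=> f lam b [->|->]; rewrite ?Pei ?PeNi ?opprK => fl bB.
  by apply: (empty _ _ _ b2); exists lam => //; exists b.
by apply: (empty _ _ _ b4); exists lam => //; exists b.
Qed.

Theorem theorem3p20 (R : realType) (s l : vectType R[i])
    (br : s -> s -> s) (gs : int -> set s) (J : s -> s)
    (act : s -> l -> l) (gl : int -> set l)
    (JS ES : s) (h : {vspace s}) (B : seq 'Hom(subvs_of h, R[i]^o)) :
  (* s, with bracket br and gradation gs, is a fundamental transitive semisimple
     graded CR algebra of the complex type *)
  graded_lie_algebra br gs ->
  @graded_CR_algebra R (realified s) br gs J ->
  @fundamental_gr R (realified s) (realified s) gs br gs ->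
  @transitive_gr R (realified s) (realified s) gs br gs ->
  @lie_semisimple R (realified s) br ->
  (* l, with action act and gradation gl, is a complex irreducible graded
     representation of s *)
  graded_module br gs act gl ->
  lie_irreducible act ->
  gl (-1) <> [set 0] ->
  gl (-2) <> [set 0] ->
  (* the elements J_s and E_s *)
  gs 0 JS ->
  (forall X, gs (-1) X -> br JS X = J X) ->
  (forall p X, gs p X -> br ES X = p%:~R *: X) ->
  (* the Cartan subalgebra h and the system B of simple roots *)
  cartan_subalgebra br [set` h] ->
  ES \in h ->
  let P := weights act in
  let P_ p := weights_in act gl p in
  let R_ p := roots_in br gs p in
  let R10 := roots_at br gs JS 'i in
  let R01 := roots_at br gs JS (- 'i) in
  simple_roots br B ->
  (forall alpha, negative_root br B alpha ->
     weight_space br alpha `<=` plus_part gs) ->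
  let B0 := [set` B] `&` R_ 0 in
  let B10 := [set` B] `&` R10 in
  let B01 := [set` B] `&` R01 in
  [set` B] = B0 `|` B10 `|` B01 ->
  let cond_i := @partial_Levi_Tanaka R (realified s) (realified l)
                  br gs J act gl in
  let cond_ii := exists c : R[i], forall Y0 Y2, gl 0 Y0 -> gl (-2) Y2 ->
                   act JS (Y0 + Y2) = c *: (Y0 + Y2) in
  let cond_iii := no_forbidden_weight P (P_ (-2)) R10 R01 in
  let cond_iv := CR_partition P (P_ (-1)) B0 B10 B01 in
  [/\ cond_i -> cond_ii,
      @trivial_common_kernel R (realified s) (realified l) br gs act ->
        cond_ii -> cond_i,
      cond_ii <-> cond_iii
    & cond_iii <-> cond_iv].
Proof.
move=> gsL sCR fund rtrans ss glM irr gl1 gl2 JS0 JSJ ESd hC hES P P_ R_ R10 R01 sB _.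
move=> B0 B10 B01 BE cond_i cond_ii cond_iii cond_iv.
have nab := semisimple_no_abelian_ideal ss.
have trans : transitive_gr gs br gs := rtrans.
have JS2 := CR_JS2 sCR JSJ.
have JScomm := CR_JScomm gsL sCR JSJ.
have LN0 p : gl p <> [set 0] -> grade gsL ESd glM irr p <> 0%VS.
  move=> glp Lp; apply: glp; apply/seteqP; split=> [v /= vp|_ ->].
    by apply/eqP; rewrite -memv0 -Lp; apply/glP.
  by apply/(glP gsL ESd glM irr); rewrite mem0v.
have [L1 L2] := (LN0 _ gl1, LN0 _ gl2).
(* Taking one of the two vectors to be zero separates the components. *)
have iiP : cond_ii <-> exists c0, scalar_cond JS gsL ESd glM irr c0.
  have [actM _ _] := glM.
  have gl0 p : gl p 0 by apply/(glP gsL ESd glM irr); rewrite mem0v.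
  split=> -[c0 sc]; exists c0.
    by move=> p v [->|->] /(glP gsL ESd glM irr) vp;
      [have := sc v 0 vp (gl0 _) | have := sc 0 v (gl0 _) vp]; rewrite ?addr0 ?add0r.
  move=> Y0 Y2 /(glP gsL ESd glM irr) Y00 /(glP gsL ESd glM irr) Y22.
  by rewrite (actDr actM) scalerDr (sc _ _ (or_introl erefl) Y00) (sc _ _ (or_intror erefl) Y22).
have iii_scalar : cond_iii -> exists c0, scalar_cond JS gsL ESd glM irr c0.
  exact: (no_forbidden_scalar nab trans JS0 JS2 JScomm hC hES L2).
have scalar_iii c0 : scalar_cond JS gsL ESd glM irr c0 -> cond_iii.
  exact: (scalar_no_forbidden nab trans JS0 JScomm hC hES).
split.
- move=> ci; apply/iiP.
  exact: (Levi_Tanaka_scalar sCR nab trans JS0 JSJ hC hES L1 ci).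
- move=> tck /iiP[c0 sc].
  exact: (scalar_Levi_Tanaka sCR fund nab trans JS0 JSJ L1 L2 sc tck).
- by split=> [/iiP[c0 /scalar_iii]|/iii_scalar/iiP].
split=> [/iii_scalar[c0 sc]|civ].
  exact: (scalar_CR_partition nab trans JS0 JS2 JScomm hC hES B L2 sc).
have [c0 sc] := CR_partition_scalar nab trans JS0 JS2 JScomm hC hES sB BE L1 civ.
exact: scalar_iii sc.
Qed.
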